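(* Let $d\ge1$, $m>2$, $\chi>0$, $\beta\ge0$ and $M>0$. For any $s\in(0,1/2)$, let $\rho_s\in\mathcal{Y}_M$ be the unique minimizer of $\mathcal{F}_s$ over $\mathcal{Y}_M$. If $0\le\beta<\chi/2$, there exists $\rho\in\mathcal{Y}_M$ such that $\rho_s\to\rho$ strongly in $L^m(\mathbb{R}^d)$ as $s\downarrow0$, and moreover $\rho$ is the unique radially decreasing minimizer of the functional $\mathcal{F}_0$ over $\mathcal{Y}_M$. If instead $\beta\ge\chi/2$, then $\lim_{s\downarrow0}\mathcal{F}_s[\rho_s]=0$ and $\rho_s\to0$ uniformly on $\mathbb{R}^d$ as $s\downarrow 0$.
   Context: $K_s(x)=c_{d,s}|x|^{2s-d}$ is the Riesz kernel, with $c_{d,s}=\pi^{-d/2}2^{-2s}\,\Gamma(\tfrac d2-s)/\Gamma(s)$. $\mathcal{F}_s[\rho]=\frac{1}{m-1}\int_{\mathbb{R}^d}\rho^m\,dx+\beta\int_{\mathbb{R}^d}\rho^2\,dx-\frac{\chi}{2}\int_{\mathbb{R}^d}\int_{\mathbb{R}^d}K_s(x-y)\rho(x)\rho(y)\,dx\,dy$. $\mathcal{F}_0[\rho]=\frac{1}{m-1}\int_{\mathbb{R}^d}\rho^m\,dx+\left(\beta-\frac{\chi}{2}\right)\int_{\mathbb{R}^d}\rho^2\,dx$. $\mathcal{Y}_M=\{\rho\in L^1(\mathbb{R}^d)\cap L^m(\mathbb{R}^d):\ \rho\ge 0,\ \int\rho\,dx=M,\ \int x\rho(x)\,dx=0\}$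 (with $x\rho\in L^1$). ''Radially decreasing'' means radially symmetric about the origin and nonincreasing in $|x|$. For each $s\in(0,1/2)$ the minimizer of $\mathcal{F}_s$ over $\mathcal{Y}_M$ exists and is unique. *)

(* Defs.v *)
From HB Require Import structures.
From mathcomp Require Import all_boot all_order all_algebra.
From mathcomp Require Import all_classical all_reals all_analysis.

Set Implicit Arguments.
Unset Strict Implicit.
Unset Printing Implicit Defensive.

Import Order.TTheory GRing.Theory Num.Theory.
Import numFieldNormedType.Exports.

Local Open Scope classical_set_scope.
Local Open Scope ring_scope.

Definition measure_rV_display : measure_display -> measure_display.
Proof. exact. Qed.

Section measurable_rV.
Context {disp : measure_display} {T : measurableType disp} (n : nat).

Let coors : 'I_n -> 'rV[T]_n -> T := fun i x => x ord0 i.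

Let rV_set0 : g_sigma_preimage coors set0.
Proof. exact: sigma_algebra0. Qed.

Let rV_setC A : g_sigma_preimage coors A -> g_sigma_preimage coors (~` A).
Proof. exact: sigma_algebraC. Qed.

Let rV_bigcup (F : (set 'rV[T]_n)^nat) :
  (forall i, g_sigma_preimage coors (F i)) ->
  g_sigma_preimage coors (\bigcup_i (F i)).
Proof. exact: sigma_algebra_bigcup. Qed.

(* The product sigma-algebra, generated by the coordinates; for T = R it is the
   Borel sigma-algebra of R^n. *)
HB.instance Definition _ := @isMeasurable.Build (measure_rV_display disp)
  'rV[T]_n (g_sigma_preimage coors) rV_set0 rV_setC rV_bigcup.

End measurable_rV.

Lemma measurable_rV_coord disp (T : measurableType disp) n (i : 'I_n) :
  measurable_fun [set: 'rV[T]_n] (fun x : 'rV[T]_n => x ord0 i).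
Proof.
move=> _ Y mY; rewrite setTI; apply: sub_sigma_algebra => /=.
rewrite -bigcup_seq/=; exists i => /=; first by rewrite mem_index_enum.
by exists Y => //; rewrite setTI.
Qed.

Lemma measurable_fun_rV disp disp' (U : measurableType disp')
    (T : measurableType disp) n (f : U -> 'rV[T]_n) :
  (forall i, measurable_fun [set: U] (fun u => f u ord0 i)) ->
  measurable_fun [set: U] f.
Proof.
move=> mf; apply: (measurability (\big[setU/set0]_(i < n)
  preimage_set_system setT (fun x : 'rV[T]_n => x ord0 i) measurable)) => //.
move=> _ [B + <-]; rewrite -bigcup_seq/= => -[i _ [A mA <-]].
by rewrite !setTI -[X in measurable X]setTI; exact: (mf i).
Qed.

Definition rV_cons {T : Type} {n : nat} (p : T * 'rV[T]_n) : 'rV[T]_n.+1 :=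
  row_mx (const_mx p.1 : 'rV[T]_1) p.2.

Definition rV_uncons {T : Type} {n : nat} (x : 'rV[T]_n.+1) : T * 'rV[T]_n :=
  (x ord0 ord0, rsubmx (x : 'rV[T]_(1 + n))).

Lemma rV_cons0 {T : Type} {n : nat} (p : T * 'rV[T]_n) :
  rV_cons p ord0 ord0 = p.1.
Proof.
transitivity (row_mx (const_mx p.1 : 'rV_1) p.2 ord0 (lshift n ord0)).
  by congr (row_mx _ _ _ _); exact/val_inj.
by rewrite row_mxEl mxE.
Qed.

Lemma rV_consS {T : Type} {n : nat} (p : T * 'rV[T]_n) i :
  rV_cons p ord0 (lift ord0 i) = p.2 ord0 i.
Proof.
transitivity (row_mx (const_mx p.1 : 'rV_1) p.2 ord0 (rshift 1 i)).
  by congr (row_mx _ _ _ _); exact/val_inj.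
by rewrite row_mxEr.
Qed.

Lemma rV_consK {T : Type} {n : nat} : cancel (@rV_cons T n) rV_uncons.
Proof. by case=> a x; rewrite /rV_uncons rV_cons0 row_mxKr. Qed.

Lemma measurable_rV_cons disp (T : measurableType disp) n :
  measurable_fun setT (@rV_cons T n).
Proof.
apply: measurable_fun_rV => i; case: (unliftP ord0 i) => [j ->|->].
  rewrite (_ : (fun _ => _) = (fun x : 'rV[T]_n => x ord0 j) \o snd); last first.
    by apply/funext => p; rewrite /= rV_consS.
  by apply: measurableT_comp => //; exact: measurable_rV_coord.
rewrite (_ : (fun _ => _) = fst) //.
by apply/funext => p; rewrite /= rV_cons0.
Qed.

Lemma measurable_rV_uncons disp (T : measurableType disp) n :
  measurable_fun setT (@rV_uncons T n).
Proof.
apply/measurable_fun_pair => /=; first exact: measurable_rV_coord.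
apply: measurable_fun_rV => i.
rewrite (_ : (fun _ => _) = fun x : 'rV[T]_n.+1 => x ord0 (lift ord0 i)).
  exact: measurable_rV_coord.
by apply/funext => x; rewrite mxE; congr (x _ _); exact/val_inj.
Qed.

Section lebesgue_rV_step.
Context {R : realType} {n : nat}.
Variable mu : {sigma_finite_measure set 'rV[R]_n -> \bar R}.

Definition lebesgue_rVS : set 'rV[R]_n.+1 -> \bar R :=
  pushforward (@lebesgue_measure R \x mu)%E rV_cons.

Let pre_measurable (A : set 'rV[R]_n.+1) : measurable A ->
  measurable (rV_cons @^-1` A : set (measurableTypeR R * 'rV[R]_n)).
Proof.
by move=> mA; rewrite -[X in measurable X]setTI; exact: measurable_rV_cons.
Qed.

Let lebesgue_rVS0 : lebesgue_rVS set0 = 0%E.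
Proof. by rewrite /lebesgue_rVS /pushforward preimage_set0 measure0. Qed.

Let lebesgue_rVS_ge0 A : (0 <= lebesgue_rVS A)%E.
Proof. by rewrite /lebesgue_rVS /pushforward; exact: measure_ge0. Qed.

Let lebesgue_rVS_sigma_additive : semi_sigma_additive lebesgue_rVS.
Proof.
move=> F mF tF mUF; rewrite /lebesgue_rVS /pushforward preimage_bigcup.
apply: measure_semi_sigma_additive.
- by move=> k; exact: pre_measurable.
- apply/trivIsetP => /= i j _ _ ij; rewrite -preimage_setI.
  by move/trivIsetP : tF => /(_ _ _ _ _ ij) ->//; rewrite preimage_set0.
- by rewrite -preimage_bigcup; exact: pre_measurable.
Qed.

HB.instance Definition _ := isMeasure.Build _ _ _ lebesgue_rVS
  lebesgue_rVS0 lebesgue_rVS_ge0 lebesgue_rVS_sigma_additive.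

Let lebesgue_rVS_sigma_finite : sigma_finite setT lebesgue_rVS.
Proof.
have /sigma_finiteP[F [TF ndF mF]] := sigma_finiteT (@lebesgue_measure R).
have /sigma_finiteP[G [TG ndG mG]] := sigma_finiteT mu.
exists (fun k => rV_uncons @^-1` (F k `*` G k)).
  rewrite -preimage_bigcup -[LHS](preimage_setT rV_uncons); congr (_ @^-1` _).
  apply/esym/seteqP; split => // -[a x] _.
  have [i _ Fi] : (\bigcup_i F i) a by rewrite -TF.
  have [j _ Gj] : (\bigcup_i G i) x by rewrite -TG.
  exists (maxn i j) => //; split => /=.
    by move: a Fi; exact/subsetPset/ndF/leq_maxl.
  by move: x Gj; exact/subsetPset/ndG/leq_maxr.
move=> k; have [mFk Fk] := mF k; have [mGk Gk] := mG k; split.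
  rewrite -[X in measurable X]setTI.
  by apply: (@measurable_rV_uncons _ (measurableTypeR R)) => //; exact: measurableX.
rewrite /lebesgue_rVS /pushforward -comp_preimage.
rewrite (_ : _ \o _ = id); last by apply/funext => p; exact: rV_consK.
by rewrite preimage_id product_measure1E// lte_mul_pinfty// ge0_fin_numE.
Qed.

HB.instance Definition _ := Measure_isSigmaFinite.Build _ _ _ lebesgue_rVS
  lebesgue_rVS_sigma_finite.

End lebesgue_rV_step.

(* Lebesgue measure on R^n, by recursion on n: the unit mass on R^0, and the
   product of Lebesgue measure on R with that of R^n on R^n.+1. *)
Fixpoint lebesgue_rV (R : realType) (n : nat) :
    {sigma_finite_measure set 'rV[R]_n -> \bar R} :=
  if n is n'.+1 then lebesgue_rVS (lebesgue_rV R n') else \d_ (0 : 'rV[R]_0).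

Lemma lebesgue_rV_box (R : realType) (n : nat) (A : 'I_n -> set R) :
  (forall i, measurable (A i)) ->
  lebesgue_rV R n [set x | forall i, A i (x ord0 i)] =
    (\prod_(i < n) lebesgue_measure (A i))%E.
Proof.
elim: n A => [|n IH] A mA.
  by rewrite big_ord0 /= diracE mem_set//= => -[].
pose B := [set x : 'rV[R]_n | forall i, A (lift ord0 i) (x ord0 i)].
have mB : measurable B.
  rewrite (_ : B = \bigcap_(i in [set: 'I_n])
      ((fun x : 'rV[R]_n => x ord0 i) @^-1` A (lift ord0 i))).
    apply: fin_bigcap_measurable => // i _; rewrite -[X in measurable X]setTI.
    exact: measurable_rV_coord.
  by apply/seteqP; split => x /= Ax i; [move=> _; exact: Ax|exact: (Ax i I)].
rewrite big_ord_recl -IH//= /lebesgue_rVS /pushforward.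
rewrite (_ : _ @^-1` _ = A ord0 `*` B).
  apply: (@product_measure1E _ _ (measurableTypeR R)) => //.
  exact: (mA ord0).
apply/seteqP; split => [p /= Ap|p [/= Ap0 ApS] i].
  by split => [|i]; [rewrite -[p.1]rV_cons0|rewrite -rV_consS].
by case: (unliftP ord0 i) => [j ->|->]; rewrite ?rV_consS ?rV_cons0.
Qed.

Section riesz_free_energies.
Context {R : realType}.

Definition Gamma (x : R) : R :=
  \int[lebesgue_measure]_(t in `]0, +oo[) (t `^ (x - 1) * expR (- t)).

(* The Euclidean norm; the library's `|x| on 'rV[R]_d is the maximum norm. *)
Definition enorm {d : nat} (x : 'rV[R]_d) : R :=
  Num.sqrt (\sum_(i < d) x ord0 i ^+ 2).

Definition riesz_const (d : nat) (s : R) : R :=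
  pi `^ (- (d%:R / 2)) * 2 `^ (- (2 * s)) * Gamma (d%:R / 2 - s) / Gamma s.

(* Since powR 0 p = 0 for p != 0, the kernel takes the value 0 rather than +oo
   at x = 0 when 2 * s < d; the diagonal {x = y} is negligible in the double
   integral below. *)
Definition riesz_kernel {d : nat} (s : R) (x : 'rV[R]_d) : R :=
  riesz_const d s * enorm x `^ (2 * s - d%:R).

(* Functions stand for their almost-everywhere classes. *)
Definition density {d : nat} (m M : R) : set ('rV[R]_d -> R) :=
  [set rho | [/\ rho \in Lfun (lebesgue_rV R d) 1%:E,
                 rho \in Lfun (lebesgue_rV R d) m%:E,
                 forall x, 0 <= rho x,
                 \int[lebesgue_rV R d]_x rho x = M
               & forall i : 'I_d,
                   (fun x : 'rV[R]_d => x ord0 i * rho x)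
                     \in Lfun (lebesgue_rV R d) 1%:E /\
                   \int[lebesgue_rV R d]_x (x ord0 i * rho x) = 0]].

Local Open Scope ereal_scope.

(* All the integrals below are finite on density m M when m > 2 and 0 < s < 1/2,
   so that no difference +oo - +oo occurs there. *)
Definition free_energy {d : nat} (m chi beta s : R) (rho : 'rV[R]_d -> R)
    : \bar R :=
  ((m - 1)^-1)%:E * \int[lebesgue_rV R d]_x (rho x `^ m)%:E
  + beta%:E * \int[lebesgue_rV R d]_x (rho x ^+ 2)%:E
  - (chi / 2)%:E * \int[lebesgue_rV R d]_x \int[lebesgue_rV R d]_y
      (riesz_kernel s (x - y)%R * rho x * rho y)%:E.

Definition free_energy0 {d : nat} (m chi beta : R) (rho : 'rV[R]_d -> R)
    : \bar R :=
  ((m - 1)^-1)%:E * \int[lebesgue_rV R d]_x (rho x `^ m)%:E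
  + (beta - chi / 2)%:E * \int[lebesgue_rV R d]_x (rho x ^+ 2)%:E.

Definition minimizer {V : Type} (F : V -> \bar R) (Y : set V) : set V :=
  [set rho | Y rho /\ forall eta, Y eta -> F rho <= F eta].

Local Close Scope ereal_scope.

Definition ae_unique {d : nat} (P : set ('rV[R]_d -> R)) (rho : 'rV[R]_d -> R) :=
  P rho /\ forall eta, P eta -> eta = rho %[ae lebesgue_rV R d].

Definition radially_decreasing {d : nat} : set ('rV[R]_d -> R) :=
  [set rho | (forall x y, enorm x = enorm y -> rho x = rho y) /\
             (forall x y, enorm x <= enorm y -> rho y <= rho x)].

End riesz_free_energies.

(* Main.v *)
(** The Riesz kernel splits into a part near the origin, of mass [A s -> 1], and a
    bounded remainder of size [c s -> 0]; hence the interaction of a density of mass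
    [M] with itself is at most [A s * \int rho^2 + c s * M^2].

    If [chi / 2 <= beta], the minimizer is compared with the density obtained by
    cutting it off at a level [h] and spreading the mass removed over a huge ball:
    for small [s] the gain in [\int rho^m] beats the loss in interaction energy,
    unless no mass was removed, so [rho_s <= h] almost everywhere.

    If [beta < chi / 2], put [a = chi / 2 - beta] and [T = a^(1/(m-2))]. Up to a
    constant, [F_0] is the integral of [g(rho)], where the double well
    [g t = t^m / (m - 1) - a t^2 + lam t] is nonnegative and vanishes only at [0] and
    [T]. Testing minimality with [T * 1_B], where [B] is the centered ball of volume
    [M / T], shows that [\int g(rho_s) -> 0]: [rho_s] is close to [T] times the
    indicator of [A = {rho_s > T / 2}]. Polarization does not increase [F_s], so by
    uniqueness every polarization of [rho_s] towards the origin is, up to null sets,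
    a translate of [rho_s]; as [rho_s] is even and polarization decreases the first
    moment, [rho_s] is fixed by it. Therefore [A] and [B] are nested up to null sets,
    and the measure of their symmetric difference is [| |A| - |B| |], which tends
    to [0]. *)
Require Import Defs.
From mathcomp Require Import all_boot all_order all_algebra.
From mathcomp Require Import all_classical all_reals all_analysis.
From mathcomp Require Import measurable_realfun lebesgue_integral ring lra.

Import Order.TTheory GRing.Theory Num.Theory.
Import numFieldNormedType.Exports.

Local Open Scope classical_set_scope.
Local Open Scope ring_scope.

Set Implicit Arguments.
Unset Strict Implicit.
Unset Printing Implicit Defensive.

(** * Lebesgue measure on row vectors *)

(** For the energies, the delicate error is [(A s - 1) * \int rho_s^2], as no bound on the square
    integral is known beforehand. It is absorbed each time: into half of the power energy when
    [chi / 2 <= beta], into half of [\int g(rho_s)] otherwise.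

    The double well alone cannot select a limit: [F_0] does not see where the level set sits, and
    [T] times the indicator of any bounded centered set of volume [M / T] is a minimizer. The ball
    must come from the symmetry of [rho_s], and single reflections do the work of a rearrangement
    inequality together with its equality case. Radial symmetry of [rho_s] is never derived, only
    that one of [A \ B] and [B \ A] is null. Two points, one in each set, call for a reflection of
    their own, whose inequality holds only off a null set of its own. Integrating over all
    displacements between the two sets avoids a union of uncountably many null sets.

    The constraint on the center of mass makes evenness useful twice: competitors built by
    truncation stay centered, and the unknown translation that recenters a polarized density does no
    harm. *)

Section change_of_variables.
Context d1 d2 (X : measurableType d1) (Y : measurableType d2) (R : realType).
Variables (phi : X -> Y) (mu : {measure set X -> \bar R}).
Hypothesis mphi : measurable_fun setT phi.

Definition pushforward_meas : {measure set Y -> \bar R} :=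
  measure_function_pushforward__canonical__measure_function_Measure mu mphi.

Lemma integral_pushforward_meas (f : Y -> \bar R) :
  measurable_fun setT f -> (forall y, 0 <= f y)%E ->
  (\int[pushforward_meas]_y f y = \int[mu]_x f (phi x))%E.
Proof. by move=> mf f0; rewrite (ge0_integral_pushforward mphi mu measurableT). Qed.

Lemma integral_change_of_variables (nu : {measure set Y -> \bar R})
    (c : {nonneg R}) (f : Y -> \bar R) :
  (forall A, measurable A -> nu A = c%:num%:E * mu (phi @^-1` A))%E ->
  measurable_fun setT f -> (forall y, 0 <= f y)%E ->
  (\int[nu]_y f y = c%:num%:E * \int[mu]_x f (phi x))%E.
Proof.
move=> nuE mf f0; rewrite -integral_pushforward_meas// -ge0_integral_mscale//.
by apply: eq_measure_integral => A mA _; exact: nuE.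
Qed.

End change_of_variables.

Section affine1.
Context {R : realType}.
Local Notation leb := (@lebesgue_measure R).
Implicit Types (f : R -> \bar R) (a c : R).

Let aff c a (t : measurableTypeR R) : measurableTypeR R := c * t + a.

Let measurable_aff c a : measurable_fun setT (aff c a).
Proof. by apply: measurable_funD => //; exact: measurable_funM. Qed.

Lemma lebesgue_measure_affine c a (A : set (measurableTypeR R)) :
  c != 0 -> measurable A ->
  leb A = (`|c|%:E * leb (aff c a @^-1` A))%E.
Proof.
move=> c0 mA.
pose nu := mscale (NngNum (normr_ge0 c))
  (pushforward_meas leb (measurable_aff c a)).
rewrite -[RHS]/(nu A); apply: (@lebesgue_measure_unique R nu) => // _ [[x y]] _ <-.
transitivity (`|c|%:E * leb (aff c a @^-1` `]x, y]))%E => //.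
rewrite lebesgue_measure_itv.
have [cn|cp|c00] := ltgtP c 0; last by rewrite c00 eqxx in c0.
(* A negative slope reverses the interval, so the closed end changes sides. *)
- rewrite [X in lebesgue_measure X](_ : _ = `[(y - a) / c, (x - a) / c[%classic); last first.
    apply/seteqP; split => t /=; rewrite !in_itv/= /aff => /andP[h1 h2].
      by rewrite ler_ndivrMr// ltr_ndivlMr// (mulrC t); apply/andP; split; lra.
    move: h1 h2; rewrite ler_ndivrMr// ltr_ndivlMr// (mulrC t) => h1 h2.
    by apply/andP; split; lra.
  rewrite lebesgue_measure_itv/= !lte_fin ltr_nM2r ?invr_lt0// ltrD2r.
  case: ifPn => xy; last by rewrite mule0.
  by rewrite -!EFinD -EFinM ltr0_norm//; congr EFin; field.
- rewrite [X in lebesgue_measure X](_ : _ = `](x - a) / c, (y - a) / c]%classic); last first.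
    apply/seteqP; split => t /=; rewrite !in_itv/= /aff => /andP[h1 h2].
      by rewrite ler_pdivlMr// ltr_pdivrMr// (mulrC t); apply/andP; split; lra.
    move: h1 h2; rewrite ler_pdivlMr// ltr_pdivrMr// (mulrC t) => h1 h2.
    by apply/andP; split; lra.
  rewrite lebesgue_measure_itv/= !lte_fin ltr_pM2r ?invr_gt0// ltrD2r.
  case: ifPn => xy; last by rewrite mule0.
  by rewrite -!EFinD -EFinM gtr0_norm//; congr EFin; field.
Qed.

Lemma integral_affine c a f : c != 0 -> measurable_fun setT f ->
  (forall t, 0 <= f t)%E ->
  (\int[leb]_t f t = `|c|%:E * \int[leb]_t f (c * t + a)%R)%E.
Proof.
move=> c0 mf f0.
rewrite (integral_change_of_variables (mu := leb) (measurable_aff c a)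
  (c := NngNum (normr_ge0 c)) _ mf f0)// => A mA.
exact: lebesgue_measure_affine.
Qed.

End affine1.

Section measurability_rV.
Context d (U : measurableType d) {R : realType} {n : nat}.
Implicit Types (f g : U -> 'rV[R]_n) (k : U -> R).

Lemma measurable_fun_coord f i : measurable_fun setT f ->
  measurable_fun setT (fun u => f u ord0 i).
Proof. by move=> mf; exact: (measurableT_comp (measurable_rV_coord i) mf). Qed.

Lemma measurable_rVD f g : measurable_fun setT f -> measurable_fun setT g ->
  measurable_fun setT (fun u => f u + g u).
Proof.
move=> mf mg; apply: measurable_fun_rV => i.
rewrite (_ : (fun _ => _) = (fun u => f u ord0 i + g u ord0 i)).
  by apply: measurable_funD; exact: measurable_fun_coord.
by apply/funext => u; rewrite mxE.
Qed.

Lemma measurable_rVZ k f : measurable_fun setT k -> measurable_fun setT f ->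
  measurable_fun setT (fun u => k u *: f u).
Proof.
move=> mk mf; apply: measurable_fun_rV => i.
rewrite (_ : (fun _ => _) = (fun u => k u * f u ord0 i)).
  by apply: measurable_funM => //; exact: measurable_fun_coord.
by apply/funext => u; rewrite mxE.
Qed.

Lemma measurable_rVB f g : measurable_fun setT f -> measurable_fun setT g ->
  measurable_fun setT (fun u => f u - g u).
Proof.
move=> mf mg; apply: measurable_fun_rV => i.
rewrite (_ : (fun _ => _) = (fun u => f u ord0 i - g u ord0 i)).
  by apply: measurable_funB; exact: measurable_fun_coord.
by apply/funext => u; rewrite !mxE.
Qed.

End measurability_rV.

Lemma rV_unconsK {T : Type} {n : nat} : cancel (@rV_uncons T n) rV_cons.
Proof.
move=> x; apply/rowP => i; case: (unliftP ord0 i) => [j ->|->].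
  by rewrite rV_consS /= mxE; congr (x _ _); exact/val_inj.
by rewrite rV_cons0.
Qed.

Section lebesgue_rV_change_of_variables.
Context {R : realType}.
Local Notation leb := (@lebesgue_measure R).

Lemma integral_lebesgue_rVS n (f : 'rV[R]_n.+1 -> \bar R) :
  measurable_fun setT f -> (forall x, 0 <= f x)%E ->
  (\int[lebesgue_rV R n.+1]_x f x =
   \int[leb]_t \int[lebesgue_rV R n]_x f (rV_cons (t, x)))%E.
Proof.
move=> mf f0.
have -> := @integral_change_of_variables _ _ _ 'rV[R]_n.+1 R _ (leb \x lebesgue_rV R n)%E
  (@measurable_rV_cons _ (measurableTypeR R) n) (lebesgue_rV R n.+1) 1%:nng f
  _ mf f0; last by move=> A mA; rewrite mul1e.
rewrite mul1e fubini_tonelli1//.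
by apply: (measurableT_comp mf); exact: measurable_rV_cons.
Qed.

Lemma rV_cons_affine n (c t t0 : R) (x x0 : 'rV[R]_n) :
  rV_cons (c * t + t0, c *: x + x0) = c *: rV_cons (t, x) + rV_cons (t0, x0).
Proof.
apply/rowP => i; case: (unliftP ord0 i) => [j ->|->].
  by rewrite [RHS]mxE [X in _ = X + _]mxE !rV_consS !mxE.
by rewrite [RHS]mxE [X in _ = X + _]mxE !rV_cons0.
Qed.

(** Induction on the dimension: the tail contributes [|c|^n] by the induction hypothesis, the head
    one more factor by [integral_affine]. Translations, dilations and the central symmetry are all
    instances. *)
Lemma integral_affine_rV n (c : R) (a : 'rV[R]_n) (f : 'rV[R]_n -> \bar R) : c != 0 ->
  measurable_fun setT f -> (forall x, 0 <= f x)%E ->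
  (\int[lebesgue_rV R n]_x f x =
   (`|c| ^+ n)%:E * \int[lebesgue_rV R n]_x f (c *: x + a)%R)%E.
Proof.
move=> c0; elim: n a f => [|n IH] a f mf f0.
  rewrite expr0 mul1e; apply: eq_integral => x _; congr f.
  by apply/rowP => -[].
have mfc : measurable_fun setT
    (fun p : measurableTypeR R * 'rV[R]_n => f (rV_cons p)).
  by apply: (measurableT_comp mf); exact: measurable_rV_cons.
have mfa : measurable_fun setT (fun x : 'rV[R]_n.+1 => f (c *: x + a)).
  apply: (measurableT_comp mf); apply: measurable_rVD => //.
  exact: measurable_rVZ.
rewrite -[a]rV_unconsK in mfa *; case: (rV_uncons a) mfa => t0 x0 mfa {a}.
rewrite !integral_lebesgue_rVS//.
under eq_integral => t _.
  rewrite (IH x0); last 2 first.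
  - exact: (measurableT_comp mfc).
  - by [].
  over.
have mG : measurable_fun setT (fun p : measurableTypeR R * 'rV[R]_n =>
    f (rV_cons (p.1, c *: p.2 + x0))).
  apply: (measurableT_comp mfc); apply/measurable_fun_pair => //=.
  by apply: measurable_rVD => //; exact: measurable_rVZ.
have mI := measurable_fun_fubini_tonelli_F (m2 := lebesgue_rV R n) _ mG
  (fun p => f0 _).
rewrite ge0_integralZl_EFin ?exprn_ge0//; last by move=> t _; exact: integral_ge0.
rewrite (integral_affine t0 c0 mI); last by move=> t; exact: integral_ge0.
rewrite muleA -EFinM -exprSr; congr (_ * _)%E.
apply: eq_integral => t _; apply: eq_integral => x _ /=.
by rewrite rV_cons_affine.
Qed.

Lemma integral_translate_rV n (a : 'rV[R]_n) (f : 'rV[R]_n -> \bar R) :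
  measurable_fun setT f -> (forall x, 0 <= f x)%E ->
  (\int[lebesgue_rV R n]_x f (x + a)%R = \int[lebesgue_rV R n]_x f x)%E.
Proof.
move=> mf f0; rewrite [RHS](@integral_affine_rV n 1 a)// normr1 expr1n mul1e.
by apply: eq_integral => x _; rewrite scale1r.
Qed.

Lemma integral_opp_rV n (f : 'rV[R]_n -> \bar R) :
  measurable_fun setT f -> (forall x, 0 <= f x)%E ->
  (\int[lebesgue_rV R n]_x f (- x)%R = \int[lebesgue_rV R n]_x f x)%E.
Proof.
move=> mf f0; rewrite [RHS](@integral_affine_rV n (-1) 0)// ?oppr_eq0 ?oner_eq0//.
rewrite normrN normr1 expr1n mul1e.
by apply: eq_integral => x _; rewrite scaleN1r addr0.
Qed.

End lebesgue_rV_change_of_variables.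

(** * Euclidean geometry *)

Section euclidean.
Context {R : realType} {n : nat}.
Implicit Types (x y v : 'rV[R]_n) (k : R).

Definition dot x y : R := \sum_(i < n) x ord0 i * y ord0 i.

Definition sqnorm x : R := \sum_(i < n) x ord0 i ^+ 2.

Lemma dotC x y : dot x y = dot y x.
Proof. by apply: eq_bigr => i _; rewrite mulrC. Qed.

Lemma dotDl x y v : dot (x + y) v = dot x v + dot y v.
Proof. by rewrite -big_split; apply: eq_bigr => i _; rewrite mxE mulrDl. Qed.

Lemma dotZl k x v : dot (k *: x) v = k * dot x v.
Proof. by rewrite mulr_sumr; apply: eq_bigr => i _; rewrite mxE mulrA. Qed.

Lemma dotBl x y v : dot (x - y) v = dot x v - dot y v.
Proof. by rewrite dotDl -scaleN1r dotZl mulN1r. Qed.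

Lemma sqnormE x : sqnorm x = dot x x.
Proof. by apply: eq_bigr => i _; rewrite expr2. Qed.

Lemma sqnorm_ge0 x : 0 <= sqnorm x.
Proof. by apply: sumr_ge0 => i _; exact: sqr_ge0. Qed.

Lemma sqnormD x y : sqnorm (x + y) = sqnorm x + 2 * dot x y + sqnorm y.
Proof. by rewrite !sqnormE dotDl ![dot _ (x + y)]dotC !dotDl (dotC y x); lra. Qed.

Lemma sqnormZ k x : sqnorm (k *: x) = k ^+ 2 * sqnorm x.
Proof. by rewrite !sqnormE dotZl dotC dotZl mulrA expr2. Qed.

Lemma sqnormN x : sqnorm (- x) = sqnorm x.
Proof. by rewrite -scaleN1r sqnormZ sqrrN expr1n mul1r. Qed.

Lemma sqnorm0 : sqnorm 0 = 0.
Proof. by rewrite /sqnorm big1// => i _; rewrite mxE expr0n. Qed.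

Lemma sqnorm_eq0 x : (sqnorm x == 0) = (x == 0).
Proof.
apply/idP/eqP => [|->]; last by rewrite sqnorm0.
rewrite psumr_eq0; last by move=> i _; exact: sqr_ge0.
move=> /allP x0; apply/rowP => i; rewrite mxE.
by have := x0 i (mem_index_enum i); rewrite /= sqrf_eq0 => /eqP.
Qed.

Lemma sqnorm_gt0 x : (0 < sqnorm x) = (x != 0).
Proof. by rewrite lt_def sqnorm_ge0 andbT sqnorm_eq0. Qed.

Lemma enormE x : enorm x = Num.sqrt (sqnorm x). Proof. by []. Qed.

Lemma sqr_enorm x : enorm x ^+ 2 = sqnorm x.
Proof. by rewrite sqr_sqrtr// sqnorm_ge0. Qed.

Lemma enorm_ge0 x : 0 <= enorm x. Proof. exact: sqrtr_ge0. Qed.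

Lemma ler_enorm x y : (enorm x <= enorm y) = (sqnorm x <= sqnorm y).
Proof. by rewrite ler_sqrt// sqnorm_ge0. Qed.

Lemma ltr_enorm x y : (enorm x < enorm y) = (sqnorm x < sqnorm y).
Proof. by rewrite !ltNge ler_enorm. Qed.

Lemma enormN x : enorm (- x) = enorm x.
Proof. by rewrite !enormE sqnormN. Qed.

Lemma enormB x y : enorm (x - y) = enorm (y - x).
Proof. by rewrite -enormN opprB. Qed.

Lemma enormZ k x : enorm (k *: x) = `|k| * enorm x.
Proof. by rewrite !enormE sqnormZ sqrtrM ?sqr_ge0// sqrtr_sqr. Qed.

Lemma enorm_eq0 x : (enorm x == 0) = (x == 0).
Proof. by rewrite -sqnorm_eq0 -sqr_enorm sqrf_eq0. Qed.

(** Cauchy-Schwarz: what remains of [x] after projection onto [y] has nonnegative square norm. *)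
Lemma dot_le x y : dot x y <= enorm x * enorm y.
Proof.
have [->|y0] := eqVneq y 0.
  by rewrite dotC -(scale0r (0 : 'rV[R]_n)) dotZl mul0r mulr_ge0 ?enorm_ge0.
have qy : 0 < sqnorm y by rewrite sqnorm_gt0.
have := sqnorm_ge0 (x + (- (dot x y / sqnorm y)) *: y).
rewrite sqnormD sqnormZ dotC dotZl (dotC y).
rewrite sqrrN (_ : _ + _ = sqnorm x - (dot x y) ^+ 2 / sqnorm y); last first.
  by field; rewrite gt_eqF.
rewrite subr_ge0 ler_pdivrMr// -!sqr_enorm -exprMn => h.
rewrite (le_trans (ler_norm _))// -(ler_pXn2r (n := 2))// ?nnegrE//.
  by rewrite real_normK// num_real.
by rewrite mulr_ge0 ?enorm_ge0.
Qed.

Lemma ler_enormD x y : enorm (x + y) <= enorm x + enorm y.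
Proof.
rewrite -(ler_pXn2r (n := 2))// ?nnegrE ?addr_ge0 ?enorm_ge0//.
by rewrite sqrrD !sqr_enorm sqnormD lerD2r lerD2l; have := dot_le x y; lra.
Qed.

Lemma coord_le_enorm x i : `|x ord0 i| <= enorm x.
Proof.
rewrite -(ler_pXn2r (n := 2))// ?nnegrE ?enorm_ge0// sqr_enorm.
rewrite real_normK ?num_real// /sqnorm (bigD1 i)//= lerDl.
by apply: sumr_ge0 => j _; exact: sqr_ge0.
Qed.

Lemma sqnorm_le x k : (forall i, `|x ord0 i| <= k) -> sqnorm x <= n%:R * k ^+ 2.
Proof.
move=> xk; rewrite mulr_natl -[X in _ *+ X]card_ord -sumr_const.
apply: ler_sum => i _; rewrite -[leLHS]real_normK ?num_real//.
by rewrite ler_pXn2r// ?nnegrE// (le_trans _ (xk i)).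
Qed.

End euclidean.

Section reflection.
Context {R : realType} {n : nat}.
Implicit Types (x y v : 'rV[R]_n).

(** The linear reflection across the hyperplane orthogonal to [v], through the origin; [refl] adds a
    translation to it. *)
Definition householder v x := x - (2 * dot x v / sqnorm v) *: v.

(* Reflection across the hyperplane [dot x v = sqnorm v], of foot [v]. *)
Definition refl v x := householder v x + 2 *: v.

Lemma householderD v x y :
  householder v (x + y) = householder v x + householder v y.
Proof.
rewrite /householder dotDl mulrDr mulrDl scalerDl opprD.
by rewrite !addrA; congr (_ - _); rewrite addrAC.
Qed.

Lemma householderK v x : v != 0 -> householder v (householder v x) = x.
Proof.
move=> v0; have q0 : sqnorm v != 0 by rewrite sqnorm_eq0.
have [c cE] : exists c, c = 2 * dot x v / sqnorm v by eexists.
have -> : householder v x = x + (- c) *: v by rewrite scaleNr cE.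
rewrite /householder dotDl dotZl -sqnormE -addrA -[X in _ + (_ + X)]scaleNr -scalerDl.
by rewrite (_ : - c - _ = 0) ?scale0r ?addr0// cE; field.
Qed.

Lemma sqnorm_householder v x : v != 0 -> sqnorm (householder v x) = sqnorm x.
Proof.
move=> v0; have q0 : sqnorm v != 0 by rewrite sqnorm_eq0.
by rewrite /householder -scaleNr sqnormD sqnormZ dotC dotZl (dotC v); field.
Qed.

Lemma householderZ v k x : householder v (k *: x) = k *: householder v x.
Proof.
by rewrite /householder dotZl scalerBr scalerA; congr (_ - _ *: _); lra.
Qed.

Lemma householderN v x : householder v (- x) = - householder v x.
Proof. by rewrite -(scaleN1r x) householderZ scaleN1r. Qed.

Lemma householder_foot v : v != 0 -> householder v v = - v.
Proof.
move=> v0; have q0 : sqnorm v != 0 by rewrite sqnorm_eq0.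
rewrite /householder -sqnormE mulfK// -{1}[v]scale1r -scalerBl -[RHS]scaleN1r.
by congr (_ *: _); lra.
Qed.

Lemma reflK v x : v != 0 -> refl v (refl v x) = x.
Proof.
move=> v0; rewrite /refl householderD householderK// householderZ.
by rewrite householder_foot// scalerN addrNK.
Qed.

Lemma reflB v x y : refl v x - refl v y = householder v (x - y).
Proof. by rewrite householderD householderN /refl opprD addrACA subrr addr0. Qed.

Lemma enorm_reflB v x y : v != 0 -> enorm (refl v x - refl v y) = enorm (x - y).
Proof. by move=> v0; rewrite reflB !enormE sqnorm_householder. Qed.

Lemma enorm_reflBl v x y : v != 0 -> enorm (refl v x - y) = enorm (x - refl v y).
Proof. by move=> v0; rewrite -[y in LHS](@reflK v)// enorm_reflB. Qed.

(** The sign of [sqnorm v - dot x v] tells the side of the hyperplane: on the origin's side the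
    mirror image is the farther one from the origin. *)
Lemma sqnorm_refl v x : v != 0 ->
  sqnorm (refl v x) = sqnorm x + 4 * (sqnorm v - dot x v).
Proof.
move=> v0; have q0 : sqnorm v != 0 by rewrite sqnorm_eq0.
rewrite /refl sqnormD sqnorm_householder// sqnormZ dotC dotZl dotC.
by rewrite /householder -scaleNr dotDl dotZl -sqnormE; field.
Qed.

Lemma dot_refl v x : v != 0 -> dot (refl v x) v = 2 * sqnorm v - dot x v.
Proof.
move=> v0; have q0 : sqnorm v != 0 by rewrite sqnorm_eq0.
by rewrite /refl /householder -scaleNr !dotDl !dotZl -sqnormE; field.
Qed.

(* The distance between the mirror image of [x] and [y] exceeds that of [x] and
   [y] exactly when [x] and [y] lie on the same side of the hyperplane. *)
Lemma sqnorm_reflB v x y : v != 0 -> sqnorm (refl v x - y) =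
  sqnorm (x - y) + 4 / sqnorm v * ((sqnorm v - dot x v) * (sqnorm v - dot y v)).
Proof.
move=> v0; have q0 : sqnorm v != 0 by rewrite sqnorm_eq0.
have -> : refl v x - y = (x - y) + (2 * (1 - dot x v / sqnorm v)) *: v.
  by apply/rowP => i; rewrite !mxE; field.
rewrite sqnormD sqnormZ (dotC (x - y)) dotZl (dotC v) dotBl.
by field.
Qed.

End reflection.

Section measurability_euclidean.
Context {R : realType} {n : nat}.

Lemma measurable_dot d (U : measurableType d) (f g : U -> 'rV[R]_n) :
  measurable_fun setT f -> measurable_fun setT g ->
  measurable_fun setT (fun u => dot (f u) (g u)).
Proof.
move=> mf mg; apply/measurable_EFinP.
rewrite (_ : _ \o _ = fun u => \sum_(i < n) (f u ord0 i * g u ord0 i)%:E)%E; last first.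
  by apply/funext => u; rewrite /= sumEFin.
apply: emeasurable_sum => i; apply/measurable_EFinP.
by apply: measurable_funM; exact: measurable_fun_coord.
Qed.

Lemma measurable_sqnorm : measurable_fun setT (@sqnorm R n).
Proof.
rewrite (_ : sqnorm = fun x => dot x x); last first.
  by apply/funext => x; rewrite sqnormE.
exact: measurable_dot.
Qed.

Lemma measurable_enorm : measurable_fun setT (@enorm R n).
Proof.
rewrite (_ : enorm = (fun t => t `^ 2^-1) \o (@sqnorm R n)); last first.
  by apply/funext => x /=; rewrite powR12_sqrt// sqnorm_ge0.
by apply: measurableT_comp; [exact: measurable_powR|exact: measurable_sqnorm].
Qed.

Lemma measurable_householder (v : 'rV[R]_n) : measurable_fun setT (householder v).
Proof.
apply: measurable_rVB => //; apply: measurable_rVZ => //.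
apply: measurable_funM => //; apply: measurable_funM => //.
exact: measurable_dot.
Qed.

Lemma measurable_refl (v : 'rV[R]_n) : measurable_fun setT (refl v).
Proof. by apply: measurable_rVD => //; exact: measurable_householder. Qed.

End measurability_euclidean.

Section measurable_sets.
Context d (T : measurableType d) {R : realType}.
Implicit Types f g : T -> R.

Lemma measurable_lt_set f g : measurable_fun setT f -> measurable_fun setT g ->
  measurable [set x | f x < g x].
Proof.
move=> mf mg; rewrite -[X in measurable X]setTI.
exact: (measurable_fun_ltr mf mg measurableT (Y := [set true])).
Qed.

Lemma measurable_le_set f g : measurable_fun setT f -> measurable_fun setT g ->
  measurable [set x | f x <= g x].
Proof.
move=> mf mg; rewrite -[X in measurable X]setTI.
exact: (measurable_fun_ler mf mg measurableT (Y := [set true])).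
Qed.

End measurable_sets.

Section measurable_rV_sets.
Context {R : realType} {n : nat}.

Lemma measurable_set1_rV (a : 'rV[R]_n) : measurable [set a].
Proof.
rewrite [X in measurable X](_ : _ = \bigcap_(i in [set: 'I_n])
    ((fun x : 'rV[R]_n => x ord0 i) @^-1` [set a ord0 i])).
  apply: fin_bigcap_measurable => // i _; rewrite -[X in measurable X]setTI.
  exact: measurable_rV_coord.
apply/seteqP; split => [x /= -> //|x /= xa].
by apply/rowP => i; exact: xa.
Qed.

Lemma lebesgue_rV_set1 (a : 'rV[R]_n) : (0 < n)%N -> lebesgue_rV R n [set a] = 0%E.
Proof.
case: n a => // k a _.
transitivity (lebesgue_rV R k.+1 [set x | forall i, [set a ord0 i] (x ord0 i)]);
  last by rewrite (lebesgue_rV_box (A := fun i => [set a ord0 i]))// big_ord_recl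
    lebesgue_measure_set1 mul0e.
congr (lebesgue_rV R k.+1 _); apply/seteqP; split => [x /= -> //|x /= xa].
by apply/rowP => i; exact: xa.
Qed.

Lemma measurable_cube (k : R) :
  measurable [set x : 'rV[R]_n | forall i, `|x ord0 i| <= k].
Proof.
have -> : [set x : 'rV[R]_n | forall i, `|x ord0 i| <= k] =
    \bigcap_(i in [set: 'I_n]) [set x | `|x ord0 i| <= k].
  by apply/seteqP; split => x /= h i; [move=> _; exact: h|exact: (h i I)].
apply: fin_bigcap_measurable => // i _; apply: measurable_le_set => //.
by apply: measurableT_comp => //; exact: measurable_rV_coord.
Qed.

Lemma lebesgue_rV_cube (k : R) : 0 <= k ->
  lebesgue_rV R n [set x | forall i, `|x ord0 i| <= k] = ((2 * k) ^+ n)%:E.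
Proof.
move=> k0; transitivity (lebesgue_rV R n [set x | forall i, `[- k, k]%classic (x ord0 i)]).
  congr (lebesgue_rV R n _).
  by apply/seteqP; split => x /= xk i; move: (xk i); rewrite in_itv/= ler_norml.
rewrite (lebesgue_rV_box (A := fun=> `[- k, k]%classic))//.
rewrite (eq_bigr (fun=> (2 * k)%:E)); last first.
  move=> i _; rewrite lebesgue_measure_itv/= lte_fin.
  case: ltP => [_|h]; first by rewrite -EFinD; congr EFin; lra.
  by congr EFin; lra.
by rewrite prodEFin big_const iter_mulr mulr1 card_ord.
Qed.

End measurable_rV_sets.

Lemma mule_injl {R : realDomainType} (x y z : \bar R) :
  x \is a fin_num -> (0 < x)%E -> (x * y = x * z)%E -> y = z.
Proof.
move=> xf x0 xyz; apply/eqP; rewrite eq_le.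
by rewrite -(lee_pmul2l xf x0 y z) -(lee_pmul2l xf x0 z y) xyz !lexx.
Qed.

Section tonelli.
Context d1 d2 (X : measurableType d1) (Y : measurableType d2) (R : realType).
Variables (mu : {sigma_finite_measure set X -> \bar R})
  (nu : {sigma_finite_measure set Y -> \bar R}).

Lemma tonelli (F : X -> Y -> \bar R) :
  measurable_fun setT (fun p : X * Y => F p.1 p.2) ->
  (forall x y, 0 <= F x y)%E ->
  (\int[mu]_x \int[nu]_y F x y = \int[nu]_y \int[mu]_x F x y)%E.
Proof.
move=> mF F0; exact: (@fubini_tonelli _ _ _ _ _ mu nu (fun p => F p.1 p.2)).
Qed.

Lemma measurable_integral_tonelli (F : X -> Y -> \bar R) :
  measurable_fun setT (fun p : X * Y => F p.1 p.2) ->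
  (forall x y, 0 <= F x y)%E ->
  measurable_fun setT (fun x => \int[nu]_y F x y)%E.
Proof.
move=> mF F0.
exact: (@measurable_fun_fubini_tonelli_F _ _ _ _ _ nu (fun p => F p.1 p.2)).
Qed.

End tonelli.
Arguments tonelli {d1 d2 X Y R mu nu} F.
Arguments measurable_integral_tonelli {d1 d2 X Y R} nu F.

(** * Balls and invariance under linear isometries *)

Section balls.
Context {R : realType} {n : nat}.
Local Notation mu := (lebesgue_rV R n).

Definition eball (r : R) : set 'rV[R]_n := [set x | enorm x <= r].

Lemma measurable_eball r : measurable (eball r).
Proof. by apply: measurable_le_set => //; exact: measurable_enorm. Qed.

Lemma lebesgue_eball_fin r : (mu (eball r) < +oo)%E.
Proof.
have [r0|r0] := ltP r 0.
  rewrite (_ : eball r = set0) ?measure0//.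
  by apply/seteqP; split => // x /=; rewrite /eball/= leNgt (lt_le_trans r0)// enorm_ge0.
rewrite (@le_lt_trans _ _ (mu [set x | forall i, `|x ord0 i| <= r]))//; last first.
  by rewrite lebesgue_rV_cube// ltry.
apply: le_measure; rewrite ?inE; first exact: measurable_eball.
  exact: measurable_cube.
by move=> x /= xr i; rewrite (le_trans _ xr)// coord_le_enorm.
Qed.

Lemma lebesgue_eball_fin_num r : mu (eball r) \is a fin_num.
Proof. by rewrite ge0_fin_numE// lebesgue_eball_fin. Qed.

Lemma lebesgue_eball1_gt0 : (0 < mu (eball 1))%E.
Proof.
(* Half-side [1 / (n + 1)] makes sense for [n = 0] too, and [n <= (n + 1)^2] puts the cube inside
   the unit ball. *)
pose k : R := (n.+1%:R)^-1; have k0 : 0 < k by rewrite invr_gt0.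
apply: (@lt_le_trans _ _ (mu [set x | forall i, `|x ord0 i| <= k])).
  by rewrite lebesgue_rV_cube ?ltW// lte_fin exprn_gt0// mulr_gt0.
apply: le_measure; rewrite ?inE; last 1 first.
- move=> x /= /sqnorm_le xk; rewrite /eball/= -(ler_pXn2r (n := 2))// ?nnegrE ?enorm_ge0//.
  rewrite sqr_enorm (le_trans xk)// expr1n /k exprVn ler_pdivrMr ?exprn_gt0// mul1r.
  by rewrite -natrX ler_nat (leq_trans (leqnSn n))// -{1}(expn1 n.+1) leq_pexp2l.
- exact: measurable_cube.
- exact: measurable_eball.
Qed.

(* For the unit ball indicator [b], [int b * int f(T x) dx] is the integral over
   pairs of [b y * f (T x + y)]; translating in [y] turns it into the integral of
   [b (y - T x) * f y], where the integral over [x] is again [int b], because [T]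
   preserves [b]. *)
Lemma integral_isometry (T : 'rV[R]_n -> 'rV[R]_n) (f : 'rV[R]_n -> \bar R) :
  measurable_fun setT T -> (forall x, T (T x) = x) ->
  (forall x y, T (x + y) = T x + T y) ->
  (forall x, sqnorm (T x) = sqnorm x) ->
  measurable_fun setT f -> (forall x, 0 <= f x)%E ->
  (\int[mu]_x f (T x) = \int[mu]_x f x)%E.
Proof.
move=> mT TK TD Tq mf f0.
pose b (x : 'rV[R]_n) : \bar R := (\1_(eball 1) x)%:E.
have b0 x : (0 <= b x)%E by rewrite lee_fin.
have mb : measurable_fun setT b.
  by apply/measurable_EFinP; exact: measurable_indic (measurable_eball _).
have bq x y : sqnorm x = sqnorm y -> b x = b y.
  move=> xy; rewrite /b !indicE; congr ((nat_of_bool _)%:R%:E).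
  by apply/idP/idP; rewrite !inE /eball/= !enormE xy.
have Ib : (\int[mu]_x b x = mu (eball 1))%E.
  by rewrite integral_indic ?setIT//; exact: measurable_eball.
have TN x : T (- x) = - T x.
  apply: (addIr (T x)); rewrite -TD !addNr.
  by apply: (addIr (T 0)); rewrite -TD !add0r.
have IT0 g : (forall x, 0 <= g x)%E -> (0 <= \int[mu]_x g x)%E.
  by move=> g0; exact: integral_ge0.
have mfT : measurable_fun setT (f \o T) by exact: measurableT_comp.
have mp1 : measurable_fun setT (fun p : 'rV[R]_n * 'rV[R]_n => p.1)
  by exact: measurable_fst.
have mp2 : measurable_fun setT (fun p : 'rV[R]_n * 'rV[R]_n => p.2)
  by exact: measurable_snd.
have mG : measurable_fun setT (fun p : 'rV[R]_n * 'rV[R]_n =>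
    b p.1 * f (T p.2 + p.1)%R)%E.
  apply: emeasurable_funM; first exact: (measurableT_comp mb).
  apply: (measurableT_comp mf); apply: measurable_rVD => //.
  exact: (measurableT_comp mT).
have mH : measurable_fun setT (fun p : 'rV[R]_n * 'rV[R]_n =>
    b (p.2 - T p.1)%R * f p.2)%E.
  apply: emeasurable_funM; last exact: (measurableT_comp mf).
  apply: (measurableT_comp mb); apply: measurable_rVB => //.
  exact: (measurableT_comp mT).
apply: (mule_injl (lebesgue_eball_fin_num 1) lebesgue_eball1_gt0).
rewrite -{1}Ib -ge0_integralZr//; last exact: IT0.
transitivity (\int[mu]_y \int[mu]_x (b y * f (T x + y)%R))%E.
  apply: eq_integral => y _.
  rewrite -(integral_translate_rV (T y) mfT); last by move=> x; exact: f0.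
  rewrite -ge0_integralZl//.
  - by apply: eq_integral => x _; rewrite /= TD TK.
  - apply: (measurableT_comp mfT); exact: measurable_rVD.
  - by move=> x _; exact: f0.
transitivity (\int[mu]_x \int[mu]_y (b y * f (T x + y)%R))%E.
  by apply: (tonelli (fun y x => b y * f (T x + y)%R)%E) => // y x; exact: mule_ge0.
transitivity (\int[mu]_x \int[mu]_y (b (y - T x)%R * f y))%E.
  apply: eq_integral => x _ /=.
  have mHx : measurable_fun setT (fun y : 'rV[R]_n => b (y - T x)%R * f y)%E.
    exact: (measurableT_comp mH (pair1_measurable x)).
  rewrite -(integral_translate_rV (T x) mHx); last by move=> y; exact: mule_ge0.
  by apply: eq_integral => y _; rewrite addrK (addrC y).
transitivity (\int[mu]_y \int[mu]_x (b (y - T x)%R * f y))%E.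
  by apply: (tonelli (fun x y : 'rV[R]_n => b (y - T x)%R * f y)%E) => // x y; exact: mule_ge0.
rewrite -ge0_integralZl//.
apply: eq_integral => y _ /=.
rewrite ge0_integralZr//; last first.
  by apply: (measurableT_comp mb); exact: measurable_rVB.
congr (_ * _)%E; rewrite -Ib -(integral_translate_rV (- T y) mb); last exact: b0.
apply: eq_integral => x _; apply: bq.
by rewrite -(Tq (y - _)) TD TN TK -sqnormN opprB.
Qed.

End balls.

(** * Layer-cake formula and radial integration *)

Section layer_cake.
Context d (T : measurableType d) {R : realType}.
Variable mu : {sigma_finite_measure set T -> \bar R}.
Local Notation leb := (@lebesgue_measure R).

(** [psi x] is the length of []0, psi x[], and Tonelli exchanges the integrals. Keeping [0 < s]
    inside the indicator lets [s] range over the whole line. *)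
Lemma layer_cake (w psi : T -> R) :
  measurable_fun setT w -> measurable_fun setT psi ->
  (forall x, 0 <= w x) -> (forall x, 0 <= psi x) ->
  (\int[mu]_x (w x * psi x)%:E =
   \int[leb]_s \int[mu]_x (w x * \1_[set x | 0 < s < psi x] x)%:E)%E.
Proof.
move=> mw mpsi w0 psi0.
have mA : measurable [set p : T * measurableTypeR R | 0 < p.2 < psi p.1].
  rewrite [X in measurable X](_ : _ = [set p : T * measurableTypeR R | 0 < p.2] `&`
    [set p : T * measurableTypeR R | p.2 < psi p.1]); last first.
    by apply/seteqP; split => p /= => [/andP[]|[-> ->]].
  apply: measurableI.
    by apply: measurable_lt_set => //; exact: measurable_snd.
  apply: measurable_lt_set; first exact: measurable_snd.
  exact: (measurableT_comp mpsi measurable_fst).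
transitivity (\int[mu]_x \int[leb]_s
    (w x * \1_[set p : T * measurableTypeR R | 0 < p.2 < psi p.1] (x, s))%:E)%E.
  apply: eq_integral => x _.
  under eq_integral do rewrite EFinM.
  rewrite ge0_integralZl_EFin//; last first.
    apply/measurable_EFinP.
    exact: (measurableT_comp (measurable_indic mA) (pair1_measurable x)).
  rewrite EFinM; congr (_ * _)%E.
  rewrite -[LHS](_ : leb `]0, psi x[%classic = _); last first.
    rewrite lebesgue_measure_itv/= lte_fin.
    have := psi0 x; rewrite le_eqVlt => /predU1P[<-|->]; first by rewrite ltxx.
    by rewrite sube0.
  rewrite -[X in leb X]setIT -integral_indic//.
rewrite (tonelli (fun x s =>
  (w x * \1_[set p : T * measurableTypeR R | 0 < p.2 < psi p.1] (x, s))%:E)).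
- apply: eq_integral => s _; apply: eq_integral => x _.
  by rewrite !indicE; congr (_ * (nat_of_bool _)%:R)%:E; apply/idP/idP; rewrite !inE.
- apply/measurable_EFinP; apply: measurable_funM.
    exact: (measurableT_comp mw measurable_fst).
  rewrite [X in measurable_fun _ X](_ : _ =
    \1_[set p : T * measurableTypeR R | 0 < p.2 < psi p.1]); last first.
    by apply/funext => -[].
  exact: measurable_indic.
- by move=> x s; rewrite lee_fin mulr_ge0.
Qed.

End layer_cake.

Section integral_powR.
Context {R : realType}.
Local Notation leb := (@lebesgue_measure R).

(** The integrand may blow up at [0], so the fundamental theorem of calculus is applied on [[e, b]]
    and monotone convergence lets [e] tend to [0]. *)
Lemma integral_powR (p b : R) : 0 < p -> 0 <= b ->
  (\int[leb]_(t in `]0%R, b[) (t `^ (p - 1))%:E = (b `^ p / p)%:E)%E.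
Proof.
move=> p0; rewrite le_eqVlt => /predU1P[<-|b0].
  by rewrite set_itvoo0 integral_set0 powR0 ?gt_eqF// mul0r.
have mf D : measurable_fun D (fun t : R => (t `^ (p - 1))%:E).
  by apply: measurable_funTS; apply/measurable_EFinP; exact: measurable_powR.
have FTC (e : R) : 0 < e < b ->
    (\int[leb]_(t in `[e, b]) (t `^ (p - 1))%:E = ((b `^ p - e `^ p) / p)%:E)%E.
  move=> /andP[e0 eb].
  have dF (t : R) : 0 < t -> is_derive t 1 (fun t : R => t `^ p / p) (t `^ (p - 1)).
    move=> t0.
    have dp : derivable (fun t : R => t `^ p) t 1.
      by apply: derivable_powR; rewrite in_itv/= t0.
    have -> : t `^ (p - 1) = p^-1 *: (p * t `^ (p - 1)).
      by rewrite /GRing.scale/= mulrA mulVf ?mul1r// gt_eqF.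
    have -> : (fun t : R => t `^ p / p) = p^-1 *: (fun t : R => t `^ p).
      by apply/funext => u; rewrite /GRing.scale/= mulrC.
    apply: is_deriveZ; apply: DeriveDef => //.
    by rewrite -derive1E powR_derive1// in_itv/= t0.
  have cF (t : R) : 0 < t -> {for t, continuous (fun t : R => t `^ p / p)}.
    move=> t0; apply: differentiable_continuous; apply/derivable1_diffP.
    by have [] := dF _ t0.
  rewrite (@continuous_FTC2 _ _ (fun t : R => t `^ p / p))//.
  - by rewrite -EFinB mulrBl.
  - apply: continuous_in_subspaceT => t; rewrite inE/= in_itv/= => /andP[et _].
    apply: differentiable_continuous; apply/derivable1_diffP.
    by apply: derivable_powR; rewrite in_itv/= (lt_le_trans e0).
  - split => [t|  |].
    + by rewrite in_itv/= => /andP[et _]; have [] := dF _ (lt_trans e0 et).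
    + by apply: cvg_at_right_filter; exact: cF.
    + by apply: cvg_at_left_filter; apply: cF; exact: lt_trans eb.
  - move=> t; rewrite in_itv/= => /andP[et _]; rewrite derive1E.
    by have [_ ->] := dF _ (lt_trans e0 et).
(* Chosen so that the [p]-th power of [e k] is that of [b] divided by [k + 2]: the truncation error
   is then harmonic, and [e k < b] already at [k = 0]. *)
pose e (k : nat) : R := (b `^ p / k.+2%:R) `^ p^-1.
have bp0 : 0 < b `^ p by exact: powR_gt0.
have eE k : e k `^ p = b `^ p / k.+2%:R.
  by rewrite /e -powRrM mulVf ?gt_eqF// powRr1// divr_ge0// ltW.
have e_gt0 k : 0 < e k by apply: powR_gt0; rewrite divr_gt0.
have lt_pow (x y : R) : 0 <= x -> 0 <= y -> x `^ p < y `^ p -> x < y.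
  move=> x0 y0; apply: contraTT; rewrite -!leNgt => yx.
  by apply: ge0_ler_powR; rewrite ?nnegrE// ltW.
have e0 k : 0 < e k < b.
  rewrite e_gt0 lt_pow ?ltW// eE ltr_pdivrMr// ltr_pMr// ltr1n //.
rewrite integral_itv_bndo_bndc//.
have -> : `]0%R, b]%classic = \bigcup_k `[e k, b]%classic.
  apply/seteqP; split => [t /=|t [k _]/=]; rewrite !in_itv/= => /andP[t0 tb].
    have tp0 : 0 < t `^ p by exact: powR_gt0.
    exists (Num.truncn (b `^ p / t `^ p)) => //=; rewrite in_itv/= tb andbT.
    rewrite leNgt; apply/negP => /(gt0_ltr_powR p0).
    rewrite !nnegrE (ltW t0) (ltW (e_gt0 _)) => /(_ isT isT).
    apply/negP; rewrite -leNgt eE ler_pdivrMr// mulrC -ler_pdivrMr//.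
    by rewrite (le_trans (ltW (truncnS_gt _)))// ler_nat.
  by have /andP[ek _] := e0 k; rewrite (lt_le_trans ek t0).
have nd : nondecreasing_seq (fun k => `[e k, b]%classic).
  move=> i j ij; apply/subsetPset; apply: subset_itvr; rewrite bnd_simp.
  rewrite leNgt; apply/negP => /(gt0_ltr_powR p0).
  rewrite !nnegrE !(ltW (e_gt0 _)) => /(_ isT isT).
  by apply/negP; rewrite -leNgt !eE ler_wpM2l ?(ltW bp0)// lef_pV2 ?posrE// ler_nat.
have := @ge0_nondecreasing_set_cvg_integral _ (measurableTypeR R) R (fun k => `[e k, b]%classic)
  (fun t : R => (t `^ (p - 1))%:E) leb nd (fun=> measurable_itv _) (fun=> mf _) _.
move=> /(_ (fun _ _ _ => powR_ge0 _ _)) cv.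
apply: (cvg_unique _ cv) => //.
rewrite (_ : (fun i => _) = (fun i => ((b `^ p - b `^ p / i.+2%:R) / p)%:E)); last first.
  by apply/funext => i; rewrite FTC// eE.
apply: cvg_EFin; first exact: nearW.
rewrite /comp/= -[X in _ --> X / p]subr0; apply: cvgMl; apply: cvgB; first exact: cvg_cst.
rewrite -[X in _ --> X](mulr0 (b `^ p)); apply: cvgMr.
have := @cvg_harmonic R; rewrite -cvg_shiftS; exact.
Qed.

End integral_powR.

Lemma integral_indicl d (T : measurableType d) {R : realType}
    (mu : {measure set T -> \bar R}) (D : set T) (f : T -> R) :
  (\int[mu]_(x in D) (f x)%:E = \int[mu]_x (\1_D x * f x)%:E)%E.
Proof.
rewrite integral_mkcond; apply: eq_integral => x _.
by rewrite patchE indicE; case: ifPn => _; rewrite ?mul1r ?mul0r.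
Qed.

Section radial.
Context {R : realType} {n : nat}.
Local Notation mu := (lebesgue_rV R n).
Local Notation leb := (@lebesgue_measure R).

(** The punctured open ball of radius [Num.sqrt b]: radial profiles are functions of the square norm
    and may be singular at [0]. *)
Definition shell (b : R) : set 'rV[R]_n := [set x | 0 < sqnorm x < b].

Lemma measurable_shell b : measurable (shell b).
Proof.
rewrite (_ : shell b = [set x | 0 < sqnorm x] `&` [set x | sqnorm x < b]).
  by apply: measurableI; apply: measurable_lt_set => //; exact: measurable_sqnorm.
by rewrite /shell; apply/seteqP; split => x /= => [/andP[]|[-> ->]].
Qed.

Definition shell_volume : R := fine (mu (shell 1)).

Lemma shell_volumeE : mu (shell 1) = shell_volume%:E.
Proof.
rewrite /shell_volume fineK// ge0_fin_numE//.
apply: le_lt_trans (lebesgue_eball_fin (R := R) (n := n) 1).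
apply: le_measure; rewrite ?inE; [exact: measurable_shell|exact: measurable_eball|].
move=> x; rewrite /shell /eball/= => /andP[_ x1].
by rewrite -(ler_pXn2r (n := 2))// ?nnegrE ?enorm_ge0// sqr_enorm expr1n ltW.
Qed.

Lemma shell_volume_ge0 : 0 <= shell_volume.
Proof. exact: fine_ge0. Qed.

Lemma lebesgue_shell b : (0 < n)%N -> 0 <= b ->
  mu (shell b) = (b `^ (n%:R / 2) * shell_volume)%:E.
Proof.
move=> n0; rewrite le_eqVlt => /predU1P[<-|b0].
  rewrite powR0 ?mul0r; last by rewrite gt_eqF// divr_gt0// ltr0n.
  rewrite (_ : shell 0 = set0) ?measure0//; apply/seteqP; split => // x.
  by rewrite /shell/= [X in _ && X]ltNge sqnorm_ge0 andbF.
have sb0 : Num.sqrt b != 0 by rewrite gt_eqF// sqrtr_gt0.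
have mS : measurable_fun setT (fun x => (\1_(shell b) x : R)%:E).
  by apply/measurable_EFinP; exact: measurable_indic (measurable_shell b).
rewrite -[LHS](_ : (\int[mu]_x (\1_(shell b) x)%:E = _)%E); last first.
  by rewrite integral_indic ?setIT//; exact: measurable_shell.
rewrite (integral_affine_rV 0 sb0 mS) => [|x]; last by rewrite lee_fin.
rewrite ger0_norm ?sqrtr_ge0// EFinM -shell_volumeE; congr (_ * _)%E.
  by congr EFin; rewrite mulrC powRrM powR12_sqrt ?ltW// powR_mulrn// sqrtr_ge0.
transitivity (\int[mu]_x (\1_(shell 1) x)%:E)%E; last first.
  by rewrite integral_indic ?setIT//; exact: measurable_shell.
apply: eq_integral => x _; rewrite !indicE; congr ((nat_of_bool _)%:R%:E).
apply/idP/idP; rewrite !inE /shell/= addr0 sqnormZ sqr_sqrtr ?ltW//;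
  by rewrite pmulr_rgt0// gtr_pMr.
Qed.

(** Polar coordinates without a surface measure. The last hypothesis makes the superlevel sets of
    [phi] initial intervals, so the layer-cake formula reduces the left side to volumes of shells
    and the right side to power integrals over []0, b[]. The exponent is [n / 2 - 1] because the
    variable is the square of the radius. *)
Lemma integral_radial (phi : R -> R) : (0 < n)%N -> measurable_fun setT phi ->
  (forall t, 0 <= phi t) ->
  (forall s, 0 < s ->
    exists2 b, 0 <= b & forall t, 0 < t -> (s < phi t) = (t < b)) ->
  (\int[mu]_x (\1_[set x | 0 < sqnorm x] x * phi (sqnorm x))%:E =
   (n%:R / 2 * shell_volume)%:E *
   \int[leb]_(t in `]0%R, +oo[) (t `^ (n%:R / 2 - 1) * phi t)%:E)%E.
Proof.
move=> n0 mphi phi0 phiP; set p : R := n%:R / 2.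
have p0 : 0 < p by rewrite divr_gt0// ltr0n.
have mpos : measurable [set x : 'rV[R]_n | 0 < sqnorm x].
  by apply: measurable_lt_set => //; exact: measurable_sqnorm.
rewrite (@layer_cake _ _ _ mu \1_[set x | 0 < sqnorm x] (phi \o sqnorm))//; last 2 first.
- by apply: measurableT_comp => //; exact: measurable_sqnorm.
- by move=> x; exact: phi0.
rewrite integral_indicl.
under [in RHS]eq_integral do rewrite mulrA.
pose w (t : R) := \1_(`]0%R, +oo[%classic : set R) t * t `^ (p - 1).
have mw : measurable_fun setT w.
  by apply: measurable_funM; [exact: measurable_indic|exact: measurable_powR].
have w0 t : 0 <= w t by rewrite mulr_ge0 ?powR_ge0.
have mws s : measurable_fun setT (fun t : R => w t * \1_[set t | 0 < s < phi t] t).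
  apply: measurable_funM => //; apply: measurable_indic.
  rewrite (_ : [set t | 0 < s < phi t] = [set t | 0 < s] `&` [set t | s < phi t]).
    by apply: measurableI; apply: measurable_lt_set.
  by apply/seteqP; split => t/= => [/andP[]|[-> ->]].
rewrite (@layer_cake _ _ _ leb w phi)//.
have msn : measurable_fun setT (fun s : measurableTypeR R =>
    (\int[leb]_t (w t * \1_[set t | 0 < s < phi t] t)%:E)%E).
  apply: (measurable_integral_tonelli leb (fun (s t : measurableTypeR R) =>
    (w t * \1_[set t | 0 < s < phi t] t)%:E)); last first.
    by move=> s t; rewrite lee_fin mulr_ge0.
  apply/measurable_EFinP; apply: measurable_funM.
    exact: (measurableT_comp mw measurable_snd).
  rewrite (_ : (fun _ => _) = \1_([set p : measurableTypeR R * measurableTypeR R |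
      0 < p.1] `&` [set p | p.1 < phi p.2])); last first.
    apply/funext => -[s t]; rewrite !indicE; congr ((nat_of_bool _)%:R).
    by apply/idP/idP; rewrite !inE/=; [case/andP|case=> -> ->].
  apply: measurable_indic; apply: measurableI.
    by apply: measurable_lt_set => //; exact: measurable_fst.
  apply: measurable_lt_set; first exact: measurable_fst.
  exact: (measurableT_comp mphi measurable_snd).
rewrite -ge0_integralZl_EFin//; last 2 first.
- by move=> s _; apply: integral_ge0 => t _; rewrite lee_fin mulr_ge0.
- by rewrite mulr_ge0 ?shell_volume_ge0// ltW.
apply: eq_integral => s _; have [s0|s0] := leP s 0.
  have z (r : R) : ~ (0 < s < r) by move=> /andP[]; rewrite ltNge s0.
  rewrite integral0_eq; last by move=> x _; rewrite [X in (_ * X)%:E]indicE memNset ?mulr0//; exact: z.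
  rewrite integral0_eq ?mule0// => x _; rewrite [X in (_ * X)%:E]indicE memNset ?mulr0//; exact: z.
have [b b0 bP] := phiP _ s0.
transitivity (mu (shell b)).
  rewrite -[shell b]setIT -integral_indic//; last exact: measurable_shell.
  apply: eq_integral => x _; rewrite !indicE -natrM mulnb; congr ((nat_of_bool _)%:R%:E).
  apply/idP/idP; rewrite !inE /shell/=.
    by move=> /andP[]; rewrite !inE/= => q0; rewrite q0 bP.
  by move=> /andP[q0 qb]; rewrite !mem_set//= bP.
rewrite lebesgue_shell//.
transitivity ((p * shell_volume)%:E * \int[leb]_(t in `]0%R, b[) (t `^ (p - 1))%:E)%E.
  rewrite integral_powR// -EFinM; congr EFin.
  by rewrite -/p; field; rewrite gt_eqF.
congr (_ * _)%E; rewrite integral_indicl; apply: eq_integral => t _; congr EFin.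
rewrite /w !indicE mulrAC -natrM mulnb; congr ((nat_of_bool _)%:R * _).
apply/idP/idP; rewrite !inE/= !in_itv/= ?andbT.
  by move=> /andP[t0 tb]; rewrite !mem_set//= ?in_itv/= ?andbT //= bP.
by move=> /andP[]; rewrite !inE/= in_itv/= andbT => t0; rewrite t0 bP.
Qed.

End radial.

(** * The Gamma function *)

Section gamma.
Context {R : realType}.
Local Notation leb := (@lebesgue_measure R).
Implicit Types p s t : R.

(** [Gamma] is the [fine] part of this integral and would read [0] if it were infinite; finiteness
    therefore has to be tracked here. *)
Definition gamma_int p : \bar R :=
  (\int[leb]_(t in `]0%R, +oo[) (t `^ (p - 1) * expR (- t))%:E)%E.

Lemma GammaE p : Gamma p = fine (gamma_int p). Proof. by []. Qed.

Lemma measurable_powR_exp (p : R) (D : set R) :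
  measurable_fun D (fun t : R => t `^ (p - 1) * expR (- t)).
Proof.
apply: measurable_funTS; apply: measurable_funM; first exact: measurable_powR.
by apply: measurableT_comp => //; exact: measurable_funN.
Qed.

Lemma powR_exp_ge0 p t : 0 <= t `^ (p - 1) * expR (- t).
Proof. by rewrite mulr_ge0 ?powR_ge0 ?expR_ge0. Qed.

Lemma gamma_int_ge0 p : (0 <= gamma_int p)%E.
Proof. by apply: integral_ge0 => t _; rewrite lee_fin powR_exp_ge0. Qed.

Lemma Gamma_ge0 p : 0 <= Gamma p.
Proof. by rewrite GammaE fine_ge0// gamma_int_ge0. Qed.

(** From [1 + u <= exp u] at [u = - s * ln t], and [ln t <= t]. *)
Lemma powRN_ge t s : 0 < t -> 0 < s -> 1 - s * t <= t `^ (- s).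
Proof.
move=> t0 s0; rewrite /powR gt_eqF//.
have := expR_ge1Dx (- s * ln t); apply: le_trans.
by rewrite mulNr lerD2l lerN2 ler_pM2l// ltW// ln_sublinear.
Qed.

Lemma integral_expRN : (\int[leb]_(t in `[1%R, +oo[) (expR (- t))%:E <= 1)%E.
Proof.
have dF (t : R) : is_derive t (1 : R) (fun t : R => - expR (- t)) (expR (- t)).
  have d1 := is_derive1_comp (f := expR) (g := -%R) (is_derive_expR (- t))
    (is_deriveNid t 1).
  have := is_deriveN d1; rewrite mulrN1 opprK; exact.
rewrite (@ge0_continuous_FTC2y _ (fun t => expR (- t)) (fun t => - expR (- t)) 1 0).
- by rewrite sub0e -EFinN opprK lee_fin expR_le1 oppr_le0.
- by move=> t _; exact: expR_ge0.
- apply: continuous_subspaceT => t.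
  apply: continuous_comp; [exact: opp_continuous|exact: continuous_expR].
- rewrite -oppr0; apply: cvgN; exact: cvgr_expR.
- by move=> t _; have [] := dF t.
- apply: cvg_at_right_filter; apply: cvgN.
  apply: continuous_comp; [exact: opp_continuous|exact: continuous_expR].
- by move=> t _; rewrite derive1E; have [_ ->] := dF t.
Qed.

(* On [0 < t < 1], [t^(s-1) (1 - t) <= t^(s-1) e^-t <= t^(s-1)]; beyond [1],
   [t^(s-1) <= 1]. *)
Lemma gamma_int_near0 s : 0 < s -> s < 1 ->
  ((s^-1 - 1)%:E <= gamma_int s <= (s^-1 + 1)%:E)%E.
Proof.
move=> s0 s1.
have mI D : measurable_fun D (fun t : R => (t `^ (s - 1) * expR (- t))%:E).
  by apply/measurable_EFinP; exact: measurable_powR_exp.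
have mP p D : measurable_fun D (fun t : R => (t `^ p)%:E).
  by apply/measurable_EFinP; apply: measurable_funTS; exact: measurable_powR.
have splitD : `]0%R, +oo[%classic = `]0%R, 1%R[ `|` `[1%R, +oo[ :> set R.
  by rewrite -itv_bndbnd_setU// bnd_simp.
rewrite /gamma_int splitD ge0_integral_setU//=; last 3 first.
- exact: mI.
- by move=> t _; rewrite lee_fin powR_exp_ge0.
- apply/disj_setPS => t [] /=; rewrite !in_itv/= andbT => /andP[_ t1].
  by rewrite leNgt t1.
apply/andP; split.
- apply: le_trans (leeDl _ _); last first.
    by apply: integral_ge0 => t _; rewrite lee_fin powR_exp_ge0.
  have : (\int[leb]_(t in `]0%R, 1%R[) (t `^ (s - 1))%:E <=
      \int[leb]_(t in `]0%R, 1%R[) (t `^ (s - 1) * expR (- t))%:E +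
      \int[leb]_(t in `]0%R, 1%R[) (t `^ (s + 1 - 1))%:E)%E.
    rewrite -ge0_integralD//; last 4 first.
    - by move=> t _; rewrite lee_fin powR_exp_ge0.
    - exact: mI.
    - by move=> t _; rewrite lee_fin powR_ge0.
    - exact: mP.
    apply: ge0_le_integral => //.
    - by move=> t _; rewrite lee_fin powR_ge0.
    - exact: mP.
    - exact: (emeasurable_funD (mI _) (mP _ _)).
    move=> t /=; rewrite in_itv/= => /andP[t0 t1]; rewrite -EFinD lee_fin.
    have -> : t `^ (s + 1 - 1) = t `^ (s - 1) * t.
      rewrite -[X in _ * X](powRr1 (ltW t0)) -powRD ?(gt_eqF t0) ?implybT//.
      by congr powR; lra.
    have := powR_ge0 t (s - 1); have := expR_ge1Dx (- t); nra.
  rewrite !integral_powR ?powR1 ?addr_gt0// !div1r.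
  case: (\int[leb]_(t in _) _)%E => [r| |]; rewrite ?leey//.
    rewrite -EFinD !lee_fin; have : (s + 1)^-1 <= 1 by rewrite invf_le1 ?addr_gt0// lerDr ltW.
    lra.
- rewrite EFinD; apply: leeD.
    have <- : (\int[leb]_(t in `]0%R, 1%R[) (t `^ (s - 1))%:E = s^-1%:E)%E.
      by rewrite integral_powR// powR1 div1r.
    apply: ge0_le_integral => //.
    - by move=> t _; rewrite lee_fin powR_exp_ge0.
    - exact: mI.
    - exact: mP.
    move=> t /=; rewrite in_itv/= => /andP[t0 t1]; rewrite lee_fin.
    by rewrite ler_piMr ?powR_ge0// expR_le1 oppr_le0 ltW.
  apply: le_trans integral_expRN; apply: ge0_le_integral => //.
  - by move=> t _; rewrite lee_fin powR_exp_ge0.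
  - exact: mI.
  - apply/measurable_EFinP; apply: measurable_funTS.
    by apply: measurableT_comp => //; exact: measurable_funN.
  move=> t /=; rewrite in_itv/= andbT => t1; rewrite lee_fin.
  rewrite ler_piMl ?expR_ge0// -[leRHS](powRr0 t); apply: ler_powR => //.
  by rewrite subr_le0 ltW.
Qed.

(** [powRN_ge] under the integral sign. The additive form avoids subtracting integrals not yet known
    to be finite. *)
Lemma gamma_int_subr_ge p s : 0 < s -> s < p ->
  (gamma_int p <= gamma_int (p - s) + s%:E * gamma_int (p + 1))%E.
Proof.
move=> s0 sp; rewrite /gamma_int -ge0_integralZl_EFin ?(ltW s0)//; last 2 first.
- by move=> t _; rewrite lee_fin powR_exp_ge0.
- by apply/measurable_EFinP; exact: measurable_powR_exp.
rewrite -ge0_integralD//; last 4 first.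
- by move=> t _; rewrite lee_fin powR_exp_ge0.
- by apply/measurable_EFinP; exact: measurable_powR_exp.
- by move=> t _; rewrite -EFinM lee_fin mulr_ge0 ?(ltW s0) ?powR_exp_ge0.
- apply/measurable_EFinP; apply: measurable_funM => //.
  exact: measurable_powR_exp.
apply: ge0_le_integral => //.
- by move=> t _; rewrite lee_fin powR_exp_ge0.
- by apply/measurable_EFinP; exact: measurable_powR_exp.
- apply/measurable_EFinP; apply: measurable_funD; first exact: measurable_powR_exp.
  by apply: measurable_funM => //; exact: measurable_powR_exp.
move=> t /=; rewrite in_itv/= andbT => t0; rewrite -EFinM -EFinD lee_fin.
have -> : t `^ (p - s - 1) = t `^ (p - 1) * t `^ (- s).
  rewrite -powRD ?(gt_eqF t0) ?implybT//; congr powR; lra.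
have -> : t `^ (p + 1 - 1) = t `^ (p - 1) * t.
  rewrite -[X in _ * X](powRr1 (ltW t0)) -powRD ?(gt_eqF t0) ?implybT//.
  by congr powR; lra.
have : 0 <= t `^ (p - 1) * expR (- t) * (t `^ (- s) - (1 - s * t)).
  by apply: mulr_ge0; [exact: powR_exp_ge0|rewrite subr_ge0; exact: powRN_ge].
have aux (a b c : R) : 0 <= a * c * (b - (1 - s * t)) ->
    a * c <= a * b * c + s * (a * t * c).
  by rewrite -[_ <= a * b * c + _]subr_ge0; congr (0 <= _); ring.
exact: aux.
Qed.

(** With [r^-1] written as the integral of [t^(r-1)] over []0, 1[], the inequality holds pointwise:
    below [1] the product of [t^(p-s-1) - t^(p-1)] and [1 - exp (- t)] is nonnegative, and from [1]
    on [t^(p-s-1) <= t^(p-1)]. *)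
Lemma gamma_int_subr_le p s : 0 < s -> s < p ->
  (gamma_int (p - s) + (p^-1)%:E <= gamma_int p + ((p - s)^-1)%:E)%E.
Proof.
move=> s0 sp.
have I (r : R) : 0 < r -> (r^-1%:E =
    \int[leb]_(t in `]0%R, +oo[) (\1_(`]0%R, 1%R[%classic : set R) t * t `^ (r - 1))%:E)%E.
  move=> r0; transitivity (\int[leb]_(t in `]0%R, 1%R[) (t `^ (r - 1))%:E)%E.
    by rewrite integral_powR// powR1 div1r.
  rewrite [LHS]integral_indicl [RHS]integral_indicl; apply: eq_integral => t _.
  rewrite mulrA !indicE -natrM mulnb; congr ((nat_of_bool _)%:R * _)%:E.
  apply/idP/idP; last by move=> /andP[].
  move=> t01; rewrite t01 andbT; move: t01.
  by rewrite !inE/= !in_itv/= andbT => /andP[].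
have mI (r : R) : measurable_fun (`]0%R, +oo[%classic : set R) (fun t : R =>
    (\1_(`]0%R, 1%R[%classic : set R) t * t `^ (r - 1))%:E).
  apply: measurable_funTS; apply/measurable_EFinP; apply: measurable_funM.
    exact: measurable_indic.
  exact: measurable_powR.
have I0 (r t : R) : (0 <= (\1_(`]0%R, 1%R[%classic : set R) t * t `^ (r - 1))%:E)%E.
  by rewrite lee_fin mulr_ge0 ?powR_ge0.
have mG (r : R) : measurable_fun (`]0%R, +oo[%classic : set R) (fun t : R => (t `^ (r - 1) * expR (- t))%:E).
  by apply/measurable_EFinP; exact: measurable_powR_exp.
have G0 (r t : R) : (0 <= (t `^ (r - 1) * expR (- t))%:E)%E.
  by rewrite lee_fin powR_exp_ge0.
have p0 : 0 < p by exact: lt_trans sp.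
have ps0 : 0 < p - s by rewrite subr_gt0.
rewrite (I p p0) (I (p - s) ps0) /gamma_int -!ge0_integralD//;
  try solve [exact: mG | exact: mI].
apply: ge0_le_integral => //.
- by move=> t _; exact: adde_ge0.
- exact: (emeasurable_funD (mG _) (mI _)).
- exact: (emeasurable_funD (mG _) (mI _)).
move=> t /=; rewrite in_itv/= andbT => t0; rewrite -!EFinD lee_fin.
have [t1|t1] := ltP t 1.
  rewrite !indicE mem_set/= ?in_itv/= ?t0// !mul1r.
  have : t `^ (p - 1) <= t `^ (p - s - 1).
    by apply: ger_powR; rewrite ?t0 ?ltW//; lra.
  have : expR (- t) <= 1 by rewrite expR_le1 oppr_le0 ltW.
  move: (t `^ (p - 1)) (t `^ (p - s - 1)) (expR (- t)) => a b c; nra.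
rewrite !indicE memNset/= ?in_itv/=; last by move=> /andP[_]; rewrite ltNge t1.
rewrite !mul0r !addr0 ler_wpM2r ?expR_ge0//; apply: ler_powR => //; lra.
Qed.

End gamma.

(** * Gaussian integrals and the Gamma function at half-integers *)

Section gaussian.
Context {R : realType}.

Lemma sqnorm_rV_cons n (t : R) (x : 'rV[R]_n) :
  sqnorm (rV_cons (t, x)) = t ^+ 2 + sqnorm x.
Proof.
rewrite /sqnorm big_ord_recl rV_cons0; congr (_ + _).
by apply: eq_bigr => i _; rewrite rV_consS.
Qed.

Lemma measurable_expR_sqnorm n :
  measurable_fun setT (fun x : 'rV[R]_n => expR (- sqnorm x)).
Proof.
apply: measurableT_comp => //; apply: measurable_funN; exact: measurable_sqnorm.
Qed.

Lemma integral_gauss_rV n :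
  (\int[lebesgue_rV R n]_x (expR (- sqnorm x))%:E = (Num.sqrt pi ^+ n)%:E)%E.
Proof.
elim: n => [|n IH].
  rewrite /= integral_dirac//; last first.
    by apply/measurable_EFinP; exact: measurable_expR_sqnorm.
  by rewrite diracT mul1e /sqnorm big_ord0 oppr0 expR0 expr0.
rewrite integral_lebesgue_rVS; last 2 first.
- by apply/measurable_EFinP; exact: measurable_expR_sqnorm.
- by move=> x; rewrite lee_fin expR_ge0.
under eq_integral => t _.
  under eq_integral do rewrite sqnorm_rV_cons opprD expRD EFinM.
  rewrite ge0_integralZl_EFin ?expR_ge0//; last first.
    by apply/measurable_EFinP; exact: measurable_expR_sqnorm.
  rewrite IH.
  over.
rewrite ge0_integralZr//; last first.
  by apply/measurable_EFinP; exact: measurable_gauss_fun.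
by rewrite integralT_gauss -EFinM exprS.
Qed.

(** The Gaussian integral computed once as a product and once radially. It yields together the
    positivity of the shell volume, the finiteness of [gamma_int] at [n / 2], and the relation
    between the two. *)
Lemma gamma_int_half n : (0 < n)%N ->
  (Num.sqrt pi ^+ n)%:E =
    ((n%:R / 2 * shell_volume (R := R) (n := n))%:E * gamma_int (n%:R / 2))%E.
Proof.
move=> n0; rewrite -integral_gauss_rV.
have mphi : measurable_fun setT (fun t : R => expR (- t)).
  by apply: measurableT_comp => //; exact: measurable_funN.
rewrite -(integral_radial n0 mphi); last 2 first.
- by move=> t; exact: expR_ge0.
(* [s < expR (- t)] means [t < - ln s]; the maximum with [0] keeps the bound nonnegative. *)
- move=> s s0; exists (Num.max 0 (- ln s)); first by rewrite le_max lexx.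
  move=> t t0; rewrite lt_max (ltNge t 0) (ltW t0)/=.
  by rewrite -{1}(lnK s0) ltr_expR ltrNr.
apply: ge0_ae_eq_integral => //.
- by apply/measurable_EFinP; exact: measurable_expR_sqnorm.
- apply/measurable_EFinP; apply: measurable_funM; last exact: measurable_expR_sqnorm.
  by apply: measurable_indic; apply: measurable_lt_set => //; exact: measurable_sqnorm.
exists [set 0]; split; [exact: measurable_set1_rV|exact: lebesgue_rV_set1|].
move=> x /= H; apply/eqP; apply: contrapT => /negP x0; apply: H => _.
by rewrite indicE mem_set ?mul1r//= sqnorm_gt0.
Qed.

Lemma shell_volume_gt0 n : (0 < n)%N -> 0 < shell_volume (R := R) (n := n).
Proof.
move=> n0; rewrite lt_def shell_volume_ge0 andbT; apply/eqP => v0.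
have := gamma_int_half n0; rewrite v0 mulr0 mul0e => -[] /eqP.
by rewrite expf_eq0 gt_eqF ?andbF// sqrtr_gt0 pi_gt0.
Qed.

Lemma gamma_int_half_fin_num n : (0 < n)%N ->
  gamma_int (n%:R / 2 : R) \is a fin_num.
Proof.
move=> n0; have := gamma_int_half n0; have := gamma_int_ge0 (n%:R / 2 : R).
case: gamma_int => // _; rewrite gt0_muley// lte_fin mulr_gt0 ?shell_volume_gt0//.
by rewrite divr_gt0 ?ltr0n.
Qed.

Lemma Gamma_half n : (0 < n)%N ->
  Num.sqrt pi ^+ n = n%:R / 2 * shell_volume (n := n) * Gamma (n%:R / 2 : R).
Proof.
move=> n0; apply: EFin_inj; rewrite gamma_int_half//.
by rewrite -[gamma_int _]fineK ?gamma_int_half_fin_num// -EFinM.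
Qed.

End gaussian.

(** * The Riesz kernel as s tends to 0 *)

Section riesz_kernel.
Context {R : realType} {n : nat}.
Hypothesis n0 : (0 < n)%N.
Local Notation mu := (lebesgue_rV R n).
Local Notation leb := (@lebesgue_measure R).
Local Notation V := ('rV[R]_n).
Implicit Types (x y : V) (s : R).

Let p : R := n%:R / 2.

Let p0 : 0 < p. Proof. by rewrite divr_gt0 ?ltr0n. Qed.

Lemma riesz_const_ge0 s : 0 <= riesz_const (R := R) n s.
Proof. by rewrite /riesz_const !mulr_ge0 ?invr_ge0 ?powR_ge0 ?Gamma_ge0. Qed.

Lemma riesz_kernel_ge0 s x : 0 <= riesz_kernel s x.
Proof. by rewrite mulr_ge0 ?riesz_const_ge0 ?powR_ge0. Qed.

Lemma measurable_riesz_kernel s : measurable_fun setT (@riesz_kernel R n s).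
Proof.
apply: measurable_funM => //.
exact: (measurableT_comp (measurable_powR _) (@measurable_enorm R n)).
Qed.

Lemma riesz_kernel_enorm s x y : enorm x = enorm y ->
  riesz_kernel s x = riesz_kernel s y.
Proof. by rewrite /riesz_kernel => ->. Qed.

Lemma ler_powRN (a b r : R) : 0 <= r -> 0 < a -> a <= b -> b `^ (- r) <= a `^ (- r).
Proof.
move=> r0 a0 ab; have b0 := lt_le_trans a0 ab.
rewrite !powRN lef_pV2 ?posrE ?powR_gt0//.
by apply: ge0_ler_powR => //; rewrite nnegrE ltW.
Qed.

Lemma riesz_kernel_le s x y : 2 * s < n%:R -> 0 < enorm x ->
  enorm x <= enorm y -> riesz_kernel s y <= riesz_kernel s x.
Proof.
move=> sn x0 xy; rewrite ler_wpM2l ?riesz_const_ge0// -opprB.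
by apply: ler_powRN => //; rewrite subr_ge0 ltW.
Qed.

Lemma riesz_kernel_far s x : 2 * s < n%:R -> 1 <= enorm x ->
  riesz_kernel s x <= riesz_const n s.
Proof.
move=> sn x1; rewrite ler_piMr ?riesz_const_ge0// -opprB.
have r0 : 0 <= n%:R - 2 * s by rewrite subr_ge0 ltW.
by have := ler_powRN r0 ltr01 x1; rewrite powR1.
Qed.

(** The [A s] of the overview: by [integral_riesz_kernel_near] with [delta = 1], the integral of the
    kernel over the unit ball when [0 < s] and [2 * s < n]. *)
Definition near_mass s : R :=
  riesz_const n s * (p * shell_volume (R := R) (n := n)) / s.

Lemma near_mass_ge0 s : 0 < s -> 0 <= near_mass s.
Proof.
move=> s0; rewrite /near_mass mulr_ge0 ?invr_ge0 ?(ltW s0)//.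
by rewrite mulr_ge0 ?riesz_const_ge0// mulr_ge0 ?(ltW p0) ?shell_volume_ge0.
Qed.

Lemma lt_powRN (r s t : R) : 0 < r -> 0 < s -> 0 < t ->
  (s < t `^ (- r)) = (t < s `^ (- r^-1)).
Proof.
move=> r0 s0 t0; rewrite -(@ltr_ln _ s) ?posrE ?powR_gt0//.
rewrite -(@ltr_ln _ t) ?posrE ?powR_gt0// !ln_powR !mulNr [RHS]ltrNr.
by rewrite [in RHS]mulrC ltr_pdivrMr// mulrC mulNr ltrNr.
Qed.

Lemma integral_riesz_kernel_near s (delta : R) : 0 < s -> 2 * s < n%:R -> 0 < delta ->
  (\int[mu]_x (\1_[set x | enorm x < delta] x * riesz_kernel s x)%:E =
   (near_mass s * (delta ^+ 2) `^ s)%:E)%E.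
Proof.
move=> s0 sn d0; have sp : s < p by rewrite /p ltr_pdivlMr// mulrC.
(* The truncated kernel, up to its constant, as a function of the square norm: the exponent
   [2 * s - n] is halved. *)
pose phi (t : R) := \1_[set t : R | t < delta ^+ 2] t * t `^ (- (p - s)).
have mphi : measurable_fun setT phi.
  apply: measurable_funM; last exact: measurable_powR.
  by apply: measurable_indic; exact: measurable_lt_set.
have phi0 t : 0 <= phi t by rewrite mulr_ge0 ?powR_ge0.
transitivity (\int[mu]_x ((riesz_const n s)%:E *
    (\1_[set x | 0 < sqnorm x] x * phi (sqnorm x))%:E))%E.
  apply: eq_integral => x _; rewrite -EFinM; congr EFin.
  rewrite /riesz_kernel mulrCA; congr (_ * _).
  rewrite [in RHS]indicE; have [->|x0] := eqVneq x 0.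
    (* At the origin both sides vanish, a nonzero power of [0] being [0]. *)
    rewrite memNset/= ?sqnorm0 ?ltxx// mul0r.
    rewrite enormE sqnorm0 sqrtr0 powR0 ?mulr0//.
    by rewrite subr_eq0 lt_eqF.
  rewrite mem_set/= ?sqnorm_gt0// mul1r /phi !indicE; congr ((nat_of_bool _)%:R * _).
    have E : (enorm x < delta) = (sqnorm x < delta ^+ 2).
      by rewrite -sqr_enorm ltr_pXn2r// ?nnegrE ?enorm_ge0// ltW.
    by apply/idP/idP; rewrite !inE/= E.
  rewrite enormE -powR12_sqrt ?sqnorm_ge0// -powRrM; congr powR.
  by rewrite /p; field.
rewrite ge0_integralZl_EFin ?riesz_const_ge0//; last 2 first.
- by move=> x _; rewrite lee_fin mulr_ge0.
- apply/measurable_EFinP; apply: measurable_funM.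
    by apply: measurable_indic; apply: measurable_lt_set => //; exact: measurable_sqnorm.
  exact: (measurableT_comp mphi (@measurable_sqnorm R n)).
rewrite integral_radial//; last first.
  move=> u u0; exists (Num.min (delta ^+ 2) (u `^ (- (p - s)^-1))).
    by rewrite le_min sqr_ge0 powR_ge0.
  move=> t t0; rewrite lt_min -lt_powRN ?subr_gt0// /phi indicE.
  have [td|td] := ltP t (delta ^+ 2); first by rewrite mem_set// mul1r.
  rewrite memNset/= ?mul0r; first by rewrite ltNge (ltW u0).
  by rewrite ltNge td.
rewrite -/p.
transitivity ((riesz_const n s)%:E * ((p * shell_volume (R := R) (n := n))%:E *
    \int[leb]_(t in `]0%R, (delta ^+ 2)%R[) (t `^ (s - 1))%:E))%E.
  congr (_ * (_ * _))%E; rewrite [LHS]integral_indicl [RHS]integral_indicl.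
  apply: eq_integral => t _; congr EFin; rewrite !indicE.
  have [t0|t0] := ltP 0 t; last first.
    rewrite memNset/= ?in_itv/= ?andbT; last by rewrite ltNge t0.
    rewrite memNset/= ?in_itv/=; last by rewrite ltNge t0.
    by rewrite !mul0r.
  rewrite [in LHS]mem_set/= ?in_itv/= ?t0// mul1r /phi indicE mulrCA.
  congr ((nat_of_bool _)%:R * _).
    by apply/idP/idP; rewrite !inE/= in_itv/= t0.
  by rewrite -powRD ?(gt_eqF t0) ?implybT//; congr powR; lra.
rewrite integral_powR ?sqr_ge0// -!EFinM; congr EFin.
rewrite /near_mass; move: ((delta ^+ 2) `^ s) (riesz_const n s) => a b.
by field; rewrite gt_eqF.
Qed.

Let gfin : gamma_int p \is a fin_num. Proof. exact: gamma_int_half_fin_num. Qed.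

Let gfin1 : gamma_int (p + 1) \is a fin_num.
Proof.
(* A half-integer again, that of dimension [n + 2]. *)
have -> : p + 1 = n.+2%:R / 2 by rewrite /p -[n.+2]addn2 natrD; field.
exact: gamma_int_half_fin_num.
Qed.

Let gammaP : gamma_int p = (Gamma p)%:E. Proof. by rewrite GammaE fineK. Qed.
Let gammaP1 : gamma_int (p + 1) = (Gamma (p + 1))%:E.
Proof. by rewrite GammaE fineK. Qed.

Let Gamma_subr s : 0 < s -> s < p ->
  Gamma p - s * Gamma (p + 1) <= Gamma (p - s) <= Gamma p + ((p - s)^-1 - p^-1).
Proof.
move=> s0 sp; have := gamma_int_subr_ge s0 sp; have := gamma_int_subr_le s0 sp.
have := gamma_int_ge0 (p - s); rewrite gammaP gammaP1 [Gamma (p - s)]GammaE.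
case: (gamma_int (p - s)) => [r| |] //=; rewrite -?EFinM -?EFinD ?lee_fin//.
by move=> _ h1 h2; apply/andP; split; lra.
Qed.

Let cvg_id0 : (s : R) @[s --> (0 : R)^'+] --> (0 : R).
Proof. by apply: cvg_at_right_filter; exact: cvg_id. Qed.

Lemma Gamma_subr_cvg : Gamma (p - s) @[s --> 0^'+] --> Gamma p.
Proof.
apply: (@squeeze_cvgr _ _ _ _ (fun s => Gamma p - s * Gamma (p + 1))
  (fun s => Gamma p + ((p - s)^-1 - p^-1))).
- near=> s; have sp : s < p by near: s; exact: nbhs_right_lt.
  by apply: Gamma_subr.
- rewrite -[X in _ --> X]subr0 -[X in _ - X](mul0r (Gamma (p + 1))).
  by apply: cvgB; [exact: cvg_cst|apply: cvgMl].
- rewrite -[X in _ --> X]addr0 -[X in _ + X](subrr p^-1).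
  apply: cvgD; [exact: cvg_cst|apply: cvgB; last exact: cvg_cst].
  apply: cvgV; first by rewrite gt_eqF.
  by rewrite -[X in _ --> X]subr0; apply: cvgB; [exact: cvg_cst|].
Unshelve. all: by end_near. Qed.

Lemma mulr_Gamma_cvg : s * Gamma s @[s --> (0 : R)^'+] --> (1 : R).
Proof.
apply: (@squeeze_cvgr _ _ _ _ (fun s : R => 1 - s) (fun s : R => 1 + s)).
- near=> s; have s0 : 0 < s by [].
  have s1 : s < 1 by near: s; exact: nbhs_right_lt.
  have /andP[] := gamma_int_near0 s0 s1; rewrite [Gamma s]GammaE.
  case: (gamma_int s) => [r| |] //=; rewrite ?lee_fin => h1 h2.
  have : s * (s^-1 - 1) <= s * r by rewrite ler_pM2l.
  have : s * r <= s * (s^-1 + 1) by rewrite ler_pM2l.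
  rewrite mulrBr mulrDr divff ?gt_eqF// mulr1 => ? ?.
  by apply/andP; split.
- by rewrite -[X in _ --> X]subr0; apply: cvgB; [exact: cvg_cst|].
- by rewrite -[X in _ --> X]addr0; apply: cvgD; [exact: cvg_cst|].
Unshelve. all: by end_near. Qed.

(** [Gamma_half] expresses the shell volume through [Gamma p] and a power of pi, which cancels the
    one in [riesz_const]. Each remaining factor tends to [1]. *)
Lemma near_massE s : s != 0 -> Gamma s != 0 ->
  near_mass s = 2 `^ (- (2 * s)) * (Gamma (p - s) / Gamma p) / (s * Gamma s).
Proof.
move=> s0 gs0.
have gp0 : Gamma p != 0.
  have := Gamma_half (R := R) n0; rewrite -/p; apply: contra_eq_neq => ->.
  by rewrite mulr0 expf_eq0 gt_eqF ?andbF// sqrtr_gt0 pi_gt0.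
have pi0 : Num.sqrt (pi : R) ^+ n != 0.
  by rewrite expf_eq0 gt_eqF ?andbF// sqrtr_gt0 pi_gt0.
have E : p * shell_volume (R := R) (n := n) = Num.sqrt pi ^+ n / Gamma p.
  by rewrite (Gamma_half (R := R) n0) -/p mulfK.
have pE : (pi : R) `^ (- p) = (Num.sqrt pi ^+ n)^-1.
  rewrite powRN; congr (_^-1); rewrite /p mulrC powRrM powR12_sqrt ?pi_ge0//.
  by rewrite powR_mulrn// sqrtr_ge0.
rewrite /near_mass E /riesz_const -/p pE.
move: (Num.sqrt pi ^+ n) (2 `^ _) (Gamma (p - s)) (Gamma p) (Gamma s) pi0 gp0 gs0.
by move=> a b c d e a0 d0 e0; field; rewrite a0 d0 e0 s0.
Qed.

Lemma near_mass_cvg : near_mass s @[s --> 0^'+] --> (1 : R).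
Proof.
have gp0 : Gamma p != 0.
  have := Gamma_half (R := R) n0; rewrite -/p; apply: contra_eq_neq => ->.
  by rewrite mulr0 expf_eq0 gt_eqF ?andbF// sqrtr_gt0 pi_gt0.
have : 2 `^ (- (2 * s)) * (Gamma (p - s) / Gamma p) / (s * Gamma s)
    @[s --> (0 : R)^'+] --> (1 * (Gamma p / Gamma p) / 1 : R).
  apply: cvgM; last by apply: cvgV; [exact: oner_neq0|exact: mulr_Gamma_cvg].
  apply: cvgM; last by apply: cvgMl; exact: Gamma_subr_cvg.
  rewrite /powR gt_eqF// -[X in _ --> X]expR0.
  apply: continuous_cvg; first exact: continuous_expR.
  rewrite -[X in _ --> X](mul0r (ln 2)); apply: cvgMl.
  rewrite -[X in _ --> X]oppr0; apply: cvgN.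
  by rewrite -[X in _ --> X](mulr0 2); apply: cvgMr.
rewrite divff// !mulr1 invr1 mulr1 => h; apply: (cvg_trans _ h); apply: near_eq_cvg.
near=> s; rewrite near_massE ?gt_eqF//.
have s0 : 0 < s by [].
have s1 : s < 1 by near: s; exact: nbhs_right_lt.
have /andP[] := gamma_int_near0 s0 s1; rewrite [Gamma s]GammaE.
case: (gamma_int s) => [r| |] //=; rewrite ?lee_fin => h1 h2.
by rewrite (lt_le_trans _ h1)// subr_gt0 invf_gt1.
Unshelve. all: by end_near. Qed.

(** Up to a fixed positive factor the constant is [near_mass s * s], and [near_mass] stays
    bounded. *)
Lemma riesz_const_cvg : riesz_const n s @[s --> 0^'+] --> (0 : R).
Proof.
have k0 : p * shell_volume (R := R) (n := n) != 0.
  by rewrite mulf_neq0// gt_eqF// shell_volume_gt0.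
have : near_mass s * s / (p * shell_volume (R := R) (n := n))
   @[s --> 0^'+] --> 1 * 0 / (p * shell_volume (R := R) (n := n)).
  by apply: cvgMl; apply: cvgM => //; exact: near_mass_cvg.
rewrite mulr0 mul0r => h; apply: (cvg_trans _ h); apply: near_eq_cvg; near=> s.
rewrite /near_mass divfK; first by rewrite mulfK.
by rewrite gt_eqF.
Unshelve. all: by end_near. Qed.

End riesz_kernel.

(** * Interaction energies *)

Ltac nonneg := repeat first [solve [trivial | exact: ler01] | apply: mulr_ge0].

Section nonnegative_integrals.
Context d (T : measurableType d) {R : realType}.
Variable mu : {measure set T -> \bar R}.
Implicit Types f g : T -> R.

Lemma nnint_ge0 f : (forall x, 0 <= f x) -> (0 <= \int[mu]_x (f x)%:E)%E.
Proof. by move=> f0; apply: integral_ge0 => x _; rewrite lee_fin. Qed.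

Lemma nnintD f g : measurable_fun setT f -> measurable_fun setT g ->
  (forall x, 0 <= f x) -> (forall x, 0 <= g x) ->
  (\int[mu]_x (f x + g x)%:E = \int[mu]_x (f x)%:E + \int[mu]_x (g x)%:E)%E.
Proof.
move=> mf mg f0 g0; rewrite -ge0_integralD//.
- by move=> x _; rewrite lee_fin.
- exact/measurable_EFinP.
- by move=> x _; rewrite lee_fin.
- exact/measurable_EFinP.
Qed.

Lemma nnintZ f k : measurable_fun setT f -> (forall x, 0 <= f x) -> 0 <= k ->
  (\int[mu]_x (k * f x)%:E = k%:E * \int[mu]_x (f x)%:E)%E.
Proof.
move=> mf f0 k0; rewrite -ge0_integralZl_EFin//.
- by move=> x _; rewrite lee_fin.
- exact/measurable_EFinP.
Qed.

Lemma nnint_le f g : measurable_fun setT f -> measurable_fun setT g ->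
  (forall x, 0 <= f x) -> (forall x, f x <= g x) ->
  (\int[mu]_x (f x)%:E <= \int[mu]_x (g x)%:E)%E.
Proof.
move=> mf mg f0 fg; apply: ge0_le_integral => //.
- by move=> x _; rewrite lee_fin.
- exact/measurable_EFinP.
- exact/measurable_EFinP.
- by move=> x _; rewrite lee_fin.
Qed.

Lemma nnint_ae_le f g N : measurable N -> mu N = 0 ->
  measurable_fun setT f -> measurable_fun setT g ->
  (forall x, 0 <= f x) -> (forall x, 0 <= g x) ->
  (forall x, ~ N x -> f x <= g x) ->
  (\int[mu]_x (f x)%:E <= \int[mu]_x (g x)%:E)%E.
Proof.
move=> mN N0 mf mg f0 g0 fg; apply: ae_ge0_le_integral => //.
- by move=> x _; rewrite lee_fin.
- exact/measurable_EFinP.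
- by move=> x _; rewrite lee_fin.
- exact/measurable_EFinP.
- exists N; split => // x /= h; apply: contrapT => Nx; apply: h => _.
  by rewrite lee_fin fg.
Qed.

Lemma nnint_ae_eq f g : measurable_fun setT f -> measurable_fun setT g ->
  (forall x, 0 <= f x) -> (forall x, 0 <= g x) -> f = g %[ae mu] ->
  (\int[mu]_x (f x)%:E = \int[mu]_x (g x)%:E)%E.
Proof.
move=> mf mg f0 g0 fg; apply: ge0_ae_eq_integral => //.
- exact/measurable_EFinP.
- exact/measurable_EFinP.
- by move=> x _; rewrite lee_fin.
- by move=> x _; rewrite lee_fin.
- by apply: filterS fg => x /= fgx xT; rewrite fgx.
Qed.

Lemma nnint_eq0 f : measurable_fun setT f -> (forall x, 0 <= f x) ->
  (\int[mu]_x (f x)%:E = 0)%E -> f = \0 %[ae mu].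
Proof.
move=> mf f0 f00.
have /(ae_eq_integral_abs mu measurableT) H : (\int[mu]_x `|(f x)%:E| = 0)%E.
  by rewrite -[RHS]f00; apply: eq_integral => x _; rewrite gee0_abs// lee_fin.
have {}H := H (proj2 (measurable_EFinP _ _) mf).
by apply: filterS H => x /= + xT => /(_ xT) [].
Qed.

End nonnegative_integrals.

Lemma integral_reflect_rV {R : realType} n (a : 'rV[R]_n) (f : 'rV[R]_n -> \bar R) :
  measurable_fun setT f -> (forall x, 0 <= f x)%E ->
  (\int[lebesgue_rV R n]_x f (a - x)%R = \int[lebesgue_rV R n]_x f x)%E.
Proof.
move=> mf f0; rewrite -[RHS](integral_opp_rV mf f0).
have mfN : measurable_fun setT (fun x : 'rV[R]_n => f (- x)).
  apply: (measurableT_comp mf).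
  rewrite (_ : -%R = fun x : 'rV[R]_n => 0 - x); last by apply/funext => x; rewrite sub0r.
  exact: measurable_rVB.
rewrite -[RHS](integral_translate_rV (- a) mfN)//.
by apply: eq_integral => x _; rewrite opprB.
Qed.

Section double_integrals.
Context d1 d2 (X : measurableType d1) (Y : measurableType d2) {R : realType}.
Variables (mu : {sigma_finite_measure set X -> \bar R})
  (nu : {sigma_finite_measure set Y -> \bar R}).
Implicit Types F G : X -> Y -> R.

Let meas F := measurable_fun setT (fun z : X * Y => F z.1 z.2).

Lemma dint_measurable_sec F x : meas F -> measurable_fun setT (F x).
Proof. by move=> mF; exact: (measurableT_comp mF (pair1_measurable x)). Qed.

Lemma dint_measurable F : meas F -> (forall x y, 0 <= F x y) ->
  measurable_fun setT (fun x => \int[nu]_y (F x y)%:E)%E.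
Proof.
move=> mF F0; apply: (measurable_integral_tonelli nu (fun x y => (F x y)%:E)).
  exact/measurable_EFinP.
by move=> x y; rewrite lee_fin.
Qed.

Lemma dint_swap F : meas F -> (forall x y, 0 <= F x y) ->
  (\int[mu]_x \int[nu]_y (F x y)%:E = \int[nu]_y \int[mu]_x (F x y)%:E)%E.
Proof.
move=> mF F0; apply: (tonelli (fun x y => (F x y)%:E)).
  exact/measurable_EFinP.
by move=> x y; rewrite lee_fin.
Qed.

Lemma dintD F G : meas F -> meas G ->
  (forall x y, 0 <= F x y) -> (forall x y, 0 <= G x y) ->
  (\int[mu]_x \int[nu]_y (F x y + G x y)%:E =
   \int[mu]_x \int[nu]_y (F x y)%:E + \int[mu]_x \int[nu]_y (G x y)%:E)%E.
Proof.
move=> mF mG F0 G0; rewrite -ge0_integralD//; last 4 first.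
- by move=> x _; exact: nnint_ge0.
- exact: dint_measurable.
- by move=> x _; exact: nnint_ge0.
- exact: dint_measurable.
apply: eq_integral => x _; rewrite nnintD//; exact: dint_measurable_sec.
Qed.

(** The exceptional set may depend on [x]: this is what removes the diagonal and its mirror image in
    [interaction_polarize]. *)
Lemma dint_ae_le F G (N : X -> set Y) :
  (forall x, measurable (N x)) -> (forall x, nu (N x) = 0%E) ->
  meas F -> meas G -> (forall x y, 0 <= F x y) -> (forall x y, 0 <= G x y) ->
  (forall x y, ~ N x y -> F x y <= G x y) ->
  (\int[mu]_x \int[nu]_y (F x y)%:E <= \int[mu]_x \int[nu]_y (G x y)%:E)%E.
Proof.
move=> mN N0 mF mG F0 G0 FG; apply: ge0_le_integral => //.
- by move=> x _; exact: nnint_ge0.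
- exact: dint_measurable.
- exact: dint_measurable.
- move=> x _; apply: (nnint_ae_le (mN x) (N0 x)) => //.
  + exact: dint_measurable_sec.
  + exact: dint_measurable_sec.
  + exact: FG.
Qed.

Lemma dint_le F G : meas F -> meas G -> (forall x y, 0 <= F x y) ->
  (forall x y, F x y <= G x y) ->
  (\int[mu]_x \int[nu]_y (F x y)%:E <= \int[mu]_x \int[nu]_y (G x y)%:E)%E.
Proof.
move=> mF mG F0 FG; apply: (@dint_ae_le _ _ (fun=> set0)) => //.
by move=> x y; exact: le_trans (FG x y).
Qed.

End double_integrals.

Section interaction.
Context {R : realType} {n : nat}.
Hypothesis n0 : (0 < n)%N.
Local Notation mu := (lebesgue_rV R n).
Local Notation V := ('rV[R]_n).
Implicit Types (x y : V) (f g : V -> R).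

Definition interaction (s : R) f g : \bar R :=
  (\int[mu]_x \int[mu]_y (riesz_kernel s (x - y)%R * f x * g y)%:E)%E.

Lemma measurable_kernel2 (k : V -> R) f g : measurable_fun setT k ->
  measurable_fun setT f -> measurable_fun setT g ->
  measurable_fun setT (fun z : V * V => k (z.1 - z.2) * f z.1 * g z.2).
Proof.
move=> mk mf mg; apply: measurable_funM.
  apply: measurable_funM; last exact: (measurableT_comp mf measurable_fst).
  apply: (measurableT_comp mk).
  by apply: measurable_rVB; [exact: measurable_fst|exact: measurable_snd].
exact: (measurableT_comp mg measurable_snd).
Qed.

Lemma kernel2_sym (k : V -> R) f g : measurable_fun setT k ->
  (forall x, 0 <= k x) -> (forall x y, k (x - y) = k (y - x)) ->
  measurable_fun setT f -> measurable_fun setT g ->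
  (forall x, 0 <= f x) -> (forall x, 0 <= g x) ->
  (\int[mu]_x \int[mu]_y (k (x - y)%R * f x * g y)%:E =
   \int[mu]_x \int[mu]_y (k (x - y)%R * g x * f y)%:E)%E.
Proof.
move=> mk k0 ks mf mg f0 g0.
transitivity (\int[mu]_y \int[mu]_x (k (x - y)%R * f x * g y)%:E)%E.
  apply: (dint_swap mu mu (F := fun x y : V => k (x - y)%R * f x * g y)).
    exact: measurable_kernel2.
  by move=> x y; nonneg.
apply: eq_integral => y _; apply: eq_integral => x _.
by rewrite ks mulrAC.
Qed.

Lemma interaction_sym s f g : measurable_fun setT f -> measurable_fun setT g ->
  (forall x, 0 <= f x) -> (forall x, 0 <= g x) ->
  interaction s f g = interaction s g f.
Proof.
move=> mf mg f0 g0; apply: (@kernel2_sym (riesz_kernel s)).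
- exact: measurable_riesz_kernel.
- by move=> x; exact: riesz_kernel_ge0.
- by move=> x y; apply: riesz_kernel_enorm; rewrite enormB.
- exact: mf.
- exact: mg.
- exact: f0.
- exact: g0.
Qed.

Lemma interaction_ge0 s f g : (forall x, 0 <= f x) -> (forall x, 0 <= g x) ->
  (0 <= interaction s f g)%E.
Proof.
move=> f0 g0; apply: integral_ge0 => x _; apply: nnint_ge0 => y.
by rewrite mulr_ge0// mulr_ge0// riesz_kernel_ge0.
Qed.

Lemma interactionDl s f1 f2 g :
  measurable_fun setT f1 -> measurable_fun setT f2 -> measurable_fun setT g ->
  (forall x, 0 <= f1 x) -> (forall x, 0 <= f2 x) -> (forall x, 0 <= g x) ->
  (interaction s (fun x => f1 x + f2 x)%R g =
   interaction s f1 g + interaction s f2 g)%E.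
Proof.
move=> mf1 mf2 mg f10 f20 g0; have mK := @measurable_riesz_kernel R n s.
have K0 x : 0 <= riesz_kernel s x by exact: riesz_kernel_ge0.
rewrite /interaction -dintD.
- by apply: eq_integral => x _; apply: eq_integral => y _; rewrite mulrDr mulrDl.
- exact: measurable_kernel2.
- exact: measurable_kernel2.
- by move=> x y; nonneg.
- by move=> x y; nonneg.
Qed.

Lemma interaction_le s f f' g g' : measurable_fun setT f -> measurable_fun setT f' ->
  measurable_fun setT g -> measurable_fun setT g' ->
  (forall x, 0 <= f x <= f' x) -> (forall x, 0 <= g x <= g' x) ->
  (interaction s f g <= interaction s f' g')%E.
Proof.
move=> mf mf' mg mg' ff' gg'; have mK := @measurable_riesz_kernel R n s.
have K0 x : 0 <= riesz_kernel s x by exact: riesz_kernel_ge0.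
apply: dint_le; [exact: measurable_kernel2|exact: measurable_kernel2| |] => x y;
  have /andP[f0 fx] := ff' x; have /andP[g0 gy] := gg' y.
  by nonneg.
by apply: ler_pM => //; [rewrite mulr_ge0|exact: ler_wpM2l].
Qed.

Section bounds.
Variable s : R.
Hypotheses (s0 : 0 < s) (sn : 2 * s < n%:R).

Let Kn (delta : R) (x : V) : R := \1_[set x | enorm x < delta] x * riesz_kernel s x.

Let mKn delta : measurable_fun setT (Kn delta).
Proof.
apply: measurable_funM; last exact: measurable_riesz_kernel.
apply: measurable_indic; apply: measurable_lt_set => //; exact: measurable_enorm.
Qed.

Let mKK delta x : measurable_fun setT (fun y => Kn delta (x - y)).
Proof. by apply: (measurableT_comp (mKn delta)); apply: measurable_rVB. Qed.

Let Kn0 delta x : 0 <= Kn delta x.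
Proof. by rewrite mulr_ge0// riesz_kernel_ge0. Qed.

Let KnB delta x y : Kn delta (x - y) = Kn delta (y - x).
Proof.
rewrite /Kn (riesz_kernel_enorm s (enormB x y)); congr (_ * _).
by rewrite !indicE; congr ((nat_of_bool _)%:R); apply/idP/idP; rewrite !inE/= enormB.
Qed.

Let Kn_int delta x : 0 < delta ->
  (\int[mu]_y (Kn delta (x - y))%:E = (near_mass (n := n) s * (delta ^+ 2) `^ s)%:E)%E.
Proof.
move=> d0; rewrite -(integral_riesz_kernel_near n0 s0 sn d0).
have mE : measurable_fun setT (fun y => (Kn delta y)%:E) by exact/measurable_EFinP.
by rewrite -[RHS](integral_reflect_rV x mE)// => y; rewrite lee_fin.
Qed.

Let K_le x : riesz_kernel s x <= Kn 1 x + riesz_const n s.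
Proof.
rewrite /Kn indicE; have [x1|x1] := ltP (enorm x) 1.
  by rewrite mem_set// mul1r lerDl riesz_const_ge0.
by rewrite memNset/= ?ltNge ?x1// mul0r add0r riesz_kernel_far.
Qed.

Let Kn1_int x : (\int[mu]_y (Kn 1 (x - y))%:E = (near_mass (n := n) s)%:E)%E.
Proof. by rewrite Kn_int// expr1n powR1 mulr1. Qed.

(** The kernel is at most [Kn 1 + riesz_const]: [g <= h] is used against the near part, the masses
    against the constant. The bound is linear in the mass of [f], as the truncation argument
    requires for a small removed part. *)
Lemma interaction_le_bounded f g (h : R) :
  measurable_fun setT f -> measurable_fun setT g ->
  (forall x, 0 <= f x) -> (forall x, 0 <= g x <= h) ->
  (interaction s f g <=
   ((near_mass (n := n) s * h)%:E + (riesz_const n s)%:E * \int[mu]_x (g x)%:E) *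
     \int[mu]_x (f x)%:E)%E.
Proof.
move=> mf mg f0 gh.
have g0 x : 0 <= g x by have /andP[] := gh x.
have h0 : 0 <= h by have /andP[a b] := gh 0; exact: le_trans b.
have mK := @measurable_riesz_kernel R n s.
have K0 x : 0 <= riesz_kernel s x by exact: riesz_kernel_ge0.
have c0 := riesz_const_ge0 (R := R) (n := n) s.
have A0 := near_mass_ge0 n0 s0.
have mh1 : measurable_fun setT (fun x => h * f x) by exact: measurable_funM.
have mcf : measurable_fun setT (fun x => riesz_const n s * f x) by exact: measurable_funM.
have M1 := measurable_kernel2 (mKn 1) mh1 (measurable_cst (1 : R)).
have M2 := measurable_kernel2 (measurable_cst (1 : R)) mcf mg.
apply: (le_trans (y := \int[mu]_x \int[mu]_y
   (Kn 1 (x - y)%R * (h * f x) * 1 + 1 * (riesz_const n s * f x) * g y)%:E)%E).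
  apply: dint_le.
  - exact: measurable_kernel2.
  - exact: (measurable_funD M1 M2).
  - by move=> x y; nonneg.
  move=> x y; have /andP[gy0 gyh] := gh y.
  apply: (le_trans (y := (Kn 1 (x - y) + riesz_const n s) * f x * g y)).
    by rewrite ler_wpM2r// ler_wpM2r.
  rewrite mulrDl mulrDl mulr1 mul1r lerD2r -mulrA (mulrC h).
  by apply: ler_wpM2l; [exact: Kn0|apply: ler_wpM2l].
rewrite dintD; last 4 first.
- exact: M1.
- exact: M2.
- by move=> x y; nonneg.
- by move=> x y; nonneg.
rewrite ge0_muleDl; last 2 first.
- by rewrite lee_fin mulr_ge0.
- by apply: mule_ge0; [rewrite lee_fin|exact: nnint_ge0].
apply: leeD.
- rewrite -nnintZ//; last exact: mulr_ge0.
  rewrite le_eqVlt; apply/orP; left; apply/eqP; apply: eq_integral => x _.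
  transitivity ((h * f x)%:E * \int[mu]_y (Kn 1 (x - y)%R)%:E)%E.
    rewrite -nnintZ//; last exact: mulr_ge0.
    by apply: eq_integral => y _; rewrite mulr1 mulrC.
  by rewrite Kn1_int -EFinM mulrC mulrA.
- rewrite -muleA (muleC (\int[mu]_x (g x)%:E)%E) -ge0_integralZr//; last 3 first.
  - exact/measurable_EFinP.
  - by move=> x _; rewrite lee_fin.
  - exact: nnint_ge0.
  rewrite -ge0_integralZl_EFin//; last 2 first.
  - by move=> x _; apply: mule_ge0; [rewrite lee_fin|exact: nnint_ge0].
  - by apply: emeasurable_funM => //; exact/measurable_EFinP.
  rewrite le_eqVlt; apply/orP; left; apply/eqP; apply: eq_integral => x _.
  rewrite muleA -EFinM -nnintZ//; last exact: mulr_ge0.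
  by apply: eq_integral => y _; rewrite mul1r.
Qed.

(** Against the near part, [f x * f y] is at most half the sum of the squares; by symmetry each half
    integrates to the same value. *)
Lemma interaction_le_sqr f :
  measurable_fun setT f -> (forall x, 0 <= f x) ->
  (interaction s f f <= (near_mass (n := n) s)%:E * \int[mu]_x (f x ^+ 2)%:E +
   (riesz_const n s)%:E * (\int[mu]_x (f x)%:E * \int[mu]_x (f x)%:E))%E.
Proof.
move=> mf f0.
have mK := @measurable_riesz_kernel R n s.
have K0 x : 0 <= riesz_kernel s x by exact: riesz_kernel_ge0.
have c0 := riesz_const_ge0 (R := R) (n := n) s.
have A0 := near_mass_ge0 n0 s0.
have mf2 : measurable_fun setT (fun x => f x ^+ 2) by exact: measurable_funX.
have f20 x : 0 <= f x ^+ 2 by exact: sqr_ge0.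
have mff : measurable_fun setT (fun x => 2^-1 * f x ^+ 2) by exact: measurable_funM.
have ff0 x : 0 <= 2^-1 * f x ^+ 2 by rewrite mulr_ge0.
have mcf : measurable_fun setT (fun x => riesz_const n s * f x) by exact: measurable_funM.
pose k1 : V -> R := fun=> 1.
have mk1 : measurable_fun setT k1 by exact: measurable_cst.
have E1 : (\int[mu]_x \int[mu]_y (Kn 1 (x - y)%R * (2^-1 * f x ^+ 2) * k1 y)%:E =
    (near_mass (n := n) s)%:E * (2^-1%:E * \int[mu]_x (f x ^+ 2)%:E))%E.
  rewrite -nnintZ// -nnintZ//; apply: eq_integral => x _.
  transitivity ((2^-1 * f x ^+ 2)%:E * \int[mu]_y (Kn 1 (x - y)%R)%:E)%E.
    rewrite -nnintZ//.
    by apply: eq_integral => y _; rewrite mulr1 mulrC.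
  by rewrite Kn1_int -EFinM mulrC.
have E2 : (\int[mu]_x \int[mu]_y (Kn 1 (x - y)%R * k1 x * (2^-1 * f y ^+ 2))%:E =
    (near_mass (n := n) s)%:E * (2^-1%:E * \int[mu]_x (f x ^+ 2)%:E))%E.
  by rewrite -E1; apply: (@kernel2_sym (Kn 1)) => //; exact: KnB.
have E3 : (\int[mu]_x \int[mu]_y (k1 (x - y)%R * (riesz_const n s * f x) * f y)%:E =
    (riesz_const n s)%:E * (\int[mu]_x (f x)%:E * \int[mu]_x (f x)%:E))%E.
  rewrite -ge0_integralZr//; last 3 first.
  - exact/measurable_EFinP.
  - by move=> x _; rewrite lee_fin.
  - exact: nnint_ge0.
  rewrite -ge0_integralZl_EFin//; last 2 first.
  - by move=> x _; apply: mule_ge0; [rewrite lee_fin|exact: nnint_ge0].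
  - by apply: emeasurable_funM => //; exact/measurable_EFinP.
  apply: eq_integral => x _; rewrite muleA -EFinM -nnintZ//; last exact: mulr_ge0.
  by apply: eq_integral => y _; rewrite mul1r.
have M1 := measurable_kernel2 (mKn 1) mff mk1.
have M2 := measurable_kernel2 (mKn 1) mk1 mff.
have M3 := measurable_kernel2 mk1 mcf mf.
apply: (le_trans (y := \int[mu]_x \int[mu]_y
   (Kn 1 (x - y)%R * (2^-1 * f x ^+ 2) * k1 y +
    (Kn 1 (x - y)%R * k1 x * (2^-1 * f y ^+ 2) +
     k1 (x - y)%R * (riesz_const n s * f x) * f y))%:E)%E).
  apply: dint_le.
  - exact: measurable_kernel2.
  - exact: (measurable_funD M1 (measurable_funD M2 M3)).
  - by move=> x y; nonneg.
  move=> x y; rewrite /k1 !mulr1 mul1r.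
  apply: (le_trans (y := (Kn 1 (x - y) + riesz_const n s) * f x * f y)).
    by rewrite ler_wpM2r// ler_wpM2r.
  rewrite mulrDl mulrDl addrA lerD2r -mulrDr -mulrA ler_wpM2l//.
  have := sqr_ge0 (f x - f y); nra.
rewrite dintD; last 4 first.
- exact: M1.
- exact: (measurable_funD M2 M3).
- by move=> x y; nonneg.
- by move=> x y; apply: addr_ge0; nonneg.
rewrite dintD; last 4 first.
- exact: M2.
- exact: M3.
- by move=> x y; nonneg.
- by move=> x y; nonneg.
rewrite E1 E2 E3 addeA le_eqVlt; apply/orP; left; apply/eqP; congr (_ + _)%E.
rewrite -ge0_muleDr; last 2 first.
- by apply: mule_ge0; [rewrite lee_fin|exact: nnint_ge0].
- by apply: mule_ge0; [rewrite lee_fin|exact: nnint_ge0].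
congr (_ * _)%E; rewrite -ge0_muleDl ?lee_fin//.
by rewrite -EFinD (_ : 2^-1 + 2^-1 = 1 :> R) ?mul1e//; field.
Qed.

(** Only the pairs with [x] at depth [delta] in the ball and [y] within [delta] of [x] are kept, so
    that [y] ranges over a full ball around [x]. *)
Lemma interaction_eball_ge (r delta : R) : 0 < delta ->
  ((near_mass (n := n) s * (delta ^+ 2) `^ s)%:E * mu (eball (r - delta)) <=
   interaction s \1_(eball r) \1_(eball r))%E.
Proof.
move=> d0.
have mK := @measurable_riesz_kernel R n s.
have K0 x : 0 <= riesz_kernel s x by exact: riesz_kernel_ge0.
have mB r' : measurable_fun setT (\1_(eball r') : V -> R).
  by apply: measurable_indic; exact: measurable_eball.
apply: (le_trans (y := \int[mu]_x \int[mu]_y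
   (Kn delta (x - y)%R * \1_(eball (r - delta)) x * 1)%:E)%E).
  rewrite le_eqVlt; apply/orP; left; apply/eqP.
  rewrite -[X in mu X]setIT -integral_indic//; last exact: measurable_eball.
  rewrite -nnintZ//; last by rewrite mulr_ge0 ?powR_ge0// near_mass_ge0.
  apply: eq_integral => x _; rewrite mulrC EFinM -(Kn_int x d0) -nnintZ//.
  by apply: eq_integral => y _; rewrite mulr1 mulrC.
apply: dint_le.
- exact: (measurable_kernel2 (mKn delta) (mB _) (measurable_cst (1 : R))).
- exact: measurable_kernel2.
- by move=> x y; nonneg.
move=> x y; rewrite mulr1 /Kn !indicE.
have [xr|xr] := boolP (x \in eball (r - delta)); last first.
  by rewrite mulr0; nonneg.
rewrite mulr1; have [xy|xy] := ltP (enorm (x - y)) delta; last first.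
  by rewrite memNset/= ?ltNge ?xy// mul0r; nonneg.
rewrite mem_set// mul1r; move: xr; rewrite inE /eball/= => xr.
rewrite !mem_set/= ?mulr1//.
- have := ler_enormD x (y - x); rewrite addrC subrK enormB; lra.
- lra.
Qed.

End bounds.
End interaction.

(** * Polarization *)

Section invariance.
Context {R : realType} {n : nat}.
Local Notation mu := (lebesgue_rV R n).
Local Notation V := ('rV[R]_n).
Variable T : V -> V.
Hypothesis intT : forall f : V -> \bar R, measurable_fun setT f ->
  (forall x, 0 <= f x)%E -> (\int[mu]_x f (T x) = \int[mu]_x f x)%E.
Hypothesis normT : forall x y, enorm (T x - T y) = enorm (x - y).

Lemma nnint_comp (f : V -> R) : measurable_fun setT f -> (forall x, 0 <= f x) ->
  (\int[mu]_x (f (T x))%:E = \int[mu]_x (f x)%:E)%E.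
Proof.
move=> mf f0; apply: (intT (f := fun x => (f x)%:E)); first exact/measurable_EFinP.
by move=> x; rewrite lee_fin.
Qed.

Lemma interaction_comp s (f g : V -> R) :
  measurable_fun setT f -> measurable_fun setT g ->
  (forall x, 0 <= f x) -> (forall x, 0 <= g x) ->
  interaction s (f \o T) (g \o T) = interaction s f g.
Proof.
move=> mf mg f0 g0; have mK := @measurable_riesz_kernel R n s.
have K0 x : 0 <= riesz_kernel s x by exact: riesz_kernel_ge0.
pose F x y := riesz_kernel s (x - y) * f x * g y.
have mF : measurable_fun setT (fun z : V * V => F z.1 z.2).
  exact: measurable_kernel2.
have F0 x y : 0 <= F x y by rewrite /F; nonneg.
rewrite /interaction -[RHS](intT (dint_measurable mu mF F0)); last first.
  by move=> x; apply: nnint_ge0 => y; exact: F0.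
apply: eq_integral => x _.
rewrite -[RHS](nnint_comp (f := F (T x)) (dint_measurable_sec (F := F) (T x) mF) (F0 (T x))).
by apply: eq_integral => y _; rewrite /F (riesz_kernel_enorm s (normT x y)).
Qed.

Lemma free_energy_comp m chi beta s (f : V -> R) :
  measurable_fun setT f -> (forall x, 0 <= f x) ->
  free_energy m chi beta s (f \o T) = free_energy m chi beta s f.
Proof.
move=> mf f0; rewrite /free_energy.
rewrite (_ : (\int[mu]_x (((f \o T) x) `^ m)%:E = \int[mu]_x (f x `^ m)%:E)%E); last first.
  apply: (nnint_comp (f := fun x => f x `^ m)).
    exact: (measurableT_comp (measurable_powR _) mf).
  by move=> x; exact: powR_ge0.
rewrite (_ : (\int[mu]_x (((f \o T) x) ^+ 2)%:E = \int[mu]_x (f x ^+ 2)%:E)%E); last first.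
  apply: (nnint_comp (f := fun x => f x ^+ 2)); first exact: measurable_funX.
  by move=> x; exact: sqr_ge0.
have := interaction_comp s mf mf f0 f0; rewrite /interaction => -> //.
Qed.

End invariance.

Section concrete_isometries.
Context {R : realType} {n : nat}.
Local Notation mu := (lebesgue_rV R n).
Local Notation V := ('rV[R]_n).

Lemma measurable_translate (a : V) : measurable_fun setT (fun x : V => x + a).
Proof. exact: measurable_rVD. Qed.

Lemma enorm_translate (a x y : V) : enorm (x + a - (y + a)) = enorm (x - y).
Proof. by rewrite opprD addrACA subrr addr0. Qed.

Lemma measurable_opp_rV : measurable_fun setT (fun x : V => - x).
Proof.
rewrite (_ : (fun x => - x) = fun x : V => 0 - x); last first.
  by apply/funext => x; rewrite sub0r.
exact: measurable_rVB.
Qed.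

Lemma enorm_opp (x y : V) : enorm (- x - - y) = enorm (x - y).
Proof. by rewrite -opprD enormN. Qed.

Lemma integral_refl (v : V) (f : V -> \bar R) : v != 0 ->
  measurable_fun setT f -> (forall x, 0 <= f x)%E ->
  (\int[mu]_x f (refl v x) = \int[mu]_x f x)%E.
Proof.
move=> v0 mf f0; rewrite -[RHS](integral_translate_rV (2 *: v) mf f0).
apply: (integral_isometry (f := fun x => f (x + 2 *: v))).
- exact: measurable_householder.
- by move=> x; exact: householderK.
- exact: householderD.
- by move=> x; exact: sqnorm_householder.
- exact: (measurableT_comp mf (measurable_translate _)).
- by move=> x; exact: f0.
Qed.

End concrete_isometries.

(** Equality when the two pairs are ordered alike; otherwise the right side gains [k1 - k2] times
    the product of the two spreads. *)
Lemma two_point_ineq {R : realFieldType} (k1 k2 a b c d : R) : k2 <= k1 ->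
  k1 * (a * c + b * d) + k2 * (a * d + b * c) <=
  k1 * (Num.max a b * Num.max c d + Num.min a b * Num.min c d) +
  k2 * (Num.max a b * Num.min c d + Num.min a b * Num.max c d).
Proof.
move=> k12; have : 0 <= (k1 - k2) * ((Num.max a b - Num.min a b) *
    (Num.max c d - Num.min c d)).
  by rewrite !mulr_ge0// subr_ge0// le_max !ge_min !lexx ?orbT.
by case: (leP a b) => ab; case: (leP c d) => cd; lra.
Qed.

Section polarization.
Context {R : realType} {n : nat}.
Hypothesis n0 : (0 < n)%N.
Local Notation mu := (lebesgue_rV R n).
Local Notation V := ('rV[R]_n).
Variable v : V.
Hypothesis v0 : v != 0.
Implicit Types (f : V -> R) (x y : V).

Let sigma := refl v.

(* Two-point rearrangement towards the half-space containing the origin. *)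
Definition polarize f x : R :=
  if dot x v <= sqnorm v then Num.max (f x) (f (refl v x))
  else Num.min (f x) (f (refl v x)).

Let qv : 0 < sqnorm v. Proof. by rewrite sqnorm_gt0. Qed.

Lemma refl_fix x : dot x v = sqnorm v -> refl v x = x.
Proof.
move=> xv; rewrite /refl /householder xv mulfK ?gt_eqF//.
by rewrite addrNK.
Qed.

Lemma polarize_refl f x : polarize f (refl v x) =
  if dot x v <= sqnorm v then Num.min (f x) (f (refl v x))
  else Num.max (f x) (f (refl v x)).
Proof.
rewrite /polarize reflK// dot_refl// [in LHS]maxC [in LHS]minC.
have [xv|xv|xv] := ltgtP (dot x v) (sqnorm v).
- by rewrite leNgt (_ : sqnorm v < _)//; lra.
- by rewrite (_ : _ <= sqnorm v)//; lra.
- by rewrite refl_fix// maxxx minxx; case: ifP.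
Qed.

Lemma polarize_ge0 f : (forall x, 0 <= f x) -> forall x, 0 <= polarize f x.
Proof.
by move=> f0 x; rewrite /polarize; case: ifP => _; rewrite ?le_max ?le_min ?f0.
Qed.

Lemma measurable_polarize f : measurable_fun setT f ->
  measurable_fun setT (polarize f).
Proof.
move=> mf; have mfr : measurable_fun setT (fun x => f (refl v x)).
  exact: (measurableT_comp mf (measurable_refl v)).
have mH : measurable [set x : V | dot x v <= sqnorm v].
  by apply: measurable_le_set => //; exact: measurable_dot.
rewrite (_ : polarize f = fun x =>
  \1_[set x : V | dot x v <= sqnorm v] x * Num.max (f x) (f (refl v x)) +
  \1_(~` [set x : V | dot x v <= sqnorm v]) x * Num.min (f x) (f (refl v x))).
  apply: measurable_funD; apply: measurable_funM.
  - exact: measurable_indic.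
  - exact: measurable_maxr.
  - by apply: measurable_indic; exact: measurableC.
  - exact: measurable_minr.
apply/funext => x; rewrite /polarize !indicE in_setC; case: ifPn => h.
  by rewrite mem_set// mul1r mul0r addr0.
by rewrite memNset ?mul0r ?mul1r ?add0r//; exact/negP.
Qed.

(** Averaging over the reflection reduces an integral to pairs of mirror points, on which
    polarization acts by exchanging values. *)
Lemma symmetrize_refl f : measurable_fun setT f -> (forall x, 0 <= f x) ->
  (\int[mu]_x (f x)%:E = \int[mu]_x (2^-1 * (f x + f (refl v x)))%:E)%E.
Proof.
move=> mf f0; have mfr : measurable_fun setT (fun x => f (refl v x)).
  exact: (measurableT_comp mf (measurable_refl v)).
rewrite nnintZ//; last 2 first.
- exact: measurable_funD.
- by move=> x; exact: addr_ge0.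
rewrite nnintD// (nnint_comp (fun g => integral_refl (f := g) v0) mf f0).
rewrite ge0_muleDr ?nnint_ge0// -ge0_muleDl ?lee_fin//.
by rewrite -EFinD (_ : 2^-1 + 2^-1 = 1 :> R) ?mul1e//; field.
Qed.

(** Polarization only permutes the two values taken on a pair of mirror points. *)
Lemma integral_polarize f (phi : R -> R) : measurable_fun setT f ->
  (forall x, 0 <= f x) ->
  measurable_fun setT phi -> (forall t, 0 <= t -> 0 <= phi t) ->
  (\int[mu]_x (phi (polarize f x))%:E = \int[mu]_x (phi (f x))%:E)%E.
Proof.
move=> mf f0 mphi phi0.
rewrite (symmetrize_refl (measurableT_comp mphi (measurable_polarize mf))); last first.
  by move=> x; exact/phi0/polarize_ge0.
rewrite [RHS](symmetrize_refl (measurableT_comp mphi mf)); last first.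
  by move=> x; exact/phi0/f0.
apply: eq_integral => x _; congr (_ * _)%:E; rewrite /= polarize_refl /polarize.
case: ifP => _; case: (leP (f x) (f (refl v x))) => _ //; exact: addrC.
Qed.

(** The average over the four pairs obtained from [x], [y] and their mirror images; the interaction
    inequality holds pointwise for it. *)
Let four (F : V -> V -> R) x y :=
  2^-1 * (2^-1 * (F x y + F x (sigma y)) +
          2^-1 * (F (sigma x) y + F (sigma x) (sigma y))).

Let meas2 (F : V -> V -> R) := measurable_fun setT (fun z : V * V => F z.1 z.2).

Let comp2 (F : V -> V -> R) (a b : V * V -> V) : meas2 F ->
  measurable_fun setT a -> measurable_fun setT b ->
  measurable_fun setT (fun z => F (a z) (b z)).
Proof.
move=> mF ma mb.
have mab : measurable_fun setT (fun z => (a z, b z)) by apply/measurable_fun_pair.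
exact: (measurableT_comp mF mab).
Qed.

Let mfst : measurable_fun setT (fun z : V * V => z.1).
Proof. exact: measurable_fst. Qed.

Let msnd : measurable_fun setT (fun z : V * V => z.2).
Proof. exact: measurable_snd. Qed.

Let msigma1 : measurable_fun setT (fun z : V * V => sigma z.1).
Proof. exact: (measurableT_comp (@measurable_refl R n v) mfst). Qed.

Let msigma2 : measurable_fun setT (fun z : V * V => sigma z.2).
Proof. exact: (measurableT_comp (@measurable_refl R n v) msnd). Qed.

Let measurable_four (F : V -> V -> R) : meas2 F -> meas2 (four F).
Proof.
move=> mF.
have m1 := comp2 mF mfst msigma2.
have m2 := comp2 mF msigma1 msnd.
have m3 := comp2 mF msigma1 msigma2.
apply: measurable_funM; first exact: measurable_cst.
apply: measurable_funD; apply: measurable_funM; try exact: measurable_cst.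
  exact: (measurable_funD mF m1).
exact: (measurable_funD m2 m3).
Qed.

Let symmetrize2 (F : V -> V -> R) : meas2 F -> (forall x y, 0 <= F x y) ->
  (\int[mu]_x \int[mu]_y (F x y)%:E = \int[mu]_x \int[mu]_y (four F x y)%:E)%E.
Proof.
move=> mF F0.
have mS (G : V -> V -> R) : meas2 G ->
    meas2 (fun x y => 2^-1 * (G x y + G x (sigma y))).
  move=> mG; apply: measurable_funM; first exact: measurable_cst.
  exact: (measurable_funD mG (comp2 mG mfst msigma2)).
have inner (G : V -> V -> R) : meas2 G -> (forall x y, 0 <= G x y) ->
    (\int[mu]_x \int[mu]_y (G x y)%:E =
     \int[mu]_x \int[mu]_y (2^-1 * (G x y + G x (sigma y)))%:E)%E.
  move=> mG G0; apply: eq_integral => x _.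
  exact: (symmetrize_refl (dint_measurable_sec (F := G) x mG) (G0 x)).
have mswap (G : V -> V -> R) : meas2 G -> meas2 (fun y x => G x y).
  by move=> mG; exact: (comp2 mG msnd mfst).
pose G y x := 2^-1 * (F x y + F x (sigma y)).
have mG : meas2 G := mswap _ (mS _ mF).
have G0 y x : 0 <= G y x by rewrite mulr_ge0 ?addr_ge0 ?F0.
apply: (etrans (inner F mF F0)).
apply: (etrans (dint_swap mu mu (mS _ mF) (fun x y => G0 y x))).
apply: (etrans (inner G mG G0)).
apply: (dint_swap mu mu (mS _ mG)) => y x.
by rewrite mulr_ge0 ?addr_ge0 ?G0.
Qed.

(** On the four pairs built from [x], [y] and their images the kernel takes two values, and by
    [sqnorm_reflB] the larger one belongs to pairs on the same side. Polarization puts the two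
    maxima on the same side, so [two_point_ineq] concludes. *)
Lemma interaction_polarize s f : 2 * s < n%:R -> measurable_fun setT f ->
  (forall x, 0 <= f x) ->
  (interaction s f f <= interaction s (polarize f) (polarize f))%E.
Proof.
move=> sn mf f0; have mK := @measurable_riesz_kernel R n s.
have K0 x : 0 <= riesz_kernel s x by exact: riesz_kernel_ge0.
have p0 := polarize_ge0 f0; have mp := measurable_polarize mf.
pose F x y := riesz_kernel s (x - y) * f x * f y.
pose P x y := riesz_kernel s (x - y) * polarize f x * polarize f y.
have mF : meas2 F by exact: measurable_kernel2.
have mP : meas2 P by exact: measurable_kernel2.
have F0 x y : 0 <= F x y by rewrite /F; nonneg.
have P0 x y : 0 <= P x y by rewrite /P; nonneg.
rewrite /interaction (symmetrize2 mF F0) (symmetrize2 mP P0).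
have four0 (G : V -> V -> R) x y : (forall x y, 0 <= G x y) -> 0 <= four G x y.
  by move=> h; rewrite mulr_ge0 ?addr_ge0 ?mulr_ge0 ?addr_ge0 ?h.
(* The kernel takes the value 0 instead of +oo at the origin, hence the two
   excluded points. *)
apply: (@dint_ae_le _ _ _ _ _ _ _ _ _ (fun x => [set x] `|` [set sigma x])).
- by move=> x; apply: measurableU; exact: measurable_set1_rV.
- move=> x; apply: null_set_setU; try exact: measurable_set1_rV.
  + exact: lebesgue_rV_set1.
  + exact: lebesgue_rV_set1.
- exact: measurable_four.
- exact: measurable_four.
- by move=> x y; exact: four0.
- by move=> x y; exact: four0.
move=> x y /= /not_orP[yx ysx].
have k1E : riesz_kernel s (sigma x - sigma y) = riesz_kernel s (x - y).
  by apply: riesz_kernel_enorm; rewrite enorm_reflB.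
have k2E : riesz_kernel s (sigma x - y) = riesz_kernel s (x - sigma y).
  by apply: riesz_kernel_enorm; rewrite enorm_reflBl.
rewrite /four /F /P k1E k2E !polarize_refl /polarize -/sigma.
have qxy : sqnorm (x - sigma y) = sqnorm (x - y) +
    4 / sqnorm v * ((sqnorm v - dot x v) * (sqnorm v - dot y v)).
  have -> : sqnorm (x - sigma y) = sqnorm (sigma x - y).
    by rewrite -!sqr_enorm enorm_reflBl.
  exact: sqnorm_reflB.
have xy0 : 0 < enorm (x - y).
  rewrite lt_def enorm_ge0 andbT enorm_eq0 subr_eq0; apply/eqP => xy.
  by apply: yx; rewrite xy.
have xsy0 : 0 < enorm (x - sigma y).
  rewrite lt_def enorm_ge0 andbT enorm_eq0 subr_eq0; apply/eqP => xy.
  by apply: ysx; rewrite /= xy /sigma reflK.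
have q4 : 0 < 4 / sqnorm v by rewrite divr_gt0.
move: k1E k2E => _ _.
have cmp1 : 0 <= (sqnorm v - dot x v) * (sqnorm v - dot y v) ->
    riesz_kernel s (x - sigma y) <= riesz_kernel s (x - y).
  move=> h; apply: riesz_kernel_le => //.
  by rewrite ler_enorm qxy lerDl mulr_ge0 ?(ltW q4).
have cmp2 : (sqnorm v - dot x v) * (sqnorm v - dot y v) <= 0 ->
    riesz_kernel s (x - y) <= riesz_kernel s (x - sigma y).
  move=> h; apply: riesz_kernel_le => //.
  by rewrite ler_enorm qxy gerDl mulr_ge0_le0 ?(ltW q4).
move: (riesz_kernel s (x - y)) (riesz_kernel s (x - sigma y)) cmp1 cmp2 => k1 k2.
move: (f x) (f (sigma x)) (f y) (f (sigma y)) => a b c d cmp1 cmp2.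
have ge0 z : dot z v <= sqnorm v -> 0 <= sqnorm v - dot z v by rewrite subr_ge0.
have le0 z : ~~ (dot z v <= sqnorm v) -> sqnorm v - dot z v <= 0.
  by rewrite -ltNge subr_le0 => /ltW.
(* When [x] and [y] lie on opposite sides the two kernel values exchange roles, and the inequality
   is applied with one of the points replaced by its image. *)
case: ifPn => hx; case: ifPn => hy.
- move/ge0 : hx => hx; move/ge0 : hy => hy.
  by have := two_point_ineq a b c d (cmp1 (mulr_ge0 hx hy)); lra.
- move/ge0 : hx => hx; move/le0 : hy => hy.
  have := two_point_ineq a b d c (cmp2 (mulr_ge0_le0 hx hy)).
  by rewrite (maxC d) (minC d); lra.
- move/ge0 : hy => hy; move/le0 : hx => hx.
  have := two_point_ineq b a c d (cmp2 (mulr_le0_ge0 hx hy)).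
  by rewrite (maxC b) (minC b); lra.
- move/le0 : hx => hx; move/le0 : hy => hy.
  by have := two_point_ineq a b c d (cmp1 (mulr_le0 hx hy)); lra.
Qed.

End polarization.

(** * Densities and their first moments *)

Section densities.
Context {R : realType} {n : nat}.
Local Notation mu := (lebesgue_rV R n).
Local Notation V := ('rV[R]_n).
Implicit Types (f g : V -> R) (x y : V).

Lemma LfunP (p : R) f : 0 < p ->
  f \in Lfun mu p%:E <->
  measurable_fun setT f /\ (\int[mu]_x (`|f x| `^ p)%:E < +oo)%E.
Proof.
move=> p0; rewrite inE.
have E : finite_norm mu p%:E f <-> (\int[mu]_x (`|f x| `^ p)%:E < +oo)%E.
  rewrite /finite_norm unlock; split.
    by move=> /lty_poweRy; apply; rewrite invr_neq0// gt_eqF.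
  exact: poweR_lty.
split; first by move=> /andP[]; rewrite !inE => mf /E h; split.
by move=> [mf /E h]; apply/andP; rewrite !inE.
Qed.

Definition centered f : Prop := forall i : 'I_n,
  mu.-integrable setT (EFin \o (fun x => x ord0 i * f x)) /\
  (\int[mu]_x (x ord0 i * f x)%:E = 0)%E.

Lemma densityP m M f : 0 < m ->
  density m M f <-> [/\ measurable_fun setT f, (forall x, 0 <= f x),
    (\int[mu]_x (f x)%:E = M%:E)%E, (\int[mu]_x (f x `^ m)%:E < +oo)%E & centered f].
Proof.
move=> m0.
have int1 : (forall x, 0 <= f x) ->
    (\int[mu]_x (`|f x| `^ 1)%:E = \int[mu]_x (f x)%:E)%E.
  by move=> f0; apply: eq_integral => x _; rewrite powRr1// ger0_norm.
have intm : (forall x, 0 <= f x) ->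
    (\int[mu]_x (`|f x| `^ m)%:E = \int[mu]_x (f x `^ m)%:E)%E.
  by move=> f0; apply: eq_integral => x _; rewrite ger0_norm.
split.
- case=> /(LfunP _ ltr01) L1 /(LfunP _ m0) Lm f0 fM fc.
  have [mf fi] := L1; have [_ fm] := Lm.
  split; [exact: mf|exact: f0| | |].
  + move: fi; rewrite (int1 f0) => fi; move: fM; rewrite /Rintegral => fM.
    by rewrite -fM fineK// ge0_fin_numE//; exact: nnint_ge0.
  + by rewrite -(intm f0).
  + move=> i; have [/Lfun1_integrable h1 h2] := fc i; split; first exact: h1.
    move: h2; rewrite /Rintegral => h2.
    by rewrite -[LHS]fineK; [rewrite h2|exact: integrable_fin_num h1].
- case=> mf f0 fM fm fc; split; [| |exact: f0| |].
  + by apply/(LfunP _ ltr01); split; [exact: mf|rewrite (int1 f0) fM ltry].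
  + by apply/(LfunP _ m0); split; [exact: mf|rewrite (intm f0)].
  + by rewrite /Rintegral fM.
  + move=> i; have [h1 h2] := fc i; split; first exact/Lfun1_integrable.
    by rewrite /Rintegral h2.
Qed.

(** Positive and negative parts transfer an invariance known for nonnegative functions to the signed
    first moments. *)
Lemma integral_comp_signed (T : V -> V) (F : V -> \bar R) :
  (forall f : V -> \bar R, measurable_fun setT f ->
    (forall x, 0 <= f x)%E -> (\int[mu]_x f (T x) = \int[mu]_x f x)%E) ->
  measurable_fun setT F ->
  (\int[mu]_x F (T x) = \int[mu]_x F x)%E.
Proof.
move=> intT mF; rewrite [LHS]integralE [RHS]integralE; congr (_ - _)%E.
  rewrite -(intT _ (measurable_funepos mF)); last by move=> x; exact: funepos_ge0.
  by apply: eq_integral => x _; rewrite !funeposE.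
rewrite -(intT _ (measurable_funeneg mF)); last by move=> x; exact: funeneg_ge0.
by apply: eq_integral => x _; rewrite !funenegE.
Qed.

Lemma measurable_coordM f i : measurable_fun setT f ->
  measurable_fun setT (fun x : V => x ord0 i * f x).
Proof. by move=> mf; apply: measurable_funM => //; exact: measurable_rV_coord. Qed.

Lemma integrable_coordM f i : measurable_fun setT f -> (forall x, 0 <= f x) ->
  (\int[mu]_x (`|x ord0 i| * f x)%:E < +oo)%E ->
  mu.-integrable setT (EFin \o (fun x : V => x ord0 i * f x)).
Proof.
move=> mf f0 h; apply/integrableP; split.
  by apply/measurable_EFinP; exact: measurable_coordM.
rewrite (eq_integral (fun x : V => (`|x ord0 i| * f x)%:E)) => [//|x _].
by rewrite /= normrM (ger0_norm (f0 x)).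
Qed.

Lemma centered_opp f : measurable_fun setT f -> centered f ->
  centered (fun x => f (- x)).
Proof.
move=> mf fc i; have [h1 h2] := fc i.
have mG : measurable_fun setT (fun x : V => (- (x ord0 i * f x))%:E).
  apply/measurable_EFinP; apply: measurable_funN; exact: measurable_coordM.
have oppE (x : V) : x ord0 i * f (- x) = - ((- x) ord0 i * f (- x)).
  by rewrite mxE mulNr opprK.
have -> : (fun x : V => x ord0 i * f (- x)) =
    (fun x => - ((- x) ord0 i * f (- x))) by apply/funext => x; exact: oppE.
have I : (\int[mu]_x (- (x ord0 i * f x))%:E = 0)%E.
  under eq_integral do rewrite EFinN.
  rewrite integralN; first by rewrite h2 oppe0.
  by apply: integrable_add_def.
split.
- apply/integrableP; split.
    by apply: (measurableT_comp mG); exact: measurable_opp_rV.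
  have /integrableP[_] := h1.
  rewrite -(integral_opp_rV (f := fun x => `|(x ord0 i * f x)%:E|%E))//.
    by under eq_integral do rewrite /= -normrN.
  by apply: measurableT_comp => //; apply/measurable_EFinP; exact: measurable_coordM.
- rewrite -[RHS]I.
  transitivity (\int[mu]_x (- ((- x)%R ord0 i * f (- x)%R))%:E)%E.
    by apply: eq_integral => x _; rewrite oppE.
  apply: (integral_comp_signed (T := fun x => - x)
    (F := fun x : V => (- (x ord0 i * f x))%:E) _ mG).
  by move=> g mg g0; exact: integral_opp_rV.
Qed.

Definition first_moment f : \bar R := (\int[mu]_x (enorm x * f x)%:E)%E.

Lemma measurable_enormM f : measurable_fun setT f ->
  measurable_fun setT (fun x => enorm x * f x).
Proof. by move=> mf; apply: measurable_funM => //; exact: measurable_enorm. Qed.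

Lemma enorm_le_sum x : enorm x <= \sum_(i < n) `|x ord0 i|.
Proof.
have S0 : 0 <= \sum_(i < n) `|x ord0 i| by exact: sumr_ge0.
rewrite -(ler_pXn2r (n := 2))// ?nnegrE ?enorm_ge0// sqr_enorm expr2 mulr_suml.
apply: ler_sum => i _; rewrite -[leLHS]real_normK ?num_real// expr2.
by rewrite ler_wpM2l// (bigD1 i)//= lerDl sumr_ge0.
Qed.

Lemma first_moment_fin f : measurable_fun setT f -> (forall x, 0 <= f x) ->
  centered f -> (first_moment f < +oo)%E.
Proof.
move=> mf f0 fc.
have mi i : measurable_fun setT (fun x : V => `|x ord0 i| * f x).
  apply: measurable_funM => //; apply: measurableT_comp => //.
  exact: measurable_rV_coord.
apply: (@le_lt_trans _ _ (\int[mu]_x (\sum_(i < n) (`|x ord0 i| * f x)%:E))%E).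
  apply: ge0_le_integral => //.
  - by move=> x _; rewrite lee_fin mulr_ge0// enorm_ge0.
  - by apply/measurable_EFinP; exact: measurable_enormM.
  - by apply: emeasurable_sum => i; exact/measurable_EFinP.
  - move=> x _; rewrite sumEFin lee_fin -mulr_suml ler_wpM2r//.
    exact: enorm_le_sum.
rewrite ge0_integral_sum//; last 2 first.
- by move=> i; exact/measurable_EFinP.
- by move=> i x _; rewrite lee_fin mulr_ge0.
apply: lte_sum_pinfty => i _; have [/integrableP[_] h _] := fc i.
rewrite (eq_integral (fun x : V => `|(x ord0 i * f x)%:E|%E)) => [//|x _].
by rewrite /= normrM (ger0_norm (f0 x)).
Qed.

Lemma first_moment_coord f i : measurable_fun setT f -> (forall x, 0 <= f x) ->
  (first_moment f < +oo)%E ->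
  mu.-integrable setT (EFin \o (fun x : V => x ord0 i * f x)).
Proof.
move=> mf f0 h; apply: integrable_coordM => //; apply: le_lt_trans h.
apply: nnint_le.
- apply: measurable_funM => //; apply: measurableT_comp => //.
  exact: measurable_rV_coord.
- exact: measurable_enormM.
- by move=> x; rewrite mulr_ge0.
- by move=> x; rewrite ler_wpM2r// coord_le_enorm.
Qed.

Lemma exists_centering f M : 0 < M -> measurable_fun setT f ->
  (forall x, 0 <= f x) -> (\int[mu]_x (f x)%:E = M%:E)%E ->
  (first_moment f < +oo)%E -> exists a : V, centered (fun x => f (x + a)).
Proof.
move=> M0 mf f0 fM fm.
have fi i := first_moment_coord i mf f0 fm.
(* The center of mass of [f]. *)
pose a : V := \row_i (M^-1 * fine (\int[mu]_x (x ord0 i * f x)%:E)%E).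
have f1 : mu.-integrable setT (EFin \o f).
  apply/integrableP; split; first exact/measurable_EFinP.
  rewrite (eq_integral (fun x : V => (f x)%:E)) ?fM ?ltry// => x _.
  by rewrite /= ger0_norm.
exists a => i.
have h : mu.-integrable setT (EFin \o (fun x : V => a ord0 i * f x)).
  rewrite (_ : _ \o _ = fun x => ((a ord0 i)%:E * (EFin \o f) x)%E)//.
  exact: integrableZl.
have mG : measurable_fun setT (fun x : V => (x ord0 i * f x - a ord0 i * f x)%:E).
  apply/measurable_EFinP; apply: measurable_funB; first exact: measurable_coordM.
  exact: measurable_funM.
have addE (x : V) : x ord0 i * f (x + a) =
    (x + a) ord0 i * f (x + a) - a ord0 i * f (x + a).
  by rewrite -mulrBl mxE addrK.
have -> : (fun x : V => x ord0 i * f (x + a)) =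
    (fun x : V => (x + a) ord0 i * f (x + a) - a ord0 i * f (x + a)).
  by apply/funext => x; exact: addE.
have G : mu.-integrable setT
    (EFin \o (fun x : V => x ord0 i * f x - a ord0 i * f x)).
  exact: (integrableB measurableT (fi i) h).
split.
- apply/integrableP; split.
    exact: (measurableT_comp mG (measurable_translate a)).
  have /integrableP[_] := G.
  rewrite -(integral_translate_rV a
    (f := fun x : V => `|(x ord0 i * f x - a ord0 i * f x)%:E|%E))//.
  exact: measurableT_comp.
- transitivity (\int[mu]_x (x ord0 i * f x - a ord0 i * f x)%:E)%E.
    transitivity (\int[mu]_x ((x + a)%R ord0 i * f (x + a)%R -
        a ord0 i * f (x + a)%R)%:E)%E.
      by apply: eq_integral => x _; rewrite addE.
    apply: (integral_comp_signed (T := fun x => x + a)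
      (F := fun x : V => (x ord0 i * f x - a ord0 i * f x)%:E) _ mG).
    by move=> g mg g0; exact: integral_translate_rV.
  rewrite integralB_EFin//.
  rewrite [X in (_ - X)%E](_ : _ = ((a ord0 i)%:E * \int[mu]_x (f x)%:E)%E); last first.
    rewrite -(integralZl measurableT f1).
    by apply: eq_integral => x _.
  rewrite fM mxE -EFinM mulrAC mulVf ?gt_eqF// mul1r fineK ?subee//.
  + exact: integrable_fin_num (fi i).
  + exact: integrable_fin_num (fi i).
Qed.

End densities.

Section polarization_moment.
Context {R : realType} {n : nat}.
Local Notation mu := (lebesgue_rV R n).
Local Notation V := ('rV[R]_n).
Variable v : V.
Hypothesis v0 : v != 0.
Implicit Types (f : V -> R) (x y : V).

(** Polarization moves the mass [polarize v f x - f x] from [refl v x] to [x]; the product is the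
    first moment saved on this pair of mirror points. *)
Definition polarize_gain f x : R :=
  (enorm (refl v x) - enorm x) * (polarize v f x - f x).

Lemma polarize_gain_ge0 f x : 0 <= polarize_gain f x.
Proof.
rewrite /polarize_gain /polarize; case: ifPn => h.
  apply: mulr_ge0; last by rewrite subr_ge0 le_max lexx.
  by rewrite subr_ge0 ler_enorm sqnorm_refl// lerDl mulr_ge0// subr_ge0.
apply: mulr_le0; last by rewrite subr_le0 ge_min lexx.
rewrite subr_le0 ler_enorm sqnorm_refl// gerDl mulr_ge0_le0// subr_le0.
by rewrite ltW// ltNge.
Qed.

Lemma measurable_polarize_gain f : measurable_fun setT f ->
  measurable_fun setT (polarize_gain f).
Proof.
move=> mf; apply: measurable_funM; apply: measurable_funB => //.
- exact: (measurableT_comp (@measurable_enorm R n) (measurable_refl v)).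
- exact: measurable_enorm.
- exact: measurable_polarize.
Qed.

Lemma first_moment_polarize f : measurable_fun setT f -> (forall x, 0 <= f x) ->
  (first_moment f = first_moment (polarize v f) +
    \int[mu]_x (2^-1 * polarize_gain f x)%:E)%E.
Proof.
move=> mf f0.
have p0 := polarize_ge0 v f0; have mp := measurable_polarize v mf.
have mg := measurable_polarize_gain mf.
have h2 : 0 <= 2^-1 :> R by rewrite invr_ge0.
rewrite /first_moment (symmetrize_refl v0 (measurable_enormM mf)); last first.
  by move=> x; rewrite mulr_ge0 ?enorm_ge0.
rewrite (symmetrize_refl v0 (measurable_enormM mp)); last first.
  by move=> x; rewrite mulr_ge0 ?enorm_ge0.
rewrite -nnintD.
- apply: eq_integral => x _; congr EFin; rewrite -mulrDr; congr (_ * _).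
  rewrite /polarize_gain polarize_refl// /polarize.
  case: ifP => _; case: (leP (f x) (f (refl v x))) => _; ring.
- apply: measurable_funM => //; apply: measurable_funD; first exact: measurable_enormM.
  exact: (measurableT_comp (measurable_enormM mp) (measurable_refl v)).
- exact: measurable_funM.
- by move=> x; rewrite mulr_ge0// addr_ge0// mulr_ge0 ?enorm_ge0.
- by move=> x; rewrite mulr_ge0// polarize_gain_ge0.
Qed.

End polarization_moment.

(** * Symmetry of the minimizers *)

Section minimizers.
Context {R : realType} {n : nat}.
Hypothesis n0 : (0 < n)%N.
Local Notation mu := (lebesgue_rV R n).
Local Notation V := ('rV[R]_n).
Variables (m chi beta M s : R) (rho : V -> R).
Hypotheses (m0 : 0 < m) (chi0 : 0 < chi) (M0 : 0 < M) (sn : 2 * s < n%:R).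
Hypothesis rho_min :
  ae_unique (minimizer (free_energy m chi beta s) (density m M)) rho.

Let rhoD : density m M rho. Proof. by have [[]] := rho_min. Qed.

Let competitor_eq eta : density m M eta ->
  (free_energy m chi beta s eta <= free_energy m chi beta s rho)%E ->
  eta = rho %[ae mu].
Proof.
have [[_ rmin] runiq] := rho_min.
move=> etaD etaF; apply: runiq; split; first exact: etaD.
move=> zeta zD; exact: le_trans etaF (rmin _ zD).
Qed.

Let mpow : measurable_fun setT (fun t : R => t `^ m).
Proof. exact: measurable_powR. Qed.

Lemma minimizer_even : (fun x => rho (- x)) = rho %[ae mu].
Proof.
have [mf f0 fM fm fc] := (densityP M rho m0).1 rhoD.
have io (g : V -> \bar R) : measurable_fun setT g -> (forall x, 0 <= g x)%E ->
    (\int[mu]_x g (- x)%R = \int[mu]_x g x)%E by exact: integral_opp_rV.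
have mo := @measurable_opp_rV R n.
apply: competitor_eq.
  apply/(densityP _ _ m0); split.
  - exact: (measurableT_comp mf mo).
  - by move=> x; exact: f0.
  - by rewrite (nnint_comp io mf f0).
  - rewrite (nnint_comp io (f := fun x => rho x `^ m)) //.
    + exact: (measurableT_comp mpow mf).
    + by move=> x; exact: powR_ge0.
  - exact: centered_opp.
have h := free_energy_comp io (@enorm_opp R n) m chi beta s mf f0.
by rewrite -h; exact: lexx.
Qed.

Lemma free_energy_polarize v : v != 0 ->
  (free_energy m chi beta s (polarize v rho) <= free_energy m chi beta s rho)%E.
Proof.
move=> v0; have [mf f0 fM fm fc] := (densityP M rho m0).1 rhoD.
rewrite /free_energy.
rewrite (integral_polarize v0 mf f0 mpow (fun t _ => powR_ge0 _ _)).
rewrite (integral_polarize (phi := fun t => t ^+ 2) v0 mf f0); last 2 first.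
- exact: exprn_measurable.
- by move=> t _; exact: sqr_ge0.
apply: leeD2l; rewrite leeN2; apply: lee_wpmul2l.
  by rewrite lee_fin divr_ge0 ?(ltW chi0).
exact: interaction_polarize.
Qed.

(* The polarized minimizer is a translate of the minimizer [rho]; as [rho] is
   even and the norm is convex, translating [rho] does not decrease its first
   moment, whereas polarizing strictly decreases it unless nothing moves. *)
Lemma minimizer_polarize v : v != 0 ->
  {ae mu, forall x, dot x v < sqnorm v -> rho (refl v x) <= rho x}.
Proof.
move=> v0; have [mf f0 fM fm fc] := (densityP M rho m0).1 rhoD.
have p0 := polarize_ge0 v f0; have mp := measurable_polarize v mf.
have momf := first_moment_fin mf f0 fc.
have mg := measurable_polarize_gain v mf.
have momE := first_moment_polarize v0 mf f0.
have g0 : (0 <= \int[mu]_x (2^-1 * polarize_gain v rho x)%:E)%E.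
  by apply: nnint_ge0 => x; rewrite mulr_ge0 ?polarize_gain_ge0.
have momp : (first_moment (polarize v rho) < +oo)%E.
  by apply: le_lt_trans momf; rewrite momE leeDl.
have pM : (\int[mu]_x (polarize v rho x)%:E = M%:E)%E.
  by rewrite (integral_polarize (phi := id) v0 mf f0).
have [a ca] := exists_centering M0 mp p0 pM momp.
have it (b : V) (g : V -> \bar R) : measurable_fun setT g -> (forall x, 0 <= g x)%E ->
    (\int[mu]_x g (x + b)%R = \int[mu]_x g x)%E by exact: integral_translate_rV.
have mt (b : V) := @measurable_translate R n b.
have etaE : (fun x => polarize v rho (x + a)) = rho %[ae mu].
  apply: competitor_eq.
    apply/(densityP _ _ m0); split.
    - exact: (measurableT_comp mp (mt a)).
    - by move=> x; exact: p0.
    - by rewrite (nnint_comp (it a) mp p0).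
    - rewrite (nnint_comp (it a) (f := fun x => polarize v rho x `^ m)).
      + rewrite (integral_polarize v0 mf f0 mpow)// => t _; exact: powR_ge0.
      + exact: (measurableT_comp mpow mp).
      + by move=> x; exact: powR_ge0.
    - exact: ca.
  have h := free_energy_comp (it a) (enorm_translate a) m chi beta s mp p0.
  apply: le_trans (free_energy_polarize v0); rewrite -h; exact: lexx.
have mE (b : V) : measurable_fun setT (fun x : V => enorm (x + b)).
  exact: (measurableT_comp (@measurable_enorm R n) (mt b)).
(* Undoing the translation turns the first moment of the polarized density into that of [rho] about
   the point [- a]. *)
have pmom : first_moment (polarize v rho) =
    (\int[mu]_x (enorm (x + a)%R * rho x)%:E)%E.
  rewrite /first_moment -(nnint_comp (it a) (measurable_enormM mp)); last first.
    by move=> x; rewrite mulr_ge0 ?enorm_ge0.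
  apply: nnint_ae_eq.
  - by apply: measurable_funM => //; exact: (measurableT_comp mp (mt a)).
  - exact: measurable_funM.
  - by move=> x; rewrite mulr_ge0 ?enorm_ge0.
  - by move=> x; rewrite mulr_ge0 ?enorm_ge0.
  - by apply: filterS etaE => x /= + xT => /(_ xT) ->.
have evenE : (\int[mu]_x (enorm (x - a)%R * rho x)%:E =
    \int[mu]_x (enorm (x + a)%R * rho x)%:E)%E.
  have io (g : V -> \bar R) : measurable_fun setT g -> (forall x, 0 <= g x)%E ->
    (\int[mu]_x g (- x)%R = \int[mu]_x g x)%E by exact: integral_opp_rV.
  rewrite -(nnint_comp io (f := fun x => enorm (x - a) * rho x)); last 2 first.
  - exact: measurable_funM.
  - by move=> x; rewrite mulr_ge0 ?enorm_ge0.
  apply: nnint_ae_eq.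
  - apply: measurable_funM; last exact: (measurableT_comp mf (@measurable_opp_rV R n)).
    exact: (measurableT_comp (mE (- a)) (@measurable_opp_rV R n)).
  - exact: measurable_funM.
  - by move=> x; rewrite mulr_ge0 ?enorm_ge0.
  - by move=> x; rewrite mulr_ge0 ?enorm_ge0.
  - apply: filterS minimizer_even => x /= + xT => /(_ xT) ->.
    by rewrite -enormN opprB opprK addrC.
have mom_le : (first_moment rho <= first_moment (polarize v rho))%E.
  rewrite pmom (_ : (\int[mu]_x (enorm (x + a)%R * rho x)%:E =
    \int[mu]_x (2^-1 * (enorm (x - a)%R * rho x + enorm (x + a)%R * rho x))%:E)%E).
    apply: nnint_le.
    - exact: measurable_enormM.
    - apply: measurable_funM => //.
      by apply: measurable_funD; exact: measurable_funM.
    - by move=> x; rewrite mulr_ge0 ?enorm_ge0.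
    - move=> x; rewrite -mulrDl mulrA ler_wpM2r//.
      have := ler_enormD (x - a) (x + a); rewrite addrACA addNr addr0.
      rewrite -mulr2n -scaler_nat enormZ ger0_norm// => h.
      by rewrite mulrC ler_pdivlMr// mulrC.
  rewrite nnintZ//; last 2 first.
  - by apply: measurable_funD; exact: measurable_funM.
  - by move=> x; rewrite addr_ge0 ?mulr_ge0 ?enorm_ge0.
  rewrite nnintD; last 4 first.
  - exact: measurable_funM.
  - exact: measurable_funM.
  - by move=> x; rewrite mulr_ge0 ?enorm_ge0.
  - by move=> x; rewrite mulr_ge0 ?enorm_ge0.
  have Ige0 : (0 <= \int[mu]_x (enorm (x + a)%R * rho x)%:E)%E.
    by apply: nnint_ge0 => x; rewrite mulr_ge0 ?enorm_ge0.
  rewrite evenE ge0_muleDr// -ge0_muleDl ?lee_fin//.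
  by rewrite -EFinD (_ : 2^-1 + 2^-1 = 1 :> R) ?mul1e//; field.
have gain0 : (\int[mu]_x (2^-1 * polarize_gain v rho x)%:E = 0)%E.
  apply/eqP; rewrite eq_le g0 andbT.
  have pfin : first_moment (polarize v rho) \is a fin_num.
    rewrite ge0_fin_numE//; apply: nnint_ge0 => x.
    by rewrite mulr_ge0 ?enorm_ge0.
  by move: mom_le; rewrite momE -{2}[first_moment (polarize v rho)]adde0 leeD2lE.
have h2 : 0 <= 2^-1 :> R by rewrite invr_ge0.
have mg2 : measurable_fun setT (fun x => 2^-1 * polarize_gain v rho x).
  exact: measurable_funM.
have /(nnint_eq0 mg2) := gain0.
move=> /(_ (fun x => mulr_ge0 h2 (polarize_gain_ge0 v0 _ x))).
apply: filterS => x /= /(_ I) h xv.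
have {}h : polarize_gain v rho x = 0.
  by move/eqP : h; rewrite mulf_eq0 invr_eq0 pnatr_eq0 /= => /eqP.
move/eqP : h; rewrite /polarize_gain mulf_eq0 => /orP[|].
  rewrite subr_eq0 gt_eqF// ltr_enorm sqnorm_refl// ltrDl mulr_gt0//.
  by rewrite subr_gt0.
rewrite subr_eq0 /polarize (ltW xv) => /eqP <-.
by rewrite le_max lexx orbT.
Qed.

End minimizers.

(** * Separating level sets by reflections *)

Section separation.
Context {R : realType}.
Local Notation leb := (@lebesgue_measure R).

(** For a fixed direction [e], the displacement from [x] to its image is a multiple of [e] that
    depends affinely on the offset [h]: integrating over parallel mirrors amounts to integrating
    over displacements along [e]. *)
Lemma reflZ n (h : R) (e x : 'rV[R]_n) : h != 0 -> e != 0 ->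
  refl (h *: e) x = x + (2 * h + - (2 * dot x e / sqnorm e)) *: e.
Proof.
move=> h0 e0; have q0 : sqnorm e != 0 by rewrite sqnorm_eq0.
rewrite /refl /householder dotC dotZl (dotC e) sqnormZ.
by apply/rowP => i; rewrite !mxE; field; rewrite q0 h0.
Qed.

Lemma scale_rV_cons k (t : R) (u : 'rV[R]_k) :
  rV_cons (t, t *: u) = t *: rV_cons (1, u).
Proof.
have := rV_cons_affine t 1 0 u 0.
rewrite mulr1 !addr0 => ->; rewrite -[RHS]addr0; congr (_ + _).
apply/rowP => i; rewrite [RHS]mxE; case: (unliftP ord0 i) => [j ->|->].
  by rewrite rV_consS mxE.
by rewrite rV_cons0.
Qed.

Section pairs.
Context {n : nat}.
Local Notation mu := (lebesgue_rV R n).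
Local Notation V := ('rV[R]_n).
Variables (f : V -> R) (P Q : set V).
Hypotheses (mP : measurable P) (mQ : measurable Q).
Hypothesis fpol : forall v : V, v != 0 ->
  {ae mu, forall x, dot x v < sqnorm v -> f (refl v x) <= f x}.
Hypothesis PQf : forall x y, Q x -> P y -> f x < f y.
Hypothesis PQnorm : forall x y, Q x -> P y -> enorm x < enorm y.

Let F (w x : V) : R := \1_Q x * \1_P (x + w).

Let F0 w x : 0 <= F w x. Proof. by rewrite mulr_ge0. Qed.

Let mIQ : measurable_fun setT (\1_Q : V -> R).
Proof. exact: measurable_indic. Qed.

Let mIP : measurable_fun setT (\1_P : V -> R).
Proof. exact: measurable_indic. Qed.

Let mF : measurable_fun setT (fun z : V * V => F z.1 z.2).
Proof.
apply: measurable_funM; first exact: (measurableT_comp mIQ measurable_snd).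
apply: (measurableT_comp mIP).
by apply: measurable_rVD; [exact: measurable_snd|exact: measurable_fst].
Qed.

(** The cross-correlation of the indicators of [Q] and [P], a density for the displacements from [Q]
    to [P]. *)
Definition pair_count (w : V) : \bar R := (\int[mu]_x (F w x)%:E)%E.

Lemma pair_count_ge0 w : (0 <= pair_count w)%E.
Proof. exact: nnint_ge0. Qed.

Lemma measurable_pair_count : measurable_fun setT pair_count.
Proof. exact: (dint_measurable mu mF F0). Qed.

(** A point of [Q] whose image lies in [P] is on the origin's side, because [P] is farther out; the
    inequality [fpol] then contradicts [PQf] outside a null set. *)
Let refl_null (h : R) (e : V) : e != 0 ->
  (\int[mu]_x (F ((2 * h + - (2 * dot x e / sqnorm e)) *: e) x)%:E = 0)%E.
Proof.
move=> e0; have q0 : sqnorm e != 0 by rewrite sqnorm_eq0.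
(* The mirror through the origin has no foot vector for [fpol], but it preserves norms, so [PQnorm]
   suffices. *)
have [->|h0] := eqVneq h 0.
  apply: integral0_eq => x _; congr EFin; rewrite /F !indicE.
  have [xQ|xQ] := boolP (x \in Q); last by rewrite mul0r.
  rewrite memNset ?mulr0// => xP; rewrite inE in xQ.
  have := PQnorm xQ xP; rewrite ?mulr0 sub0r scaleNr.
  by rewrite ltr_enorm -[x - _]/(householder e x) sqnorm_householder// ltxx.
have v0 : h *: e != 0 by rewrite scaler_eq0 negb_or h0.
have mG : measurable_fun setT (fun x : V => \1_Q x * \1_P (refl (h *: e) x) : R).
  apply: measurable_funM => //.
  exact: (measurableT_comp mIP (measurable_refl _)).
transitivity (\int[mu]_x (\1_Q x * \1_P (refl (h *: e) x))%:E)%E.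
  by apply: eq_integral => x _; rewrite /F reflZ.
transitivity (\int[mu]_x (cst (0 : R) x)%:E)%E; last exact: integral0_eq.
apply: nnint_ae_eq => //.
- apply: filterS (fpol v0) => x /= xv _; rewrite !indicE.
  have [xQ|xQ] := boolP (x \in Q); last by rewrite mul0r.
  rewrite memNset ?mulr0// => xP; rewrite inE in xQ.
  have h1 := PQnorm xQ xP; have h2 := PQf xQ xP.
  move: h2; rewrite ltNge xv//.
  by move: h1; rewrite ltr_enorm sqnorm_refl// ltrDl pmulr_rgt0// subr_gt0.
Qed.

(** For fixed [x], the substitution [t = 2 * h - 2 * dot x e / sqnorm e] replaces the displacement
    [t *: e] by the one due to a reflection; after exchanging the integrals each [h] contributes [0]
    by [refl_null]. *)
Lemma pair_count_line (e : V) : e != 0 ->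
  (\int[leb]_t pair_count (t *: e) = 0)%E.
Proof.
move=> e0.
pose G (t : measurableTypeR R) (x : V) := F (t *: e) x.
pose H (h : measurableTypeR R) (x : V) :=
  F ((2 * h + - (2 * dot x e / sqnorm e)) *: e) x.
have comp (a : measurableTypeR R * V -> V) : measurable_fun setT a ->
    measurable_fun setT (fun z => F (a z) z.2).
  move=> ma; have mab : measurable_fun setT (fun z => (a z, z.2)).
    by apply/measurable_fun_pair => //; exact: measurable_snd.
  exact: (measurableT_comp mF mab).
have mfst1 : measurable_fun setT (fun z : measurableTypeR R * V => z.1).
  exact: measurable_fst.
have msnd1 : measurable_fun setT (fun z : measurableTypeR R * V => z.2).
  exact: measurable_snd.
have mG : measurable_fun setT (fun z => G z.1 z.2).
  by apply: comp; apply: measurable_rVZ.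
have mH : measurable_fun setT (fun z => H z.1 z.2).
  apply: comp; apply: measurable_rVZ => //; apply: measurable_funD.
    exact: measurable_funM.
  apply: measurable_funN; apply: measurable_funM => //; apply: measurable_funM => //.
  exact: measurable_dot.
have G0 t x : 0 <= G t x by exact: F0.
have H0 t x : 0 <= H t x by exact: F0.
apply: (etrans (dint_swap leb mu mG G0)).
transitivity (\int[mu]_x (2%:E * \int[leb]_h (H h x)%:E))%E.
  apply: eq_integral => x _.
  have mGx : measurable_fun setT (fun t : R => (G t x)%:E).
    apply/measurable_EFinP; exact: (measurableT_comp mG (pair2_measurable x)).
  have two0 : (2 : R) != 0 by rewrite pnatr_eq0.
  rewrite (integral_affine (- (2 * dot x e / sqnorm e)) two0 mGx); last first.
    by move=> t; rewrite lee_fin.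
  by rewrite ger0_norm.
have mHs : measurable_fun setT (fun z : V * measurableTypeR R => H z.2 z.1).
  have msw : measurable_fun setT (fun z : V * measurableTypeR R => (z.2, z.1)).
    by apply/measurable_fun_pair; [exact: measurable_snd|exact: measurable_fst].
  exact: (measurableT_comp mH msw).
rewrite ge0_integralZl_EFin//; last 2 first.
- by move=> x _; apply: nnint_ge0 => h; exact: H0.
- exact: (dint_measurable leb (F := fun x h => H h x) mHs (fun x h => H0 h x)).
rewrite -(dint_swap leb mu mH H0) integral0_eq ?mule0// => h _.
exact: refl_null.
Qed.

Lemma integral_pair_count :
  (\int[mu]_w pair_count w = mu Q * mu P)%E.
Proof.
apply: (etrans (dint_swap mu mu mF F0)).
transitivity (\int[mu]_x ((\1_Q x)%:E * mu P))%E.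
  apply: eq_integral => x _; rewrite nnintZ//; last first.
    by apply: (measurableT_comp mIP); apply: measurable_rVD.
  congr (_ * _)%E.
  transitivity (\int[mu]_w (\1_P (w + x)%R)%:E)%E.
    by apply: eq_integral => w _; rewrite addrC.
  rewrite (integral_translate_rV x (f := fun w => (\1_P w)%:E)); last 2 first.
  - exact/measurable_EFinP.
  - by move=> w; rewrite lee_fin.
  by rewrite integral_indic ?setIT.
rewrite ge0_integralZr//; last first.
  exact/measurable_EFinP.
by rewrite integral_indic ?setIT.
Qed.

End pairs.

(* Polar coordinates on the half-lines through the points [(1, u)]: a function
   whose integral along every line through the origin vanishes has vanishing
   integral. *)
Lemma integral_lines_eq0 k (N : 'rV[R]_k.+1 -> \bar R) : measurable_fun setT N ->
  (forall w, 0 <= N w)%E ->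
  (forall e : 'rV[R]_k.+1, e != 0 -> (\int[leb]_t N (t *: e)%R = 0)%E) ->
  (\int[lebesgue_rV R k.+1]_w N w = 0)%E.
Proof.
move=> mN N0 Nl; rewrite integral_lebesgue_rVS//.
pose G (t : measurableTypeR R) (u : 'rV[R]_k) : \bar R :=
  ((`|t| ^+ k)%:E * N (t *: rV_cons (1, u))%R)%E.
have mcons : measurable_fun setT (fun z : measurableTypeR R * 'rV[R]_k =>
    N (z.1 *: rV_cons (1 : R, z.2))).
  apply: (measurableT_comp mN); apply: measurable_rVZ; first exact: measurable_fst.
  apply: (measurableT_comp (@measurable_rV_cons _ (measurableTypeR R) k)).
  by apply/measurable_fun_pair => //; exact: measurable_snd.
have mG : measurable_fun setT (fun z => G z.1 z.2).
  apply: emeasurable_funM => //; apply/measurable_EFinP; apply: measurable_funX.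
  apply: measurableT_comp => //; exact: measurable_fst.
have G0 t u : (0 <= G t u)%E by rewrite mule_ge0 ?lee_fin ?exprn_ge0.
have mNc : measurable_fun setT (fun z : measurableTypeR R * 'rV[R]_k =>
    N (rV_cons z)).
  exact: (measurableT_comp mN (@measurable_rV_cons _ (measurableTypeR R) k)).
(* For [t != 0] the tail is rescaled by [t], with Jacobian [|t|^k], which puts the point on the line
   through [(1, u)]; the value [t = 0] is negligible. *)
transitivity (\int[leb]_t \int[lebesgue_rV R k]_u G t u)%E.
  apply: ge0_ae_eq_integral => //.
  - by apply: (measurable_integral_tonelli _ (fun t u => N (rV_cons (t, u)))).
  - exact: measurable_integral_tonelli.
  - by move=> t _; exact: integral_ge0.
  - by move=> t _; exact: integral_ge0.
  exists [set 0]; split => //; first exact: lebesgue_measure_set1.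
  move=> t /= H; apply: contrapT => t0; apply: H => _.
  have {}t0 : t != 0 by apply/eqP.
  have mNt : measurable_fun setT (fun u : 'rV[R]_k => N (rV_cons (t, u))).
    exact: (measurableT_comp mNc (pair1_measurable _)).
  rewrite (integral_affine_rV 0 t0 mNt)// -ge0_integralZl_EFin ?exprn_ge0//.
  - by apply: eq_integral => u _; rewrite addr0 scale_rV_cons.
  - rewrite [X in measurable_fun _ X](_ : _ =
        fun u : 'rV[R]_k => N (t *: rV_cons (1 : R, u))).
      exact: (measurableT_comp mcons (pair1_measurable _)).
    by apply/funext => u; rewrite addr0 scale_rV_cons.
rewrite (tonelli G)//; apply: integral0_eq => u _.
have u0 : rV_cons (1 : R, u) != 0.
  apply/eqP => /(congr1 (fun x : 'rV[R]_k.+1 => x ord0 ord0)).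
  by rewrite rV_cons0 mxE => /eqP; rewrite oner_eq0.
have mNu : measurable_fun setT (fun t : R => N (t *: rV_cons (1 : R, u))).
  exact: (measurableT_comp mcons (pair2_measurable u)).
have /(ae_eq_integral_abs leb measurableT mNu) ae0 :
    (\int[leb]_t `|N (t *: rV_cons (1 : R, u))%R| = 0)%E.
  rewrite -[RHS](Nl _ u0); apply: eq_integral => t _.
  by rewrite gee0_abs.
transitivity (\int[leb]_t cst (0 : \bar R) t)%E; last exact: integral0_eq.
apply: ge0_ae_eq_integral => //.
- exact: (measurableT_comp mG (pair2_measurable u)).
- by apply: filterS ae0 => t /= + tT => /(_ tT) tN; rewrite /G tN mule0.
Qed.

(** The measure of the product set is the integral of [pair_count] over all displacements, and every
    displacement lies on a line through the origin. *)
Lemma polarized_separation n (f : 'rV[R]_n -> R) (P Q : set 'rV[R]_n) :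
  (0 < n)%N -> measurable P -> measurable Q ->
  (forall v : 'rV[R]_n, v != 0 -> {ae lebesgue_rV R n, forall x,
     dot x v < sqnorm v -> f (refl v x) <= f x}) ->
  (forall x y, Q x -> P y -> f x < f y) ->
  (forall x y, Q x -> P y -> enorm x < enorm y) ->
  (lebesgue_rV R n Q * lebesgue_rV R n P = 0)%E.
Proof.
case: n f P Q => // k f P Q _ mP mQ fpol PQf PQnorm.
rewrite -(integral_pair_count mP mQ); apply: integral_lines_eq0.
- exact: measurable_pair_count.
- by move=> w; exact: pair_count_ge0.
- by move=> e e0; exact: (pair_count_line mP mQ fpol PQf PQnorm e0).
Qed.

End separation.

(** * Elementary estimates *)

Section powers.
Context {R : realType}.
Implicit Types (a b h m p x y : R).

(** The tangent line of a convex power at [y], read off Young's inequality with conjugate exponents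
    [p] and [p / (p - 1)]. *)
Lemma powR_tangent p x y : 1 < p -> 0 <= x -> 0 <= y ->
  p * (x * y `^ (p - 1)) <= x `^ p + (p - 1) * y `^ p.
Proof.
move=> p1 x0 y0; have p0 : 0 < p by exact: lt_trans p1.
have pm : 0 < p - 1 by rewrite subr_gt0.
have q0 : 0 < p / (p - 1) by rewrite divr_gt0.
have pq : p^-1 + (p / (p - 1))^-1 = 1 by field; rewrite !gt_eqF.
have := conjugate_powR x0 (powR_ge0 y (p - 1)) p0 q0 pq.
rewrite -powRrM mulrCA divff ?gt_eqF// mulr1.
move: (x * _) (x `^ p) (y `^ p) => u v w h.
have : p * u <= p * (v / p + w / (p / (p - 1))) by rewrite ler_pM2l.
by congr (_ <= _); field; rewrite !gt_eqF.
Qed.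

Lemma powRB2 m x : 2 < m -> 0 <= x -> x `^ m = x `^ (m - 2) * x ^+ 2.
Proof.
move=> m2 x0; rewrite -powR_mulrn// -powRD ?subrK// gt_eqF//.
by rewrite (lt_trans _ m2).
Qed.

Lemma powRB1 m x : 2 < m -> 0 <= x -> x `^ (m - 1) = x `^ (m - 2) * x.
Proof.
move=> m2 x0; rewrite -[X in _ * X](powRr1 x0) -powRD.
  by congr powR; lra.
by apply/implyP => /eqP; lra.
Qed.

Lemma sqr_le_powR m x : 2 < m -> 0 <= x -> x ^+ 2 <= x + x `^ m.
Proof.
move=> m2 x0; have [x1|x1] := leP x 1.
  by rewrite -[leLHS]addr0 lerD ?powR_ge0// expr2 ler_piMr.
rewrite -[leLHS]add0r lerD// powRB2// ler_peMl ?sqr_ge0//.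
have : x `^ 0 <= x `^ (m - 2) by apply: ler_powR; rewrite ?subr_ge0; exact: ltW.
by rewrite powRr0.
Qed.

Lemma powRB_ge_sqr m h x : 2 < m -> 0 <= h -> h <= x ->
  h `^ (m - 2) * (x ^+ 2 - h ^+ 2) <= x `^ m - h `^ m.
Proof.
move=> m2 h0 hx; have x0 := le_trans h0 hx.
rewrite mulrBr (powRB2 m2 x0) (powRB2 m2 h0) lerD2r ler_wpM2r ?sqr_ge0//.
by apply: ge0_ler_powR; rewrite ?nnegrE// subr_ge0 ltW.
Qed.

(** The tangent inequality at [a + b]. The increment is linear in [b] with a factor controlled by
    [h]: adding mass at small height costs little. *)
Lemma powRD_le m a b h : 2 < m -> 0 <= a -> 0 <= b -> a + b <= h ->
  (a + b) `^ m <= a `^ m + m * h `^ (m - 2) * (b * (a + b)).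
Proof.
move=> m2 a0 b0 abh; have ab0 : 0 <= a + b by exact: addr_ge0.
have m1 : 1 < m by rewrite (lt_trans _ m2)// ltr1n.
have m0 : 0 < m by exact: lt_trans m1.
have := powR_tangent m1 a0 ab0; rewrite (powRB1 m2 ab0) => tg.
have E : (a + b) `^ m = (a + b) `^ (m - 2) * (a + b) * (a + b).
  by rewrite (powRB2 m2 ab0) expr2 mulrA.
have : (a + b) `^ (m - 2) * (b * (a + b)) <= h `^ (m - 2) * (b * (a + b)).
  rewrite ler_wpM2r ?mulr_ge0//; apply: ge0_ler_powR; rewrite ?nnegrE//.
  - by rewrite subr_ge0 ltW.
  - exact: le_trans abh.
rewrite -(ler_pM2l m0); move: tg; rewrite E.
move: (a `^ m) ((a + b) `^ (m - 2)) (h `^ (m - 2)) => u v w tg le1.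
have -> : v * (a + b) * (a + b) =
  m * (a * (v * (a + b))) - (m - 1) * (v * (a + b) * (a + b)) + m * (v * (b * (a + b))) by ring.
have := lerD tg le1; lra.
Qed.

End powers.

Section balls_volume.
Context {R : realType} {n : nat}.
Hypothesis n0 : (0 < n)%N.
Local Notation mu := (lebesgue_rV R n).
Local Notation V := ('rV[R]_n).

Lemma integral_indic_eball r :
  (\int[mu]_x (\1_(eball r) x : R)%:E = (fine (mu (eball r)))%:E)%E.
Proof.
rewrite fineK ?lebesgue_eball_fin_num// integral_indic ?setIT//.
exact: measurable_eball.
Qed.

Definition unit_ball_volume : R := fine (mu (eball 1)).

Lemma unit_ball_volume_gt0 : 0 < unit_ball_volume.
Proof.
by rewrite -lte_fin /unit_ball_volume fineK ?lebesgue_eball1_gt0 ?lebesgue_eball_fin_num.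
Qed.

Lemma lebesgue_eball r : 0 < r -> mu (eball r) = (r ^+ n * unit_ball_volume)%:E.
Proof.
move=> r0; have rn0 : r != 0 by rewrite gt_eqF.
have mB : measurable_fun setT (fun x : V => (\1_(eball r) x : R)%:E).
  by apply/measurable_EFinP; apply: measurable_indic; exact: measurable_eball.
transitivity (\int[mu]_x (\1_(eball r) x)%:E)%E.
  by rewrite integral_indic ?setIT//; exact: measurable_eball.
rewrite (integral_affine_rV 0 rn0 mB); last by move=> x; rewrite lee_fin.
rewrite ger0_norm ?(ltW r0)// EFinM /unit_ball_volume fineK ?lebesgue_eball_fin_num//.
congr (_ * _)%E; transitivity (\int[mu]_x (\1_(eball 1) x)%:E)%E; last first.
  by rewrite integral_indic ?setIT//; exact: measurable_eball.
apply: eq_integral => x _; rewrite !indicE; congr ((nat_of_bool _)%:R%:E).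
by apply/idP/idP; rewrite !inE /eball/= addr0 enormZ ger0_norm ?(ltW r0)// ger_pMr.
Qed.

Lemma exists_eball_volume (a : R) : 0 < a -> exists2 r, 0 < r & mu (eball r) = a%:E.
Proof.
move=> a0; pose r := (a / unit_ball_volume) `^ (n%:R^-1).
have au : 0 < a / unit_ball_volume by rewrite divr_gt0 ?unit_ball_volume_gt0.
have r0 : 0 < r by exact: powR_gt0.
exists r => //; rewrite lebesgue_eball// -powR_mulrn ?(ltW r0)// -powRrM.
rewrite mulVf ?pnatr_eq0 -?lt0n// powRr1 ?(ltW au)// divfK//.
by rewrite gt_eqF// unit_ball_volume_gt0.
Qed.

(** By the substitution of [- x] for [x] the first moments equal their opposites, and they are
    finite. *)
Lemma even_centered (f : V -> R) : measurable_fun setT f -> (forall x, 0 <= f x) ->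
  (first_moment f < +oo)%E -> (fun x => f (- x)) = f %[ae mu] -> centered f.
Proof.
move=> mf f0 fm fe i; have fi := first_moment_coord i mf f0 fm.
have mo := @measurable_opp_rV R n.
have mG : measurable_fun setT (fun x : V => (x ord0 i * f x)%:E).
  by apply/measurable_EFinP; exact: measurable_coordM.
split => //.
have Ifin : (\int[mu]_x (x ord0 i * f x)%:E)%E \is a fin_num.
  exact: integrable_fin_num fi.
have E : (\int[mu]_x (x ord0 i * f x)%:E = - \int[mu]_x (x ord0 i * f x)%:E)%E.
  rewrite -{1}(integral_comp_signed (T := fun x => - x) _ mG); last first.
    by move=> g mg g0; exact: integral_opp_rV.
  rewrite -integralN; last exact: integrable_add_def.
  apply: ae_eq_integral => //.
  - exact: (measurableT_comp mG mo).
  - exact: measurableT_comp.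
  - by apply: filterS fe => x /= + xT => /(_ xT) ->; rewrite mxE mulNr EFinN.
move: E Ifin; case: (\int[mu]_x _)%E => // r [] rN _; congr EFin.
by lra.
Qed.

Lemma indic_eball_opp (r : R) (x : V) :
  \1_(eball r) (- x) = \1_(eball r) x :> R.
Proof.
by rewrite !indicE; congr ((nat_of_bool _)%:R); apply/idP/idP; rewrite !inE /eball/= enormN.
Qed.

Lemma first_moment_eball (r h : R) : 0 <= h ->
  (first_moment (fun x : V => h * \1_(eball r) x)%R < +oo)%E.
Proof.
move=> h0; have mB : measurable_fun setT (\1_(eball r) : V -> R).
  by apply: measurable_indic; exact: measurable_eball.
pose r' := Num.max 0 r.
have r0 : 0 <= r' by rewrite le_max lexx.
apply: (@le_lt_trans _ _ (\int[mu]_x ((r' * h) * \1_(eball r) x)%:E)%E).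
  apply: nnint_le.
  - by apply: measurable_enormM; exact: measurable_funM.
  - exact: measurable_funM.
  - by move=> x; rewrite !mulr_ge0// enorm_ge0.
  - move=> x; rewrite mulrA indicE; have [xB|xB] := boolP (x \in eball r).
      rewrite !mulr1 ler_wpM2r//; move: xB; rewrite inE /eball/= => xB.
      by rewrite le_max xB orbT.
    by rewrite !mulr0.
rewrite nnintZ// ?mulr_ge0// integral_indic_eball.
by rewrite -EFinM ltry.
Qed.

Lemma density_eball m r h : 0 < m -> 0 <= h -> 0 < r ->
  density m (h * fine (mu (eball r))) (fun x : V => h * \1_(eball r) x).
Proof.
move=> m0 h0 r0; have mB : measurable_fun setT (\1_(eball r) : V -> R).
  by apply: measurable_indic; exact: measurable_eball.
have mh : measurable_fun setT (fun x : V => h * \1_(eball r) x).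
  exact: measurable_funM.
have h1 x : 0 <= h * \1_(eball r) x :> R by rewrite mulr_ge0.
apply/(densityP _ _ m0); split.
- exact: mh.
- exact: h1.
- by rewrite nnintZ// integral_indic_eball.
- rewrite (eq_integral (fun x : V => (h `^ m * \1_(eball r) x)%:E)); last first.
    move=> x _; rewrite indicE; case: (x \in _); first by rewrite !mulr1.
    by rewrite !mulr0 powR0// gt_eqF.
  rewrite nnintZ ?powR_ge0// integral_indic_eball.
  by rewrite -EFinM ltry.
- apply: even_centered => //; first exact: first_moment_eball.
  by apply/nearW => x _; rewrite /= indic_eball_opp.
Qed.

End balls_volume.

Section energies.
Context {R : realType} {n : nat}.
Hypothesis n0 : (0 < n)%N.
Local Notation mu := (lebesgue_rV R n).
Local Notation V := ('rV[R]_n).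
Variable m : R.
Hypothesis m2 : 2 < m.
Implicit Types f : V -> R.

Definition powint f : R := fine (\int[mu]_x (f x `^ m)%:E)%E.
Definition sqint f : R := fine (\int[mu]_x (f x ^+ 2)%:E)%E.
Definition selfint s f : R := fine (interaction s f f).

Let m0 : 0 < m. Proof. exact: lt_trans m2. Qed.

Lemma measurable_powRm f : measurable_fun setT f ->
  measurable_fun setT (fun x => f x `^ m).
Proof. by move=> mf; exact: (measurableT_comp (measurable_powR _) mf). Qed.

Section finite_energy.
Variables (M : R) (f : V -> R).
Hypotheses (mf : measurable_fun setT f) (f0 : forall x, 0 <= f x)
  (fM : (\int[mu]_x (f x)%:E = M%:E)%E) (fm : (\int[mu]_x (f x `^ m)%:E < +oo)%E).

Lemma powintE : (\int[mu]_x (f x `^ m)%:E = (powint f)%:E)%E.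
Proof.
by rewrite /powint fineK// ge0_fin_numE//; apply: nnint_ge0 => x; exact: powR_ge0.
Qed.

Lemma powint_ge0 : 0 <= powint f.
Proof. by apply: fine_ge0; apply: nnint_ge0 => x; exact: powR_ge0. Qed.

Lemma sqint_bound : (\int[mu]_x (f x ^+ 2)%:E <= (M + powint f)%:E)%E.
Proof.
rewrite EFinD -fM -powintE -nnintD//.
- apply: nnint_le.
  + exact: measurable_funX.
  + by apply: measurable_funD => //; exact: measurable_powRm.
  + by move=> x; exact: sqr_ge0.
  + by move=> x; exact: sqr_le_powR.
- exact: measurable_powRm.
- by move=> x; exact: powR_ge0.
Qed.

Lemma sqintE : (\int[mu]_x (f x ^+ 2)%:E = (sqint f)%:E)%E.
Proof.
rewrite /sqint fineK// ge0_fin_numE; first exact: le_lt_trans sqint_bound (ltry _).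
by apply: nnint_ge0 => x; exact: sqr_ge0.
Qed.

Lemma sqint_ge0 : 0 <= sqint f.
Proof. by apply: fine_ge0; apply: nnint_ge0 => x; exact: sqr_ge0. Qed.

Lemma sqint_le : sqint f <= M + powint f.
Proof. by rewrite -lee_fin -sqintE sqint_bound. Qed.

Lemma selfint_bound s : 0 < s -> 2 * s < n%:R ->
  (interaction s f f <=
   (near_mass (n := n) s * sqint f + riesz_const n s * M ^+ 2)%:E)%E.
Proof.
move=> s0 sn; have := interaction_le_sqr n0 s0 sn mf f0.
by rewrite fM sqintE expr2 -!EFinM -EFinD.
Qed.

Lemma selfintE s : 0 < s -> 2 * s < n%:R -> interaction s f f = (selfint s f)%:E.
Proof.
move=> s0 sn; rewrite /selfint fineK// ge0_fin_numE.
  exact: le_lt_trans (selfint_bound s0 sn) (ltry _).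
exact: interaction_ge0.
Qed.

Lemma selfint_ge0 s : 0 <= selfint s f.
Proof. by apply: fine_ge0; exact: interaction_ge0. Qed.

Lemma selfint_le s : 0 < s -> 2 * s < n%:R ->
  selfint s f <= near_mass (n := n) s * sqint f + riesz_const n s * M ^+ 2.
Proof. by move=> s0 sn; rewrite -lee_fin -selfintE// selfint_bound. Qed.

Lemma free_energyE chi beta s : 0 < s -> 2 * s < n%:R ->
  free_energy m chi beta s f =
  ((m - 1)^-1 * powint f + beta * sqint f - chi / 2 * selfint s f)%:E.
Proof.
move=> s0 sn; rewrite /free_energy powintE sqintE.
have := selfintE s0 sn; rewrite /interaction => ->.
by [].
Qed.

End finite_energy.

Lemma powint_eball r h : 0 <= h ->
  powint (fun x : V => h * \1_(eball r) x)%R = h `^ m * fine (mu (eball r)).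
Proof.
move=> h0; rewrite /powint.
rewrite (eq_integral (fun x : V => (h `^ m * \1_(eball r) x)%:E)); last first.
  move=> x _; rewrite indicE; case: (x \in _); first by rewrite !mulr1.
  by rewrite !mulr0 powR0// gt_eqF.
have mB : measurable_fun setT (\1_(eball r) : V -> R).
  by apply: measurable_indic; exact: measurable_eball.
by rewrite nnintZ ?powR_ge0// integral_indic_eball.
Qed.

Lemma sqint_eball r h : 0 <= h ->
  sqint (fun x : V => h * \1_(eball r) x)%R = h ^+ 2 * fine (mu (eball r)).
Proof.
move=> h0; rewrite /sqint.
rewrite (eq_integral (fun x : V => (h ^+ 2 * \1_(eball r) x)%:E)); last first.
  move=> x _; rewrite indicE; case: (x \in _); first by rewrite !mulr1.
  by rewrite !mulr0 expr0n.
have mB : measurable_fun setT (\1_(eball r) : V -> R).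
  by apply: measurable_indic; exact: measurable_eball.
by rewrite nnintZ ?sqr_ge0// integral_indic_eball.
Qed.

End energies.

(** * Truncation and vanishing *)

Section truncation.
Context {R : realType} {n : nat}.
Hypothesis n0 : (0 < n)%N.
Local Notation mu := (lebesgue_rV R n).
Local Notation V := ('rV[R]_n).
Variables (m chi beta M s : R) (rho : V -> R).
Hypotheses (m2 : 2 < m) (chi0 : 0 < chi) (beta0 : 0 <= beta) (M0 : 0 < M)
  (s0 : 0 < s) (sn : 2 * s < n%:R).
Hypothesis rho_min :
  ae_unique (minimizer (free_energy m chi beta s) (density m M)) rho.

Let m0 : 0 < m. Proof. exact: lt_trans m2. Qed.
Let m1 : 0 < m - 1. Proof. by rewrite subr_gt0 (lt_trans _ m2)// ltr1n. Qed.

Let rhoD : density m M rho. Proof. by have [[]] := rho_min. Qed.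
Let mr : measurable_fun setT rho. Proof. by have [] := (densityP M rho m0).1 rhoD. Qed.
Let r0 : forall x, 0 <= rho x. Proof. by have [] := (densityP M rho m0).1 rhoD. Qed.
Let rM : (\int[mu]_x (rho x)%:E = M%:E)%E.
Proof. by have [] := (densityP M rho m0).1 rhoD. Qed.
Let rm : (\int[mu]_x (rho x `^ m)%:E < +oo)%E.
Proof. by have [] := (densityP M rho m0).1 rhoD. Qed.

Lemma minimal_energy_le (eta : V -> R) : density m M eta ->
  (m - 1)^-1 * powint m rho + beta * sqint rho - chi / 2 * selfint s rho <=
  (m - 1)^-1 * powint m eta + beta * sqint eta - chi / 2 * selfint s eta.
Proof.
move=> etaD; have [me e0 eM em _] := (densityP M eta m0).1 etaD.
have [[_ rmin] _] := rho_min.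
have := rmin _ etaD.
rewrite (free_energyE n0 m2 mr r0 rM rm chi beta s0 sn).
by rewrite (free_energyE n0 m2 me e0 eM em chi beta s0 sn) lee_fin.
Qed.

Section level.
Variable h : R.
Hypothesis h0 : 0 < h.

Let rh x := Num.min (rho x) h.
Let w x := rho x - rh x.

Let rh0 x : 0 <= rh x. Proof. by rewrite le_min r0 ltW. Qed.
Let rhh x : rh x <= h. Proof. by rewrite ge_min lexx orbT. Qed.
Let rhr x : rh x <= rho x. Proof. by rewrite ge_min lexx. Qed.
Let w0 x : 0 <= w x. Proof. by rewrite subr_ge0. Qed.
Let mrh : measurable_fun setT rh.
Proof. exact: measurable_minr. Qed.
Let mw : measurable_fun setT w. Proof. exact: measurable_funB. Qed.
(** Where the excess [w] is nonzero, the truncated density sits exactly at the level [h]. *)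
Let wh x : w x * rh x = h * w x.
Proof.
rewrite /w /rh; case: (leP (rho x) h) => _; first by rewrite subrr mul0r mulr0.
exact: mulrC.
Qed.

Let e := fine (\int[mu]_x (w x)%:E)%E.

Let wfin : (\int[mu]_x (w x)%:E = e%:E)%E.
Proof.
rewrite /e fineK// ge0_fin_numE; last exact: nnint_ge0.
apply: (@le_lt_trans _ _ (\int[mu]_x (rho x)%:E)%E); last by rewrite rM ltry.
by apply: nnint_le => // x; rewrite /w gerBl.
Qed.

Let e0 : 0 <= e. Proof. by rewrite -lee_fin -wfin nnint_ge0. Qed.

Let rhM : (\int[mu]_x (rh x)%:E = (M - e)%:E)%E.
Proof.
have := nnintD mu mrh mw rh0 w0.
rewrite (eq_integral (fun x => (rho x)%:E)); last first.
  by move=> x _; rewrite /w addrC subrK.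
rewrite rM wfin; case: (\int[mu]_x _)%E => [t|//|//].
by rewrite -EFinD => -[->]; rewrite addrK.
Qed.

Let rhm : (\int[mu]_x (rh x `^ m)%:E < +oo)%E.
Proof.
apply: le_lt_trans rm; apply: nnint_le.
- exact: measurable_powRm.
- exact: measurable_powRm.
- by move=> x; exact: powR_ge0.
- by move=> x; apply: ge0_ler_powR; rewrite ?nnegrE// ltW.
Qed.

Let eM : e <= M.
Proof. by rewrite -subr_ge0 -lee_fin -rhM nnint_ge0. Qed.

(* The mass [e] cut off above level [h] is spread with small height over a large ball. *)
Let spread (b : R) : 0 < b <= 1 -> exists eta : V -> R,
  [/\ density m M eta,
      powint m eta <= powint m rh + b * (m * (h + 1) `^ (m - 2) * M),
      sqint eta <= sqint rh + b * (2 * M) &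
      selfint s rh <= selfint s eta].
Proof.
move=> /andP[b0 b1]; have e1 : 0 < e + 1 by rewrite ltr_wpDl.
have a0 : 0 < (e + 1) / b by rewrite divr_gt0.
have [r r_gt0 Br] := exists_eball_volume n0 a0.
(* This height is [b * e / (e + 1)], at most [b]; using [e + 1] in place of [e] for the volume
   covers the case where no mass is removed. *)
pose k := e / ((e + 1) / b).
have k0 : 0 <= k by rewrite divr_ge0// ltW.
have kb : k <= b.
  by rewrite /k invfM invrK mulrA ler_piMl ?(ltW b0)// ler_pdivrMr// mul1r lerDl.
have k1 : k <= 1 by exact: le_trans b1.
pose g (x : V) : R := k * \1_(eball r) x.
have mg : measurable_fun setT g.
  by apply: measurable_funM => //; apply: measurable_indic; exact: measurable_eball.
have g0 x : 0 <= g x by rewrite mulr_ge0.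
have gk x : g x <= k by rewrite /g indicE; case: (x \in _); rewrite ?mulr1// mulr0.
have gM : (\int[mu]_x (g x)%:E = e%:E)%E.
  rewrite nnintZ//; last by apply: measurable_indic; exact: measurable_eball.
  by rewrite integral_indic_eball Br -EFinM /k divfK// gt_eqF.
pose eta x := rh x + g x.
have meta : measurable_fun setT eta by exact: measurable_funD.
have eta0 x : 0 <= eta x by exact: addr_ge0.
have etaM : (\int[mu]_x (eta x)%:E = M%:E)%E.
  by rewrite nnintD// rhM gM -EFinD subrK.
have mhm : measurable_fun setT (fun x => rh x `^ m) by exact: measurable_powRm.
have H0 : 0 <= m * (h + 1) `^ (m - 2) by rewrite mulr_ge0 ?powR_ge0// ltW.
have etap : (\int[mu]_x (eta x `^ m)%:E <=
    (powint m rh + b * (m * (h + 1) `^ (m - 2) * M))%:E)%E.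
  apply: (@le_trans _ _ (\int[mu]_x (rh x `^ m + b * (m * (h + 1) `^ (m - 2)) * eta x)%:E)%E).
    apply: nnint_le.
    - exact: measurable_powRm.
    - by apply: measurable_funD => //; exact: measurable_funM.
    - by move=> x; exact: powR_ge0.
    - move=> x; have := powRD_le m2 (rh0 x) (g0 x) (lerD (rhh x) (le_trans (gk x) k1)).
      move/le_trans; apply; rewrite lerD2l.
      have := ler_wpM2r (mulr_ge0 H0 (eta0 x)) (le_trans (gk x) kb).
      by rewrite /eta; move: (m * _) => K; congr (_ <= _); ring.
  rewrite nnintD//; last 3 first.
  - exact: measurable_funM.
  - by move=> x; exact: powR_ge0.
  - by move=> x; apply: mulr_ge0 => //; apply: mulr_ge0 => //; exact: ltW.
  rewrite nnintZ//; last by apply: mulr_ge0 => //; exact: ltW.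
  by rewrite etaM (powintE rhm) -EFinM -EFinD -!mulrA.
have etam : (\int[mu]_x (eta x `^ m)%:E < +oo)%E by exact: le_lt_trans etap (ltry _).
have etaD : density m M eta.
  apply/(densityP _ _ m0); split; [exact: meta|exact: eta0|exact: etaM|exact: etam|].
  have [_ _ _ _ rc] := (densityP M rho m0).1 rhoD.
  (* Truncation preserves the almost everywhere evenness of the minimizer and the added ball is
     centered, so the competitor has center of mass [0]. *)
  apply: even_centered; [exact: meta|exact: eta0| |].
    apply: (@le_lt_trans _ _ (\int[mu]_x (enorm x * rho x + enorm x * g x)%:E)%E).
      apply: nnint_le.
      - exact: measurable_enormM.
      - by apply: measurable_funD; exact: measurable_enormM.
      - by move=> x; rewrite mulr_ge0// enorm_ge0.
      - by move=> x; rewrite -mulrDr ler_wpM2l ?enorm_ge0// lerD2r.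
    rewrite nnintD; last 4 first.
    - exact: measurable_enormM.
    - exact: measurable_enormM.
    - by move=> x; rewrite mulr_ge0// enorm_ge0.
    - by move=> x; rewrite mulr_ge0// enorm_ge0.
    apply: lte_add_pinfty; first exact: first_moment_fin.
    exact: first_moment_eball.
  apply: filterS (minimizer_even m0 rho_min) => x + xT => /(_ xT) /= E.
  by rewrite /eta /rh /g E indic_eball_opp.
exists eta; split; first exact: etaD.
- by rewrite -lee_fin -(powintE etam).
- rewrite -lee_fin -(sqintE m2 meta eta0 etaM etam).
  apply: (@le_trans _ _ (\int[mu]_x (rh x ^+ 2 + b * 2 * eta x)%:E)%E).
    apply: nnint_le.
    - exact: measurable_funX.
    - by apply: measurable_funD; [exact: measurable_funX|exact: measurable_funM].
    - by move=> x; exact: sqr_ge0.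
    - move=> x; rewrite /eta sqrrD -addrA lerD2l.
      have gb := le_trans (gk x) kb.
      apply: (@le_trans _ _ (g x * (2 * (rh x + g x)))).
        rewrite -subr_ge0 (_ : _ - _ = g x ^+ 2) ?sqr_ge0//; ring.
      by rewrite -[leRHS]mulrA; apply: ler_wpM2r gb; rewrite mulr_ge0// addr_ge0.
  rewrite nnintD//; last 4 first.
  - exact: measurable_funX.
  - exact: measurable_funM.
  - by move=> x; exact: sqr_ge0.
  - by move=> x; apply: mulr_ge0 => //; apply: mulr_ge0 => //; exact: ltW.
  rewrite nnintZ//; last by apply: mulr_ge0 => //; exact: ltW.
  by rewrite etaM (sqintE m2 mrh rh0 rhM rhm) -EFinM -EFinD mulrA.
- have : (interaction s rh rh <= interaction s eta eta)%E.
    by apply: interaction_le => // x; rewrite rh0 lerDl g0.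
  rewrite (selfintE n0 m2 mrh rh0 rhM rhm s0 sn).
  by rewrite (selfintE n0 m2 meta eta0 etaM etam s0 sn) lee_fin.
Qed.

Let le_of_slope (x y C : R) : 0 <= C ->
  (forall b, 0 < b <= 1 -> x <= y + b * C) -> x <= y.
Proof.
move=> C0 H; rewrite leNgt; apply/negP => yx.
have C1 : 0 < C + 1 by rewrite ltr_wpDl.
pose b := Num.min 1 ((x - y) / 2 / (C + 1)).
have b0 : 0 < b by rewrite lt_min ltr01 !divr_gt0// subr_gt0.
have b1 : b <= 1 by rewrite ge_min lexx.
have bC : b * (C + 1) <= (x - y) / 2 by rewrite -ler_pdivlMr// ge_min lexx orbT.
by have := H b; rewrite b0 b1 => /(_ isT); lra.
Qed.

(** [rh] has mass [M - e], so it need not be a competitor; the inequality is the limit as [b] tends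
    to [0] of those for the spread densities, whose interaction energy is at least that of [rh]. *)
Let truncated_energy_ge :
  (m - 1)^-1 * powint m rho + beta * sqint rho - chi / 2 * selfint s rho <=
  (m - 1)^-1 * powint m rh + beta * sqint rh - chi / 2 * selfint s rh.
Proof.
apply: (@le_of_slope _ _ ((m - 1)^-1 * (m * (h + 1) `^ (m - 2) * M) + beta * (2 * M))).
  have h1 := powR_ge0 (h + 1) (m - 2).
  apply: addr_ge0; first by rewrite mulr_ge0 ?invr_ge0 ?(ltW m1)// !mulr_ge0// ltW.
  by rewrite !mulr_ge0// ltW.
move=> b bb; have [eta [etaD]] := spread bb.
have := minimal_energy_le etaD.
move: (powint m eta) (sqint eta) (selfint s eta) (selfint s rh) (powint m rh) (sqint rh)
  (m * _ * M) => p q i ih ph qh C lm lp lq li.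
have c2 : 0 <= chi / 2 by rewrite divr_ge0// ltW.
have mi : 0 <= (m - 1)^-1 by rewrite invr_ge0 ltW.
have := ler_wpM2l mi lp; have := ler_wpM2l beta0 lq; have := ler_wpM2l c2 li.
by rewrite !mulrDr; move: lm; rewrite !(mulrCA _ b); lra.
Qed.

Let Q := sqint rho - sqint rh.

(** By [wh], the square of [rho] is pointwise the sum of [rh^2], [w^2] and [2 * h * w]. *)
Let sqr_split : (\int[mu]_x (w x ^+ 2)%:E)%E = (Q - 2 * h * e)%:E.
Proof.
have := nnintD mu (measurable_funX 2 mrh) (measurable_funD (measurable_funX 2 mw)
  (measurable_funM (measurable_cst (2 * h)) mw)) (fun x => sqr_ge0 _)
  (fun x => addr_ge0 (sqr_ge0 _) (mulr_ge0 (mulr_ge0 (ler0n R 2) (ltW h0)) (w0 x))).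
rewrite (eq_integral (fun x => (rho x ^+ 2)%:E)); last first.
  move=> x _; congr EFin; rewrite /= -mulrA -wh.
  by rewrite (_ : rho x = rh x + w x); [ring|rewrite /w addrC subrK].
rewrite nnintD//; last 4 first.
- exact: measurable_funX.
- exact: measurable_funM.
- by move=> x; exact: sqr_ge0.
- by move=> x; apply: mulr_ge0 => //; apply: mulr_ge0 => //; exact: ltW.
rewrite nnintZ//; last by apply: mulr_ge0 => //; exact: ltW.
rewrite wfin (sqintE m2 mrh rh0 rhM rhm) (sqintE m2 mr r0 rM rm).
have : (0 <= \int[mu]_x (w x ^+ 2)%:E)%E by apply: nnint_ge0 => x; exact: sqr_ge0.
case: (\int[mu]_x _)%E => [t _|//|//].
by rewrite -EFinM -!EFinD => -[E]; congr EFin; rewrite /Q; lra.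
Qed.

Let Q_ge : 2 * h * e <= Q.
Proof.
by rewrite -subr_ge0 -lee_fin -sqr_split; apply: nnint_ge0 => x; exact: sqr_ge0.
Qed.

Let powint_gap : h `^ (m - 2) * Q <= powint m rho - powint m rh.
Proof.
have hp := powR_ge0 h (m - 2).
have mhm : measurable_fun setT (fun x => rh x `^ m) by exact: measurable_powRm.
have md : measurable_fun setT (fun x => w x ^+ 2 + 2 * h * w x).
  by apply: measurable_funD; [exact: measurable_funX|exact: measurable_funM].
have d0 x : 0 <= w x ^+ 2 + 2 * h * w x.
  by apply: addr_ge0; [exact: sqr_ge0|apply: mulr_ge0 => //; apply: mulr_ge0 => //; exact: ltW].
have : (\int[mu]_x (rh x `^ m + h `^ (m - 2) * (w x ^+ 2 + 2 * h * w x))%:E <=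
    \int[mu]_x (rho x `^ m)%:E)%E.
  apply: nnint_le.
  - by apply: measurable_funD => //; exact: measurable_funM.
  - exact: measurable_powRm.
  - by move=> x; apply: addr_ge0; [exact: powR_ge0|exact: mulr_ge0].
  - move=> x; rewrite /w /rh; case: (leP (rho x) h) => hx.
      by rewrite subrr expr0n !mulr0 addr0 mulr0 addr0.
    have := powRB_ge_sqr m2 (ltW h0) (ltW hx).
    by rewrite -lerBrDl; congr (_ <= _); ring.
rewrite nnintD//; last 3 first.
- exact: measurable_funM.
- by move=> x; exact: powR_ge0.
- by move=> x; exact: mulr_ge0.
rewrite nnintZ// nnintD//; last 4 first.
- exact: measurable_funX.
- exact: measurable_funM.
- by move=> x; exact: sqr_ge0.
- by move=> x; apply: mulr_ge0 => //; apply: mulr_ge0 => //; exact: ltW.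
rewrite nnintZ//; last by apply: mulr_ge0 => //; exact: ltW.
rewrite wfin sqr_split (powintE rhm) (powintE rm).
rewrite -(EFinM (2 * h) e) -(EFinD (Q - _)) -(EFinM (h `^ _)) -EFinD lee_fin.
by rewrite subrK -lerBrDl.
Qed.

Local Notation A := (near_mass (R := R) (n := n) s).
Local Notation c := (riesz_const (R := R) n s).

(** Expand the interaction of [rho = rh + w]. The two cross terms use [rh <= h], the term in [w]
    alone the quadratic bound; the contributions [2 * A * h * e] then cancel, and three copies of
    [c * M * e] remain. *)
Let selfint_gap : selfint s rho - selfint s rh <= A * Q + 3 * c * M * e.
Proof.
have c0 : 0 <= c by exact: riesz_const_ge0.
have Jw (f : V -> R) : measurable_fun setT f -> (forall x, 0 <= f x) ->
    (interaction s f rho = interaction s rh f + interaction s w f)%E.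
  move=> mf f0; rewrite (interaction_sym s mf mr f0 r0).
  rewrite -(interactionDl s mrh mw mf rh0 w0 f0).
  by congr (interaction s _ f); apply/funext => x; rewrite /w addrC subrK.
have E : (interaction s rho rho = interaction s rh rh + interaction s w rh +
    (interaction s w rh + interaction s w w))%E.
  by rewrite (Jw _ mr r0) (Jw _ mrh rh0) (Jw _ mw w0) (interaction_sym s mrh mw rh0 w0).
have b1 : (interaction s w rh <= ((A * h + c * M) * e)%:E)%E.
  have rhh' x : 0 <= rh x <= h by rewrite rh0 rhh.
  apply: (le_trans (interaction_le_bounded n0 s0 sn mw mrh w0 rhh')).
  rewrite rhM wfin -(EFinM c) -(EFinD (A * h)) -(EFinM _ e) lee_fin.
  rewrite ler_wpM2r// lerD2l ler_wpM2l//.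
  by rewrite gerBl.
have b2 : (interaction s w w <= (A * (Q - 2 * h * e) + c * (M * e))%:E)%E.
  apply: (le_trans (interaction_le_sqr n0 s0 sn mw w0)).
  rewrite sqr_split wfin -(EFinM A) -(EFinM e) -(EFinM c) -(EFinD (A * _)) lee_fin.
  rewrite lerD2l ler_wpM2l//.
  by rewrite ler_wpM2r.
have b3 : (interaction s rho rho <= (selfint s rh + (A * h + c * M) * e +
    ((A * h + c * M) * e + (A * (Q - 2 * h * e) + c * (M * e))))%:E)%E.
  rewrite E (selfintE n0 m2 mrh rh0 rhM rhm s0 sn) !EFinD.
  by apply: leeD; [apply: leeD|apply: leeD].
move: b3; rewrite (selfintE n0 m2 mr r0 rM rm s0 sn) lee_fin.
move: (selfint s rho) (selfint s rh) A c => i ih a k.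
rewrite lerBlDl => /le_trans; apply; rewrite le_eqVlt; apply/orP; left.
by apply/eqP; ring.
Qed.

(** Since [2 * h * e <= Q], gains and losses are all measured by [Q]; the hypothesis says that the
    gain has the larger coefficient. Hence [Q <= 0], the removed mass [e] is [0], and the excess
    vanishes almost everywhere. *)
Lemma minimizer_bounded :
  chi / 2 * (A + 3 * c * M / (2 * h)) < (m - 1)^-1 * h `^ (m - 2) + beta ->
  {ae mu, forall x, rho x <= h}.
Proof.
move=> hyp; have c0 : 0 <= c by exact: riesz_const_ge0.
have Q0 : Q <= 0.
  have gap1 : (m - 1)^-1 * (powint m rho - powint m rh) + beta * Q <=
      chi / 2 * (selfint s rho - selfint s rh).
    rewrite /Q; move: truncated_energy_ge.
    move: (powint m rho) (powint m rh) (sqint rho) (sqint rh) (selfint s rho)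
      (selfint s rh) (m - 1)^-1 => p ph q qh i ih k.
    by rewrite !mulrBr; lra.
  have mi : 0 <= (m - 1)^-1 by rewrite invr_ge0 ltW.
  have c2 : 0 <= chi / 2 by rewrite divr_ge0// ltW.
  have eQ : 3 * c * M * e <= 3 * c * M / (2 * h) * Q.
    have cM : 0 <= 3 * c * M.
      by apply: mulr_ge0; [exact: mulr_ge0|exact: ltW].
    rewrite -[leRHS]mulrA; apply: ler_wpM2l cM _ _ _.
    by rewrite ler_pdivlMl ?mulr_gt0.
  have g1 := ler_wpM2l mi powint_gap.
  have g2 := ler_wpM2l c2 selfint_gap.
  have g3 := ler_wpM2l c2 eQ.
  rewrite leNgt; apply/negP => Qp.
  have : ((m - 1)^-1 * h `^ (m - 2) + beta) * Q <=
      chi / 2 * (A + 3 * c * M / (2 * h)) * Q.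
    move: g1 gap1 g2 g3; move: (powint m rho - _) (selfint s rho - _) => p i.
    move: (3 * c * M * e) (3 * c * M / _) (h `^ _) (m - 1)^-1 => k k' u v.
    by rewrite !mulrDr !mulrDl; lra.
  by rewrite leNgt ltr_pM2r// hyp.
have : e <= 0.
  have h2 : 0 < 2 * h by rewrite mulr_gt0.
  by have := le_trans Q_ge Q0; rewrite pmulr_rle0.
move=> ee; have {ee} : e = 0 by apply/eqP; rewrite eq_le ee e0.
move=> ee; have w00 : (\int[mu]_x (w x)%:E = 0)%E by rewrite wfin ee.
apply: filterS (nnint_eq0 mw w0 w00) => x /= /(_ I) /eqP; rewrite /w subr_eq0 => /eqP ->.
exact: rhh.
Qed.

End level.
End truncation.

Section convergence_to_zero.
Context {R : realType}.
Implicit Types (f : R -> \bar R).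

Lemma cvge0P f :
  (forall e : R, 0 < e -> \forall s \near 0^'+, (`|f s| <= e%:E)%E) ->
  f s @[s --> 0^'+] --> 0%E.
Proof.
move=> H; apply/fine_cvgP; split.
  apply: filterS (H 1 ltr01) => s.
  by case: (f s) => [r| |] //=; rewrite leye_eq.
apply/cvgr0Pnorm_le => e e0; apply: filterS (H e e0) => s /=.
by case: (f s) => [r| |] //=; rewrite ?normr0 ?(ltW e0).
Qed.

Lemma near_half : \forall s \near (0 : R)^'+, 0 < s < 1 / 2.
Proof.
near=> s; have s0 : 0 < s by [].
rewrite s0 /=; near: s; apply: nbhs_right_lt; lra.
Unshelve. all: by end_near. Qed.

Lemma near_mass_near n (e : R) : (0 < n)%N -> 0 < e ->
  \forall s \near 0^'+, `|near_mass (n := n) s - 1| <= e.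
Proof.
move=> n0 e0; have /cvgrPdist_le/(_ _ e0) := near_mass_cvg (R := R) n0.
by apply: filterS => s; rewrite distrC.
Qed.

Lemma riesz_const_near n (e : R) : (0 < n)%N -> 0 < e ->
  \forall s \near 0^'+, riesz_const n s <= e.
Proof.
move=> n0 e0; have /cvgr0Pnorm_le/(_ _ e0) := riesz_const_cvg (R := R) n0.
by apply: filterS => s; exact: le_trans (ler_norm _).
Qed.

End convergence_to_zero.

Section vanishing.
Context {R : realType} {n : nat}.
Hypothesis n0 : (0 < n)%N.
Local Notation mu := (lebesgue_rV R n).
Local Notation V := ('rV[R]_n).
Variables (m chi beta M : R) (rho : R -> V -> R).
Hypotheses (m2 : 2 < m) (chi0 : 0 < chi) (beta0 : 0 <= beta) (M0 : 0 < M).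
Hypothesis rho_min : forall s, 0 < s < 1 / 2 ->
  ae_unique (minimizer (free_energy m chi beta s) (density m M)) (rho s).

Let m0 : 0 < m. Proof. exact: lt_trans m2. Qed.
Let m1 : 0 < m - 1. Proof. by rewrite subr_gt0 (lt_trans _ m2)// ltr1n. Qed.
Let mi : 0 < (m - 1)^-1. Proof. by rewrite invr_gt0. Qed.

Lemma double_lt_dim (s : R) : 0 < s < 1 / 2 -> 2 * s < n%:R.
Proof.
move=> /andP[s0 s1]; apply: (@lt_le_trans _ _ 1); first lra.
by rewrite ler1n.
Qed.

Lemma mass_ball_test (h : R) : 0 < h -> exists eta : V -> R,
  [/\ density m M eta, powint m eta = M * h `^ (m - 1) & sqint eta = M * h].
Proof.
move=> h0; have a0 : 0 < M / h by rewrite divr_gt0.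
have [r r0 Br] := exists_eball_volume n0 a0.
exists (fun x : V => h * \1_(eball r) x); split.
- have := density_eball (n := n) m0 (ltW h0) r0.
  by rewrite Br /= mulrCA divff ?gt_eqF// mulr1.
- rewrite powint_eball ?(ltW h0)// Br /= (powRB1 m2 (ltW h0)) (powRB2 m2 (ltW h0)).
  by move: (h `^ _) => u; field; rewrite gt_eqF.
- by rewrite sqint_eball ?(ltW h0)// Br /=; field; rewrite gt_eqF.
Qed.

Hypothesis beta_chi : chi / 2 <= beta.

(** From above, a flat ball of height [h] has energy of order [h]. From below, only the error
    [(A - 1) * sqint] and the term with [riesz_const] can be negative, and [sqint <= M + powint]
    lets the power energy absorb the former up to a multiple of [M]. *)
Lemma vanishing_energy :
  free_energy m chi beta s (rho s) @[s --> 0^'+] --> 0%E.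
Proof.
apply: cvge0P => e e0.
pose C := M * ((m - 1)^-1 + beta) + 1.
have C0 : 0 < C by rewrite ltr_wpDl ?mulr_ge0 ?addr_ge0// ?ltW// ltW.
pose h := Num.min 1 (e / C).
have h0 : 0 < h by rewrite lt_min ltr01 divr_gt0.
have h1 : h <= 1 by rewrite ge_min lexx.
have hC : h * C <= e by rewrite -ler_pdivlMr// ge_min lexx orbT.
have hh : h `^ (m - 1) <= h.
  rewrite (powRB1 m2 (ltW h0)) ler_piMl ?(ltW h0)//.
  have := ge0_ler_powR (_ : 0 <= m - 2) _ _ h1; rewrite powR1; apply.
  - by rewrite subr_ge0 ltW.
  - by rewrite nnegrE ltW.
  - by rewrite nnegrE.
have [eta [etaD etap etaq]] := mass_ball_test h0.
(* [e1] and [e3] leave errors of at most [e / 2] each; [e2] makes half of the power energy absorb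
   the part of the error proportional to it. *)
have e1 : 0 < e / (chi * M) by rewrite divr_gt0 ?mulr_gt0.
have e2 : 0 < (m - 1)^-1 / chi by rewrite divr_gt0.
have e3 : 0 < e / (chi * M ^+ 2) by rewrite divr_gt0 ?mulr_gt0 ?exprn_gt0.
near=> s; have sI : 0 < s < 1 / 2 by near: s; exact: near_half.
have s0 : 0 < s by case/andP: sI.
have sn := double_lt_dim sI; have rmin := rho_min sI.
have rD : density m M (rho s) by have [[]] := rmin.
have [mr r0 rM rm _] := (densityP M (rho s) m0).1 rD.
have [_ he0 _ _ _] := (densityP M eta m0).1 etaD.
have up := minimal_energy_le n0 m2 s0 sn rmin etaD.
rewrite (free_energyE n0 m2 mr r0 rM rm chi beta s0 sn) abse_EFin lee_fin.
have A1 : `|near_mass (n := n) s - 1| <= e / (chi * M).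
  by near: s; exact: near_mass_near.
have A2 : `|near_mass (n := n) s - 1| <= (m - 1)^-1 / chi.
  by near: s; exact: near_mass_near.
have cs : riesz_const n s <= e / (chi * M ^+ 2).
  by near: s; exact: riesz_const_near.
have ile := selfint_le n0 m2 mr r0 rM rm s0 sn.
have qle := sqint_le m2 mr r0 rM rm.
have q0 := sqint_ge0 (rho s); have p0 := powint_ge0 m (rho s).
have i0 := selfint_ge0 he0 s.
move: A1 A2 ile; rewrite etap etaq in up; set a := near_mass s - 1.
rewrite (_ : near_mass s = 1 + a); last by rewrite /a addrC subrK.
have c2 : 0 <= chi / 2 by rewrite divr_ge0// ltW.
move: a up cs q0 p0 i0 qle.
move: (powint m (rho s)) (sqint (rho s)) (selfint s (rho s)) (selfint s eta)
  (riesz_const n s) => p q i j c a up cs q0 p0 j0 qle A1 A2 ile.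
have {}cs : c * (chi * M ^+ 2) <= e by rewrite -ler_pdivlMr ?mulr_gt0 ?exprn_gt0.
have {}A1 : `|a| * (chi * M) <= e by rewrite -ler_pdivlMr ?mulr_gt0.
have {}A2 : `|a| * chi <= (m - 1)^-1 by rewrite -ler_pdivlMr.
have aq : a * q <= `|a| * (M + p).
  apply: (@le_trans _ _ (`|a| * q)); first by rewrite ler_wpM2r// ler_norm.
  by rewrite ler_wpM2l.
rewrite ler_norml; apply/andP; split.
  have t1 := ler_wpM2l c2 ile; have t2 := ler_wpM2r q0 beta_chi.
  have t3 := ler_wpM2l c2 aq; have t4 := ler_wpM2r p0 A2.
  have t5 : 0 <= `|a| * chi * p by rewrite !mulr_ge0// ltW.
  move: t1 t3; rewrite (mulrDl 1) mul1r.
  have -> : chi / 2 * (`|a| * (M + p)) = (`|a| * (chi * M) + `|a| * chi * p) / 2 by field.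
  have -> : chi / 2 * (q + a * q + c * M ^+ 2) =
    chi / 2 * q + chi / 2 * (a * q) + c * (chi * M ^+ 2) / 2 by field.
  move: A1 cs t2 t4 t5.
  by move: (`|a| * (chi * M)) (`|a| * chi * p) (c * _) (a * q) => x y z w; lra.
apply: (le_trans up).
have t1 : 0 <= chi / 2 * j by rewrite mulr_ge0.
have t2 := ler_wpM2l (mulr_ge0 (ltW mi) (ltW M0)) hh.
move: hC t1 t2; rewrite /C.
by move: (h `^ (m - 1)) (m - 1)^-1 (chi / 2 * j) => u k t; lra.
Unshelve. all: by end_near. Qed.

(** As [s] tends to [0] the condition of [minimizer_bounded] becomes [chi / 2 < k + beta], which is
    strict for every level [h > 0] even if [beta = chi / 2]. *)
Lemma vanishing_sup :
  ('N[mu]_+oo[EFin \o rho s])%E @[s --> 0^'+] --> 0%E.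
Proof.
apply: cvge0P => h h0.
pose k := (m - 1)^-1 * h `^ (m - 2).
have k0 : 0 < k by rewrite mulr_gt0 ?powR_gt0.
(* Each of the two error terms may use [k / (2 * chi)]; multiplied by [chi / 2] they add up to
   [k / 2], below the available gain [k]. *)
have e1 : 0 < k / (2 * chi) by apply: divr_gt0 => //; exact: mulr_gt0.
have h2 : 0 < 2 * h by exact: mulr_gt0.
have Mh : 0 < 3 * M / (2 * h) by apply: divr_gt0 => //; exact: mulr_gt0.
have e2 : 0 < k / (2 * chi) / (3 * M / (2 * h)) by exact: divr_gt0.
near=> s; have sI : 0 < s < 1 / 2 by near: s; exact: near_half.
have s0 : 0 < s by case/andP: sI.
have sn := double_lt_dim sI; have rmin := rho_min sI.
have rD : density m M (rho s) by have [[]] := rmin.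
have [mr r0 rM rm _] := (densityP M (rho s) m0).1 rD.
rewrite gee0_abs ?Lnorm_ge0// unlock /Lnorm.
case: ifPn => _; last by rewrite lee_fin ltW.
have hyp : chi / 2 * (near_mass (n := n) s + 3 * riesz_const n s * M / (2 * h)) <
    (m - 1)^-1 * h `^ (m - 2) + beta.
  have A1 : `|near_mass (n := n) s - 1| <= k / (2 * chi).
    by near: s; exact: near_mass_near.
  have cs : riesz_const n s <= k / (2 * chi) / (3 * M / (2 * h)).
    by near: s; exact: riesz_const_near.
  have {}cs : 3 * riesz_const n s * M / (2 * h) <= k / (2 * chi).
    move: cs; rewrite ler_pdivlMr//.
    by congr (_ <= _); ring.
  have {}A1 : near_mass (n := n) s <= 1 + k / (2 * chi).
    by have := le_trans (ler_norm _) A1; rewrite lerBlDl.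
  have c2 : 0 < chi / 2 by rewrite divr_gt0.
  have := lerD A1 cs; rewrite -(ler_pM2l c2) => /le_lt_trans; apply.
  rewrite -/k (_ : chi / 2 * _ = chi / 2 + k / 2); last by field; rewrite gt_eqF.
  by rewrite addrC ltr_leD// ltr_pdivrMr// ltr_pMr// ltr1n.
apply/ess_sup_inf.ess_supP.
apply: filterS (minimizer_bounded n0 m2 chi0 beta0 M0 s0 sn rmin h0 hyp) => x xh.
by rewrite /= lee_fin ger0_norm.
Unshelve. all: by end_near. Qed.

End vanishing.

(** * Double well and concentration *)

Section well.
Context {R : realType}.
Variables (m a : R).
Hypotheses (m2 : 2 < m) (a0 : 0 < a).
Implicit Types (t y : R).

Let m1 : 0 < m - 1. Proof. by rewrite subr_gt0 (lt_trans _ m2)// ltr1n. Qed.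
Let mb : 0 < m - 2. Proof. by rewrite subr_gt0. Qed.
Let k := (m - 1)^-1.
Let k0 : 0 < k. Proof. by rewrite invr_gt0. Qed.

Definition plateau : R := a `^ ((m - 2)^-1).
Local Notation T := plateau.

(** The Lagrange multiplier of the mass constraint: the value for which [well t / t] has minimum
    [0], reached at [T]. *)
Definition multiplier : R := a * T * (1 - (m - 1)^-1).
Local Notation lam := multiplier.

Lemma plateau_gt0 : 0 < T. Proof. exact: powR_gt0. Qed.
Let T0 := plateau_gt0.

Lemma plateau_powR : T `^ (m - 2) = a.
Proof. by rewrite -powRrM mulVf ?gt_eqF// powRr1// ltW. Qed.

Definition well t := k * t `^ m - a * t ^+ 2 + lam * t.

Let G t := k * t `^ (m - 1) - a * t + lam.

Let wellE t : 0 <= t -> well t = t * G t.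
Proof.
move=> t0; rewrite /well /G (powRB2 m2 t0) (powRB1 m2 t0).
by move: (t `^ _) => u; ring.
Qed.

Let tangent t y : 0 <= t -> 0 <= y ->
  t * y `^ (m - 2) - y `^ (m - 2) * y <= k * t `^ (m - 1) - k * (y `^ (m - 2) * y).
Proof.
move=> t0 y0; have p1 : 1 < m - 1 by move: m2; lra.
have := powR_tangent p1 t0 y0; rewrite (powRB1 m2 y0).
have -> : m - 1 - 1 = m - 2 by ring.
move: (t `^ _) (y `^ _) => u v h.
have := ler_wpM2l (ltW k0) h; rewrite -subr_ge0 -[in X in _ -> X]subr_ge0.
by congr (0 <= _); rewrite /k; field; rewrite gt_eqF.
Qed.

(** The tangent of the convex function [G] at [y], where [G y] is dropped because it is nonnegative,
    by the tangent at [T]. *)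
Let slope t y : 0 <= t -> 0 <= y -> (y `^ (m - 2) - a) * (t - y) <= G t.
Proof.
move=> t0 y0; have h1 := tangent t0 y0; have h2 := tangent y0 (ltW T0).
move: h2; rewrite plateau_powR (powRB1 m2 y0) => h2.
have -> : G t = k * t `^ (m - 1) - a * t + (a * T - k * (a * T)).
  by rewrite /G /multiplier -/k; congr (_ + _); ring.
move: h1 h2; move: (t `^ _) (y `^ _) => u v.
by move: (T) => x h1 h2; have := lerD h1 h2; lra.
Qed.

Let G_ge0 t : 0 <= t -> 0 <= G t.
Proof.
by move=> t0; have := slope t0 (ltW T0); rewrite plateau_powR subrr mul0r.
Qed.

Lemma well_ge0 t : 0 <= t -> 0 <= well t.
Proof. by move=> t0; rewrite wellE// mulr_ge0// G_ge0. Qed.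

Lemma well_plateau : well T = 0.
Proof.
rewrite /well (powRB2 m2 (ltW T0)) plateau_powR /multiplier -/k.
by move: (T) => x; ring.
Qed.

Let coercive delta : 0 < delta -> delta <= T -> exists2 D, 0 < D &
  forall t, 0 <= t -> delta <= `|t - T| -> Num.max t T <= D * G t.
Proof.
(* The tangents at half the distance [delta] on either side of [T] have nonzero slope, so they bound
   [G] below by positive quantities at distance [delta] and beyond, linearly in [t] on the right. *)
move=> d0 dT; have Tp := T0; pose y1 := T - delta / 2; pose y2 := T + delta / 2.
have y10 : 0 < y1 by rewrite /y1; lra.
have y20 : 0 < y2 by rewrite /y2; lra.
have c1 : 0 < a - y1 `^ (m - 2).
  rewrite subr_gt0 -[ltRHS]plateau_powR gt0_ltr_powR// ?nnegrE ?ltW//.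
  by rewrite /y1; lra.
have c2 : 0 < y2 `^ (m - 2) - a.
  rewrite subr_gt0 -[ltLHS]plateau_powR gt0_ltr_powR// ?nnegrE ?ltW//.
  by rewrite /y2; lra.
have s1 t (t0 : 0 <= t) := slope t0 (ltW y10).
have s2 t (t0 : 0 <= t) := slope t0 (ltW y20).
move: c1 c2 s1 s2.
move: (y1 `^ _) (y2 `^ _) => u v c1 c2 s1 s2.
have b1 : 0 < (a - u) * (delta / 2) by rewrite mulr_gt0// divr_gt0.
have b2 : 0 < (v - a) * (delta / 2 / (T + delta)).
  by rewrite mulr_gt0// divr_gt0 ?divr_gt0// addr_gt0.
exists (T / ((a - u) * (delta / 2)) + ((v - a) * (delta / 2 / (T + delta)))^-1).
  by rewrite addr_gt0 ?invr_gt0// divr_gt0.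
move=> t t0; have Gt := G_ge0 t0; rewrite ler_normr => /orP[tT|tT].
- have -> : Num.max t T = t by apply/max_idPl; lra.
  rewrite mulrDl -[leLHS]add0r lerD//; first by rewrite mulr_ge0// divr_ge0// ltW.
  rewrite ler_pdivlMl//; apply: le_trans (s2 t t0).
  rewrite -[leLHS]mulrA ler_wpM2l ?(ltW c2)// [leLHS]mulrAC ler_pdivrMr ?addr_gt0// /y2.
  rewrite -subr_ge0 (_ : _ - _ = (t - T - delta) * (T + delta / 2)); last by field.
  by rewrite mulr_ge0//; lra.
- have -> : Num.max t T = T by apply/max_idPr; lra.
  rewrite mulrDl -[leLHS]addr0 lerD//; last by rewrite mulr_ge0// invr_ge0 ltW.
  rewrite -[leRHS]mulrA -[leLHS]mulr1 ler_wpM2l ?(ltW T0)// ler_pdivlMl// mulr1.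
  apply: le_trans (s1 t t0); rewrite -[leRHS]mulrNN !opprB ler_wpM2l ?(ltW c1)//.
  by rewrite /y1; lra.
Qed.

(* Distance to the nearer of the two zeros of [well]. *)
Definition well_dist t := `|t - T * \1_(`]T / 2, +oo[%classic) t|.

Lemma well_dist_low t : t <= T / 2 -> well_dist t = `|t|.
Proof.
move=> tT; rewrite /well_dist indicE memNset ?mulr0 ?subr0//=.
by rewrite in_itv/= andbT; apply/negP; rewrite -leNgt.
Qed.

Lemma well_dist_high t : T / 2 < t -> well_dist t = `|t - T|.
Proof.
by move=> tT; rewrite /well_dist indicE mem_set ?mulr1//= in_itv/= tT.
Qed.

Lemma measurable_well_dist : measurable_fun setT well_dist.
Proof.
apply: measurableT_comp => //; apply: measurable_funB => //.
by apply: measurable_funM => //; exact: measurable_indic.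
Qed.

Let well_dist_le t : 0 <= t -> well_dist t <= t.
Proof.
move=> t0; have Tp := T0; have [tT|tT] := leP t (T / 2).
  by rewrite well_dist_low// ger0_norm.
by rewrite well_dist_high// ler_norml; apply/andP; split; lra.
Qed.

(** Near [T] the well is flat and cannot control the distance to the first power; there the distance
    is small and, as [t > T / 2], the term [eps * t] pays for it. On a density this costs only
    [eps * M]. *)
Lemma well_dist_bound (eps : R) : 0 < eps -> exists2 C, 0 <= C &
  forall t, 0 <= t ->
    well_dist t `^ m + a * T * well_dist t <= eps * t + C * well t.
Proof.
move=> e0; have Tp := T0; have mp := m2; have K0 : 0 < 1 + a * T by rewrite addr_gt0// mulr_gt0.
(* [1] makes the [m]-th power of the distance at most the distance, [T / 4] keeps [t] above [T / 2],
   and the last bound fits the total below [eps * (T / 2)]. *)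
pose delta := Num.min (Num.min 1 (T / 4)) (eps * (T / 2) / (1 + a * T)).
have d0 : 0 < delta by rewrite !lt_min ltr01 !divr_gt0// mulr_gt0// divr_gt0.
have d1 : delta <= 1 by rewrite !ge_min lexx.
have dT : delta <= T / 4 by rewrite !ge_min lexx orbT.
have de : delta * (1 + a * T) <= eps * (T / 2).
  by rewrite -ler_pdivlMr// ge_min lexx orbT.
have dT' : delta <= T by lra.
have [D D0 HD] := coercive d0 dT'.
have m0 : 0 < m by lra.
(* Away from [T], [t^(m-1)] is at most [(m - 1) * (G t + a * t)], while [t] and [T] are both at most
   [D * G t]. *)
exists (m - 1 + m * a * D).
  by apply: addr_ge0; [exact: ltW|rewrite !mulr_ge0// ltW].
move=> t t0; have [far|close] := leP delta `|t - T|.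
  have G0 := G_ge0 t0; have H := HD t t0 far.
  have tD : t <= D * G t by apply: le_trans H; rewrite le_max lexx.
  have TD : T <= D * G t by apply: le_trans H; rewrite le_max lexx orbT.
  rewrite (wellE t0); apply: (@le_trans _ _ (t * (t `^ (m - 1) + a * T))).
    rewrite mulrDr lerD//.
      rewrite (_ : t * _ = t `^ m).
        by apply: ge0_ler_powR; rewrite ?nnegrE ?well_dist_le ?(ltW m0)//; exact: normr_ge0.
      by rewrite (powRB1 m2 t0) (powRB2 m2 t0) mulrC -mulrA.
    by rewrite mulrC ler_wpM2r ?well_dist_le// mulr_ge0// ltW.
  rewrite -[leLHS]add0r lerD//; first by rewrite mulr_ge0// ltW.
  rewrite [leRHS]mulrCA ler_wpM2l//.
  have E : t `^ (m - 1) = (m - 1) * (G t + a * t - lam).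
    rewrite /G; move: (t `^ _) => u; rewrite /k; field; exact: lt0r_neq0.
  have l0 : 0 <= (m - 1) * lam.
    rewrite /lam (_ : _ * _ = a * T * (m - 2)); last by field; rewrite gt_eqF.
    by rewrite !mulr_ge0// ltW.
  rewrite E; move: tD TD l0; move: (G t) G0 => u u0 tD TD l0.
  have h1 := ler_wpM2l (mulr_ge0 (ltW m1) (ltW a0)) tD.
  have h2 := ler_wpM2l (ltW a0) TD.
  by move: (lam) (T) l0 h1 h2 => l x; lra.
have tT : T / 2 < t by move: close; rewrite ltr_norml => /andP[]; lra.
rewrite well_dist_high//; move: close; move: `|t - T| (normr_ge0 (t - T)) => x x0 xd.
rewrite -[leLHS]addr0 lerD//; last first.
  apply: mulr_ge0; last exact: well_ge0.
  by apply: addr_ge0; [exact: ltW|rewrite !mulr_ge0// ltW].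
have xm : x `^ m <= x.
  have x1 : x <= 1 by exact: le_trans (ltW xd) d1.
  rewrite (powRB2 m2 x0) expr2 mulrA ler_piMl// mulr_ile1 ?powR_ge0//.
  have := ge0_ler_powR (ltW mb) _ _ x1; rewrite powR1; apply; by rewrite nnegrE.
apply: (@le_trans _ _ (delta * (1 + a * T))).
  apply: (@le_trans _ _ (x * (1 + a * T))); last by rewrite ler_wpM2r// ltW.
  by rewrite mulrDr mulr1 lerD// mulrC.
by apply: (le_trans de); rewrite ler_wpM2l// ltW// ltW.
Qed.

(** Coercivity with [delta = T] handles [t > 2 * T]. The bound lets the error in the interaction
    energy be absorbed by the integral of the well. *)
Lemma sqr_well_bound : exists2 D, 0 < D &
  forall t, 0 <= t -> t ^+ 2 <= 2 * T * t + D * well t.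
Proof.
have [D D0 HD] := coercive T0 (lexx _); exists D => // t t0.
have Tp := T0; have w0 := well_ge0 t0; have [tT|tT] := leP t (2 * T).
  rewrite -[leLHS]addr0 lerD//; first by rewrite expr2 ler_wpM2r.
  by rewrite mulr_ge0// ltW.
rewrite -[leLHS]add0r lerD//; first by rewrite !mulr_ge0// ltW.
rewrite (wellE t0) mulrCA expr2 ler_wpM2l//.
apply: le_trans (HD t t0 _); first by rewrite le_max lexx.
by rewrite ler_normr; apply/orP; left; lra.
Qed.

End well.

Section stability.
Context {R : realType} {n : nat}.
Local Notation mu := (lebesgue_rV R n).
Local Notation V := ('rV[R]_n).
Variables (m a M r : R).
Hypotheses (m2 : 2 < m) (a0 : 0 < a) (M0 : 0 < M).
Local Notation T := (plateau m a).
Local Notation B := (eball r : set V).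
Hypothesis Bvol : mu B = (M / T)%:E.

Let m0 : 0 < m. Proof. exact: lt_trans m2. Qed.
Let T0 : 0 < T. Proof. exact: plateau_gt0. Qed.
Let aT0 : 0 < a * T. Proof. exact: mulr_gt0. Qed.

(** The real value of the integral of the well on a density of mass [M], see [integral_well]; this
    form displays it as [F_0] up to the constant [multiplier m a * M]. *)
Definition well_int (rho : V -> R) : R :=
  (m - 1)^-1 * powint m rho - a * sqint rho + multiplier m a * M.

Let powR_sum (x y z : R) : 0 <= x -> 0 <= y -> 0 <= z -> x <= y + z ->
  x `^ m <= 2 `^ m * (y `^ m + z `^ m).
Proof.
move=> x0 y0 z0 xyz; have w0 : 0 <= Num.max y z by rewrite le_max y0.
apply: (@le_trans _ _ ((2 * Num.max y z) `^ m)).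
  apply: ge0_ler_powR; rewrite ?nnegrE ?mulr_ge0 ?(ltW m0)//.
  by apply: (le_trans xyz); rewrite mulrDl mul1r lerD// le_max lexx ?orbT.
rewrite powRM// ler_wpM2l ?powR_ge0//.
by case: (leP y z) => _; rewrite ?lerDl ?lerDr powR_ge0.
Qed.

Section one_density.
Variable rho : V -> R.
Hypotheses (mr : measurable_fun setT rho) (r0 : forall x, 0 <= rho x)
  (rM : (\int[mu]_x (rho x)%:E = M%:E)%E) (rm : (\int[mu]_x (rho x `^ m)%:E < +oo)%E).

Lemma measurable_well_comp : measurable_fun setT (fun x => well m a (rho x)).
Proof.
apply: measurable_funD; last exact: measurable_funM.
apply: measurable_funB; apply: measurable_funM => //.
- exact: measurable_powRm.
- exact: measurable_funX.
Qed.

Lemma integral_well : (\int[mu]_x (well m a (rho x))%:E = (well_int rho)%:E)%E.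
Proof.
have l0 : 0 <= multiplier m a.
  rewrite mulr_ge0 ?(ltW aT0)// subr_ge0 invf_le1; last by move: m2; lra.
  by move: m2; lra.
have k0 : 0 <= (m - 1)^-1 by rewrite invr_ge0; move: m2; lra.
have mw := measurable_well_comp; have mp := measurable_powRm m mr.
have w0 x : 0 <= well m a (rho x) by exact: well_ge0.
have q0 x : 0 <= rho x ^+ 2 by exact: sqr_ge0.
have p0 x : 0 <= rho x `^ m by exact: powR_ge0.
(* The negative term changes sides so that all integrands are nonnegative. *)
have E : (\int[mu]_x (well m a (rho x) + a * rho x ^+ 2)%:E =
    \int[mu]_x ((m - 1)^-1 * rho x `^ m + multiplier m a * rho x)%:E)%E.
  apply: eq_integral => x _; congr EFin; rewrite /well.
  by move: (rho x `^ m) => u; ring.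
have mq : measurable_fun setT (fun x => rho x ^+ 2) by exact: measurable_funX.
have maq : measurable_fun setT (fun x => a * rho x ^+ 2) by exact: measurable_funM.
have mkp : measurable_fun setT (fun x => (m - 1)^-1 * rho x `^ m).
  exact: measurable_funM.
have mlr : measurable_fun setT (fun x => multiplier m a * rho x).
  exact: measurable_funM.
have aq0 x : 0 <= a * rho x ^+ 2 by apply: mulr_ge0 => //; exact: ltW.
have kp0 x : 0 <= (m - 1)^-1 * rho x `^ m by exact: mulr_ge0.
have lr0 x : 0 <= multiplier m a * rho x by exact: mulr_ge0.
move: E; rewrite (nnintD mu mw maq w0 aq0) (nnintD mu mkp mlr kp0 lr0).
rewrite (nnintZ mu mq q0 (ltW a0)) (nnintZ mu mp p0 k0) (nnintZ mu mr r0 l0) rM.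
rewrite (powintE rm) (sqintE m2 mr r0 rM rm).
case: (\int[mu]_x _)%E => [t|//|//] [E]; congr EFin.
apply: (addIr (a * sqint rho)); rewrite [LHS]E /well_int; ring.
Qed.

Lemma well_int_ge0 : 0 <= well_int rho.
Proof.
by rewrite -lee_fin -integral_well; apply: nnint_ge0 => x; exact: well_ge0.
Qed.

Let A := [set x | T / 2 < rho x].

Let mA : measurable A. Proof. exact: measurable_lt_set. Qed.
Let mB : measurable B. Proof. exact: measurable_eball. Qed.

(** The indicator of the symmetric difference of [A] and [B]. *)
Let D (x : V) : R := \1_(A `\` B) x + \1_(B `\` A) x.

Let mD : measurable_fun setT D.
Proof. by apply: measurable_funD; apply: measurable_indic; exact: measurableD. Qed.

Let D0 x : 0 <= D x. Proof. by rewrite addr_ge0. Qed.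

Let mTD : measurable_fun setT (fun x => T * D x). Proof. exact: measurable_funM. Qed.
Let TD0 x : 0 <= T * D x. Proof. by apply: mulr_ge0 => //; exact: ltW. Qed.

Let phi x := well_dist m a (rho x).

Let mphi : measurable_fun setT phi.
Proof. exact: (measurableT_comp (measurable_well_dist m a) mr). Qed.

Let phi0 x : 0 <= phi x. Proof. exact: normr_ge0. Qed.

(** The four regions cut out by [A] and [B], with the values there of the indicator of [B], of [D]
    and of [phi]. *)
Variant region_spec x : R -> R -> R -> Prop :=
  | Region_both of A x & B x : region_spec x 1 0 `|rho x - T|
  | Region_level of A x & ~ B x : region_spec x 0 1 `|rho x - T|
  | Region_ball of ~ A x & B x : region_spec x 1 1 (rho x)
  | Region_none of ~ A x & ~ B x : region_spec x 0 0 (rho x).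

Let regionP x : region_spec x (\1_B x) (D x) (phi x).
Proof.
rewrite /D !indicE !in_setD /phi.
have [xA|xA] := boolP (x \in A); have [xB|xB] := boolP (x \in B);
  rewrite /= ?addr0 ?add0r; move: xA xB; rewrite ?notin_setE ?inE => xA xB.
- by rewrite well_dist_high//; constructor.
- by rewrite well_dist_high//; constructor.
- rewrite well_dist_low; last by rewrite leNgt; apply/negP.
  by rewrite ger0_norm//; constructor.
- rewrite well_dist_low; last by rewrite leNgt; apply/negP.
  by rewrite ger0_norm//; constructor.
Qed.

Hypothesis nested : (mu (B `\` A) * mu (A `\` B) = 0)%E.

(** Mass balance: [rho] and [T * \1_B] both have mass [M]. If [B] lies in [A] up to a null set, then
    [T * \1_B + T * D], which is [T] times the indicator of [A], is at most [rho + phi]; in the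
    opposite case [rho + T * D <= T * \1_B + phi]. The mass [M] cancels after integration. *)
Let excess_le : (\int[mu]_x (T * D x)%:E <= \int[mu]_x (phi x)%:E)%E.
Proof.
have Tp := T0.
have mTB : measurable_fun setT (fun x => T * \1_B x).
  by apply: measurable_funM => //; exact: measurable_indic.
have TB0 x : 0 <= T * \1_B x by apply: mulr_ge0 => //; exact: ltW.
have IB : (\int[mu]_x (T * \1_B x)%:E = M%:E)%E.
  have mIB : measurable_fun setT (\1_B : V -> R) by exact: measurable_indic.
  have IB0 x : 0 <= \1_B x :> R by [].
  by rewrite (nnintZ mu mIB IB0 (ltW Tp)) integral_indic_eball Bvol -EFinM /= mulrCA divff ?mulr1// gt_eqF.
have Mfin : M%:E \is a fin_num by [].
move/eqP: nested; rewrite mule_eq0 => /orP[/eqP N0|/eqP N0].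
- have : (\int[mu]_x (T * \1_B x + T * D x)%:E <= \int[mu]_x (rho x + phi x)%:E)%E.
    apply: (nnint_ae_le (N := B `\` A)) => //.
    + exact: measurableD.
    + exact: measurable_funD.
    + exact: measurable_funD.
    + by move=> x; exact: addr_ge0.
    + by move=> x; exact: addr_ge0.
    move=> x xN; have rx := r0 x; have t1 := ler_norm (T - rho x).
    have xA' : A x -> T / 2 < rho x by [].
    case: regionP => xA xB; rewrite ?mulr1 ?mulr0 ?addr0 ?add0r; last exact: addr_ge0.
    + by rewrite distrC; lra.
    + by rewrite distrC; lra.
    + by case: xN.
  by rewrite nnintD// nnintD// IB rM leeD2lE.
- have : (\int[mu]_x (rho x + T * D x)%:E <= \int[mu]_x (T * \1_B x + phi x)%:E)%E.
    apply: (nnint_ae_le (N := A `\` B)) => //.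
    + exact: measurableD.
    + exact: measurable_funD.
    + exact: measurable_funD.
    + by move=> x; exact: addr_ge0.
    + by move=> x; exact: addr_ge0.
    move=> x xN; have rx := r0 x; have t1 := ler_norm (rho x - T).
    case: regionP => xA xB; rewrite ?mulr1 ?mulr0 ?addr0 ?add0r//.
    + by lra.
    + by case: xN.
    + by rewrite addrC.
  by rewrite nnintD// nnintD// IB rM leeD2lE.
Qed.

Let dist_le x :
  `|rho x - T * \1_B x| `^ m <= 2 `^ m * (phi x `^ m + a * T * (T * D x)).
Proof.
have Tp := ltW T0; have rx := r0 x.
(* [D] takes the values [0] and [1], and the [m]-th power of [T] is [a * T^2]. *)
have -> : a * T * (T * D x) = (T * D x) `^ m.
  case: regionP => _ _; rewrite ?mulr0 ?powR0 ?gt_eqF// mulr1 (powRB2 m2 Tp).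
  - by rewrite plateau_powR// mulrA.
  - by rewrite plateau_powR// mulrA.
apply: powR_sum => //; case: regionP => xA xB; rewrite ?mulr1 ?mulr0 ?subr0 ?addr0//.
- by rewrite ler_norml; have := ler_norm (rho x - T); have := ler_norm (T - rho x);
    rewrite distrC; lra.
- by rewrite ler_norml; apply/andP; split; lra.
- by rewrite ger0_norm.
Qed.

Lemma integral_dist_le (eps C : R) : 0 <= eps -> 0 <= C ->
  (forall t, 0 <= t ->
     well_dist m a t `^ m + a * T * well_dist m a t <= eps * t + C * well m a t) ->
  (\int[mu]_x (`|rho x - T * \1_B x| `^ m)%:E <=
   (2 `^ m * (eps * M + C * well_int rho))%:E)%E.
Proof.
move=> e0 C0 H; have aT := ltW aT0; have b0 : 0 <= 2 `^ m :> R by exact: powR_ge0.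
have mphim : measurable_fun setT (fun x => phi x `^ m) by exact: measurable_powRm.
have phim0 x : 0 <= phi x `^ m by exact: powR_ge0.
have maTD : measurable_fun setT (fun x => a * T * (T * D x)) by exact: measurable_funM.
have aTD0 x : 0 <= a * T * (T * D x) by exact: mulr_ge0.
have map : measurable_fun setT (fun x => a * T * phi x) by exact: measurable_funM.
have ap0 x : 0 <= a * T * phi x by exact: mulr_ge0.
have md : measurable_fun setT (fun x => `|rho x - T * \1_B x|).
  apply: measurableT_comp => //; apply: measurable_funB => //.
  by apply: measurable_funM => //; exact: measurable_indic.
apply: (@le_trans _ _
    (\int[mu]_x (2 `^ m * (phi x `^ m + a * T * (T * D x)))%:E)%E).
  apply: nnint_le => //.
  - exact: (measurable_powRm m md).
  - by apply: measurable_funM => //; exact: measurable_funD.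
rewrite nnintZ//; last 2 first.
- exact: measurable_funD.
- by move=> x; exact: addr_ge0.
rewrite EFinM; apply: lee_wpmul2l; first by rewrite lee_fin.
rewrite (nnintD mu mphim maTD phim0 aTD0) (nnintZ mu mTD TD0 aT).
apply: (@le_trans _ _ (\int[mu]_x (phi x `^ m + a * T * phi x)%:E)%E).
  rewrite (nnintD mu mphim map phim0 ap0) (nnintZ mu mphi phi0 aT).
  by apply: leeD => //; apply: lee_wpmul2l => //; rewrite lee_fin.
have mw := measurable_well_comp.
have w0 x : 0 <= well m a (rho x) by exact: well_ge0.
have mer : measurable_fun setT (fun x => eps * rho x) by exact: measurable_funM.
have mCw : measurable_fun setT (fun x => C * well m a (rho x)).
  exact: measurable_funM.
have er0 x : 0 <= eps * rho x by exact: mulr_ge0.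
have Cw0 x : 0 <= C * well m a (rho x) by exact: mulr_ge0.
apply: (@le_trans _ _ (\int[mu]_x (eps * rho x + C * well m a (rho x))%:E)%E).
  apply: nnint_le => //.
  - exact: measurable_funD.
  - exact: measurable_funD.
  - by move=> x; exact: addr_ge0.
  - by move=> x; exact: H.
rewrite (nnintD mu mer mCw er0 Cw0) (nnintZ mu mr r0 e0) (nnintZ mu mw w0 C0).
by rewrite rM integral_well -!EFinM -EFinD.
Qed.

End one_density.

(** The constant is the same for all densities, so the estimate can be applied along the whole
    family of minimizers. *)
Lemma well_stability (eps : R) : 0 < eps -> exists2 C : R, 0 <= C &
  forall rho : V -> R, measurable_fun setT rho -> (forall x, 0 <= rho x) ->
  (\int[mu]_x (rho x)%:E = M%:E)%E -> (\int[mu]_x (rho x `^ m)%:E < +oo)%E ->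
  (mu (B `\` [set x | T / 2 < rho x]%R) * mu ([set x | T / 2 < rho x]%R `\` B) = 0)%E ->
  (\int[mu]_x (`|rho x - T * \1_B x| `^ m)%:E <= (eps + C * well_int rho)%:E)%E.
Proof.
move=> e0; have b0 : 0 < 2 `^ m :> R by exact: powR_gt0.
have e1 : 0 < eps / (2 `^ m * M) by rewrite divr_gt0 ?mulr_gt0.
have [C C0 HC] := well_dist_bound m2 a0 e1.
exists (2 `^ m * C); first by rewrite mulr_ge0// ltW.
move=> rho mr r0 rM rm nested.
apply: (le_trans (integral_dist_le mr r0 rM rm nested (ltW e1) C0 HC)).
rewrite lee_fin; move: (2 `^ m) (well_int rho) b0 => u w u0.
rewrite le_eqVlt; apply/orP; left; apply/eqP; field.
by rewrite !gt_eqF.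
Qed.

End stability.

Section norm_limit.
Context {R : realType} {n : nat}.
Local Notation mu := (lebesgue_rV R n).

Lemma Lnorm_le (m e : R) (f : 'rV[R]_n -> R) : 0 < m -> 0 <= e ->
  (\int[mu]_x (`|f x| `^ m)%:E <= (e `^ m)%:E)%E ->
  ('N[mu]_(m%:E)[EFin \o f] <= e%:E)%E.
Proof.
move=> m0 e0 H; rewrite unlock /Lnorm.
have m1 : 0 <= m^-1 by rewrite invr_ge0 ltW.
have E : (e%:E = (e `^ m)%:E `^ m^-1)%E.
  by rewrite poweR_EFin -powRrM divff ?gt_eqF// powRr1.
rewrite [leRHS]E; apply: gt0_ler_poweR => //.
- by rewrite in_itv/= leey andbT; apply: integral_ge0 => x _; rewrite lee_fin; exact: powR_ge0.
- by rewrite in_itv/= leey andbT lee_fin powR_ge0.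
Qed.

End norm_limit.

Section ball_interaction.
Context {R : realType} {n : nat}.
Hypothesis n0 : (0 < n)%N.
Local Notation mu := (lebesgue_rV R n).
Local Notation V := ('rV[R]_n).

Lemma interaction_square_scale (s c : R) (f : V -> R) : 0 <= c ->
  measurable_fun setT f -> (forall x, 0 <= f x) ->
  interaction s (fun x => c * f x) (fun x => c * f x) =
  ((c ^+ 2)%:E * interaction s f f)%E.
Proof.
move=> c0 mf f0; have mK := @measurable_riesz_kernel R n s.
have K0 x : 0 <= riesz_kernel s x by exact: riesz_kernel_ge0.
pose F (x y : V) := riesz_kernel s (x - y) * f x * f y.
have mF : measurable_fun setT (fun z : V * V => F z.1 z.2).
  exact: measurable_kernel2.
have F0 x y : 0 <= F x y by rewrite /F; nonneg.
have c2 : 0 <= c ^+ 2 by exact: sqr_ge0.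
rewrite /interaction.
rewrite -(ge0_integralZl_EFin mu measurableT _ (dint_measurable mu mF F0) c2); last first.
  by move=> x _; exact: nnint_ge0.
apply: eq_integral => x _.
rewrite -(nnintZ mu (dint_measurable_sec x mF) (F0 x) c2).
by apply: eq_integral => y _; congr EFin; rewrite /F; ring.
Qed.

Lemma bernoulli_pow (x : R) : 0 <= x <= 1 -> 1 - n%:R * x <= (1 - x) ^+ n.
Proof.
move=> /andP[x0 x1]; elim: n => [|k IH]; first by rewrite mul0r subr0 expr0.
have y0 : 0 <= 1 - x by rewrite subr_ge0.
rewrite exprS; apply: le_trans (ler_wpM2l y0 IH); rewrite -natr1.
rewrite -subr_ge0 (_ : _ - _ = k%:R * x ^+ 2); last by ring.
by rewrite mulr_ge0// sqr_ge0.
Qed.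

(** As [s] tends to [0] the kernel concentrates at the origin. [interaction_eball_ge] with depth
    [r * x] loses little volume, by Bernoulli's inequality, and its factors [near_mass s] and
    [(r * x)^(2 * s)] tend to [1]. *)
Lemma interaction_eball_near (r e : R) : 0 < r -> 0 < e ->
  \forall s \near 0^'+, ((fine (mu (eball r)) - e)%:E <=
    interaction s (\1_(eball r) : V -> R) \1_(eball r))%E.
Proof.
move=> r0 e0; pose w := unit_ball_volume (R := R) (n := n).
have w0 : 0 < w by exact: unit_ball_volume_gt0.
have [b bE] : {b | b = r ^+ n * w} by exists (r ^+ n * w).
have b0 : 0 < b by rewrite bE mulr_gt0 ?exprn_gt0.
have nR : 0 < n%:R :> R by rewrite ltr0n.
have E1 : 0 < e / (2 * n%:R * b) by rewrite divr_gt0 ?mulr_gt0.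
(* [x] spends [e / 2] on the volume lost by shrinking the ball; [eta] below spends the other half on
   the two factors. *)
pose x := Num.min (1 / 2) (e / (2 * n%:R * b)).
have x0 : 0 < x by rewrite lt_min E1 andbT; lra.
have x1 : x <= 1 / 2 by rewrite ge_min lexx.
have xe : n%:R * x * b <= e / 2.
  have : x <= e / (2 * n%:R * b) by rewrite ge_min lexx orbT.
  rewrite ler_pdivlMr ?mulr_gt0// => h.
  by rewrite ler_pdivlMr//; apply: le_trans h; rewrite le_eqVlt; apply/orP; left; apply/eqP; ring.
have rx : 0 < r * (1 - x) by rewrite mulr_gt0// subr_gt0; lra.
have [b' b'E] : {b' | b' = (r * (1 - x)) ^+ n * w} by exists ((r * (1 - x)) ^+ n * w).
have b'b : b - e / 2 <= b'.
  rewrite b'E exprMn mulrAC -bE; have x01 : 0 <= x <= 1 by lra.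
  have := ler_wpM2l (ltW b0) (bernoulli_pow x01).
  by apply: le_trans; rewrite mulrBr mulr1 lerB// mulrC.
have b'0 : 0 <= b' by rewrite b'E mulr_ge0 ?exprn_ge0// ltW.
have b'le : b' <= b.
  rewrite b'E bE ler_wpM2r ?(ltW w0)// lerXn2r ?nnegrE ?(ltW rx) ?(ltW r0)//.
  by rewrite ler_piMr ?(ltW r0)//; lra.
pose eta := Num.min 1 (e / (2 * b)).
have eta0 : 0 < eta by rewrite lt_min ltr01 divr_gt0// mulr_gt0.
have eta1 : eta <= 1 by rewrite ge_min lexx.
have etab : eta * b <= e / 2.
  have : eta <= e / (2 * b) by rewrite ge_min lexx orbT.
  by rewrite ler_pdivlMr ?mulr_gt0// mulrCA => h; rewrite ler_pdivlMr// mulrC.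
have [d2 d2E] : {d2 | d2 = (r * x) ^+ 2} by exists ((r * x) ^+ 2).
have d20 : 0 < d2 by rewrite d2E exprn_gt0// mulr_gt0.
have L0 : 0 < 1 + `|ln d2| by rewrite ltr_wpDr.
have eta2 : 0 < eta / 2 by rewrite divr_gt0.
have eL : 0 < eta / 2 / (1 + `|ln d2|) by rewrite divr_gt0.
near=> s; have sI : 0 < s < 1 / 2 by near: s; exact: near_half.
have s0 : 0 < s by case/andP: sI.
have sn := double_lt_dim n0 sI.
have rx0 : 0 < r * x by exact: mulr_gt0.
apply: le_trans (interaction_eball_ge n0 s0 sn r rx0).
rewrite (_ : r - r * x = r * (1 - x)); last by ring.
rewrite lebesgue_eball// lebesgue_eball// -EFinM lee_fin /= -/w -bE -b'E -d2E.
have A1 : 1 - eta / 2 <= near_mass (n := n) s.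
  have : `|near_mass (n := n) s - 1| <= eta / 2 by near: s; exact: near_mass_near.
  by rewrite ler_norml => /andP[]; lra.
have A2 : 1 - eta / 2 <= d2 `^ s.
  rewrite /powR gt_eqF//; apply: le_trans (expR_ge1Dx _).
  have : s <= eta / 2 / (1 + `|ln d2|).
    by apply: ltW; near: s; exact: nbhs_right_lt.
  rewrite ler_pdivlMr// => h; have l1 : - `|ln d2| <= ln d2 by rewrite lerNnormlW.
  have := ler_wpM2l (ltW s0) l1; move: h; move: (ln d2) => l; lra.
have A3 : 1 - eta <= near_mass (n := n) s * d2 `^ s.
  have e3 : 0 <= 1 - eta / 2 by lra.
  apply: le_trans (ler_pM e3 e3 A1 A2); rewrite -subr_ge0.
  rewrite (_ : _ - _ = (eta / 2) ^+ 2) ?sqr_ge0//; by field.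
apply: le_trans (ler_wpM2r b'0 A3).
have := ler_wpM2l (ltW eta0) b'le; move: b'b etab; lra.
Unshelve. all: by end_near. Qed.

End ball_interaction.

(** * Concentration on the plateau density *)

Section concentration.
Context {R : realType} {n : nat}.
Hypothesis n0 : (0 < n)%N.
Local Notation mu := (lebesgue_rV R n).
Local Notation V := ('rV[R]_n).
Variables (m chi beta M r : R).
Hypotheses (m2 : 2 < m) (chi0 : 0 < chi) (beta0 : 0 <= beta) (M0 : 0 < M)
  (beta_chi : beta < chi / 2) (r_gt0 : 0 < r).
Local Notation a := (chi / 2 - beta).
Local Notation T := (plateau m a).
Local Notation B := (eball r : set V).
Hypothesis Bvol : mu B = (M / T)%:E.

Let m0 : 0 < m. Proof. exact: lt_trans m2. Qed.
Let a0 : 0 < a. Proof. by rewrite subr_gt0. Qed.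
Let T0 : 0 < T. Proof. exact: plateau_gt0. Qed.

Definition plateau_density (x : V) : R := T * \1_B x.
Local Notation rstar := plateau_density.

Let fBvol : fine (mu B) = M / T. Proof. by rewrite Bvol. Qed.

Lemma density_plateau : density m M rstar.
Proof.
have := density_eball (n := n) m0 (ltW T0) r_gt0.
by rewrite fBvol mulrCA divff ?gt_eqF// mulr1.
Qed.

Lemma radially_decreasing_plateau : radially_decreasing rstar.
Proof.
have dec x y : enorm x <= enorm y -> rstar y <= rstar x.
  move=> xy; rewrite /rstar ler_wpM2l ?(ltW T0)// !indicE ler_nat.
  have [yB|yB] := boolP (y \in B); last exact: leq0n.
  by rewrite mem_set//; move: yB; rewrite inE /eball /=; exact: le_trans.
split=> // x y xy; apply/eqP; rewrite eq_le; apply/andP; split; apply: dec.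
- by rewrite xy.
- by rewrite xy.
Qed.

Lemma sqint_plateau : sqint rstar = T * M.
Proof.
rewrite (sqint_eball r (ltW T0)) fBvol expr2 -mulrA; congr (_ * _).
by rewrite mulrCA divff ?gt_eqF// mulr1.
Qed.

Lemma well_int_plateau : well_int m a M rstar = 0.
Proof.
rewrite /well_int sqint_plateau (powint_eball m2 r (ltW T0)) fBvol.
have E := well_plateau m2 a0; have : M / T * well m a T = 0 by rewrite E mulr0.
rewrite /well; have Tn : T != 0 by rewrite gt_eqF.
move: (T `^ m) (T) Tn => u t tn <-; rewrite !mulrDr mulrN.
congr (_ - _ + _); first by ring.
  by field.
by field.
Qed.

Lemma free_energy0E (rho : V -> R) : density m M rho ->
  free_energy0 m chi beta rho = (well_int m a M rho - multiplier m a * M)%:E.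
Proof.
move=> rD; have [mr r0 rM rm _] := (densityP M rho m0).1 rD.
rewrite /free_energy0 (powintE rm) (sqintE m2 mr r0 rM rm).
rewrite -(EFinM (m - 1)^-1) -(EFinM (beta - _)) -EFinD; congr EFin.
by rewrite /well_int; ring.
Qed.

Lemma minimizer_plateau : minimizer (free_energy0 m chi beta) (density m M) rstar.
Proof.
split; first exact: density_plateau.
move=> eta etaD; have [me e0 eM em _] := (densityP M eta m0).1 etaD.
rewrite (free_energy0E etaD) (free_energy0E density_plateau) lee_fin lerD2r.
by rewrite well_int_plateau (well_int_ge0 m2 a0 me e0 eM em).
Qed.

(** The level set of a radially decreasing function is nested with every ball, and a minimizer has
    [well_int] at most [0]; [well_stability] then applies with arbitrarily small [eps]. *)
Lemma radial_minimizer_unique :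
  ae_unique (minimizer (free_energy0 m chi beta) (density m M) `&`
             radially_decreasing) rstar.
Proof.
split; first by split; [exact: minimizer_plateau|exact: radially_decreasing_plateau].
move=> eta [[etaD etamin] [_ etadec]].
have [me e0 eM em _] := (densityP M eta m0).1 etaD.
have wi : well_int m a M eta <= 0.
  have := etamin _ density_plateau.
  rewrite (free_energy0E etaD) (free_energy0E density_plateau) lee_fin lerD2r.
  by rewrite well_int_plateau.
have nested : (mu (B `\` [set x | T / 2 < eta x]%R) *
    mu ([set x | T / 2 < eta x]%R `\` B) = 0)%E.
  have [->|/set0P[y [yA yB]]] := eqVneq ([set x | T / 2 < eta x]%R `\` B) set0.
    by rewrite measure0 mule0.
  rewrite (_ : B `\` _ = set0) ?measure0 ?mul0e//.
  rewrite -subset0 => x [xB xA].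
  have xy : enorm x <= enorm y.
    by apply: (le_trans xB); apply: ltW; rewrite ltNge; apply/negP.
  by apply: xA; exact: lt_le_trans (etadec _ _ xy).
have md : measurable_fun setT (fun x => `|eta x - rstar x|).
  apply: measurableT_comp => //; apply: measurable_funB => //.
  by have [] := (densityP M rstar m0).1 density_plateau.
have mdm := measurable_powRm m md.
have dm0 x : 0 <= `|eta x - rstar x| `^ m by exact: powR_ge0.
have d0 : (\int[mu]_x (`|eta x - rstar x| `^ m)%:E = 0)%E.
  apply/eqP; rewrite eq_le; apply/andP; split; last exact: nnint_ge0.
  apply/lee_addgt0Pr => eps eps0; rewrite add0e.
  have [C C0 H] := well_stability m2 a0 M0 Bvol eps0.
  apply: (le_trans (H eta me e0 eM em nested)).
  by rewrite lee_fin gerDl mulr_ge0_le0.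
apply: filterS (nnint_eq0 mdm dm0 d0) => x /= + xT => /(_ xT) /eqP.
by rewrite powR_eq0 normr_eq0 subr_eq0 => /andP[/eqP].
Qed.

Variable rho : R -> V -> R.
Hypothesis rho_min : forall s, 0 < s < 1 / 2 ->
  ae_unique (minimizer (free_energy m chi beta s) (density m M)) (rho s).

Let selfint_near (e : R) : 0 < e ->
  \forall s \near 0^'+, sqint rstar - selfint s rstar <= e.
Proof.
move=> e0; have T2 : 0 < T ^+ 2 by rewrite exprn_gt0.
have e1 : 0 < e / T ^+ 2 by rewrite divr_gt0.
near=> s; have sI : 0 < s < 1 / 2 by near: s; exact: near_half.
have s0 : 0 < s by case/andP: sI.
have sn := double_lt_dim n0 sI.
have [mp p0 pM pm _] := (densityP M rstar m0).1 density_plateau.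
have mB : measurable_fun setT (\1_B : V -> R).
  by apply: measurable_indic; exact: measurable_eball.
have B0 x : 0 <= \1_B x :> R by [].
have h : ((fine (mu B) - e / T ^+ 2)%:E <= interaction s (\1_B : V -> R) \1_B)%E.
  by near: s; exact: interaction_eball_near.
have T2' : (0 <= (T ^+ 2)%:E)%E by rewrite lee_fin ltW.
have := lee_wpmul2l T2' h.
rewrite -(interaction_square_scale s (ltW T0) mB B0).
rewrite (selfintE n0 m2 mp p0 pM pm s0 sn) -EFinM lee_fin fBvol mulrBr.
rewrite [X in _ - X <= _]mulrCA divff ?gt_eqF// mulr1 sqint_plateau.
rewrite (_ : T ^+ 2 * (M / T) = T * M); last by field; rewrite gt_eqF.
by move: (T * M) (selfint _ _) => u i; lra.
Unshelve. all: by end_near. Qed.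

(** Minimality against the plateau, whose interaction is close to its square integral by
    [selfint_near]. The unknown [sqint (rho s)] in the error is itself bounded through [well_int],
    by [sqr_well_bound]. *)
Let well_int_near (e : R) : 0 < e ->
  \forall s \near 0^'+, well_int m a M (rho s) <= e.
Proof.
move=> e0; have [D D0 HD] := sqr_well_bound m2 a0.
have Tp := T0; have chip := chi0; have c2 : 0 <= chi / 2 by lra.
have TM : 0 < T * M by exact: mulr_gt0.
(* [e2] absorbs half of [well_int]; [e1], [e3] and [e4] leave errors of at most [e / 6] each. *)
have e1 : 0 < e / 3 / (2 * chi * (T * M)) by rewrite divr_gt0 ?mulr_gt0 ?divr_gt0.
have e2 : 0 < (chi * D)^-1 by rewrite invr_gt0 mulr_gt0.
have e3 : 0 < e / 3 / (chi * M ^+ 2) by rewrite divr_gt0 ?mulr_gt0 ?divr_gt0 ?exprn_gt0.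
have e4 : 0 < e / 3 / chi by rewrite !divr_gt0.
near=> s; have sI : 0 < s < 1 / 2 by near: s; exact: near_half.
have s0 : 0 < s by case/andP: sI.
have sn := double_lt_dim n0 sI; have rmin := rho_min sI.
have rD : density m M (rho s) by have [[]] := rmin.
have [mr r0 rM rm _] := (densityP M (rho s) m0).1 rD.
have en := minimal_energy_le n0 m2 s0 sn rmin density_plateau.
have ile := selfint_le n0 m2 mr r0 rM rm s0 sn.
have w0 := well_int_ge0 m2 a0 mr r0 rM rm.
have qw : sqint (rho s) <= 2 * T * M + D * well_int m a M (rho s).
  have mw := measurable_well_comp m a mr.
  have wx0 x : 0 <= well m a (rho s x) by exact: well_ge0.
  have T2 : 0 <= 2 * T by rewrite mulr_ge0// ltW.
  rewrite -lee_fin -(sqintE m2 mr r0 rM rm).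
  apply: (@le_trans _ _ (\int[mu]_x (2 * T * rho s x + D * well m a (rho s x))%:E)%E).
    apply: nnint_le.
    - exact: measurable_funX.
    - by apply: measurable_funD; exact: measurable_funM.
    - by move=> x; exact: sqr_ge0.
    - by move=> x; exact: HD.
  rewrite nnintD; last 4 first.
  - exact: measurable_funM.
  - exact: measurable_funM.
  - by move=> x; exact: mulr_ge0.
  - by move=> x; apply: mulr_ge0 => //; exact: ltW.
  rewrite (nnintZ mu mr r0 T2) (nnintZ mu mw wx0 (ltW D0)) rM.
  by rewrite (integral_well m2 a0 mr r0 rM rm) -!EFinM -EFinD.
have q0 := sqint_ge0 (rho s).
have A1 : `|near_mass (n := n) s - 1| <= e / 3 / (2 * chi * (T * M)).
  by near: s; exact: near_mass_near.
have A2 : `|near_mass (n := n) s - 1| <= (chi * D)^-1.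
  by near: s; exact: near_mass_near.
have cs : riesz_const n s <= e / 3 / (chi * M ^+ 2).
  by near: s; exact: riesz_const_near.
have si : sqint rstar - selfint s rstar <= e / 3 / chi.
  by near: s; exact: selfint_near.
have wp := well_int_plateau.
move: A1 A2 ile; set b := near_mass s - 1.
rewrite (_ : near_mass s = 1 + b); last by rewrite /b addrC subrK.
move: b en cs si w0 wp qw q0; rewrite /well_int.
move: (powint m (rho s)) (sqint (rho s)) (selfint s (rho s)) (powint m rstar)
  (sqint rstar) (selfint s rstar) (riesz_const n s) (multiplier m a) (m - 1)^-1
  => p q i p' q' i' c l k b en cs si.
set w := k * p - a * q + l * M.
have [v vE] : {v | v = w} by exists w.
rewrite -!vE => w0 wp qw q0 A1 A2 ile.
have {}cs : c * (chi * M ^+ 2) <= e / 3 by rewrite -ler_pdivlMr ?mulr_gt0 ?exprn_gt0.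
have {}A1 : `|b| * (2 * chi * (T * M)) <= e / 3 by rewrite -ler_pdivlMr ?mulr_gt0.
have {}A2 : `|b| * (chi * D) <= 1.
  by rewrite -ler_pdivlMr ?mulr_gt0// mul1r.
have {}si : (q' - i') * chi <= e / 3 by rewrite -ler_pdivlMr.
have bq : b * q <= `|b| * (2 * T * M + D * v).
  apply: (@le_trans _ _ (`|b| * q)); first by rewrite ler_wpM2r// ler_norm.
  by rewrite ler_wpM2l.
have t1 := ler_wpM2l c2 ile; have t2 := ler_wpM2l c2 bq; have t3 := ler_wpM2r w0 A2.
have {}vE : v = k * p - a * q + l * M := vE.
move: t1 t2 t3 cs A1 si en wp vE.
move: (T) (`|b|) => t x.
rewrite (mulrDl 1) mul1r.
have -> : chi / 2 * (x * (2 * t * M + D * v)) = x * (2 * chi * (t * M)) / 2 +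
  x * (chi * D) * v / 2 by field.
have -> : chi / 2 * (q + b * q + c * M ^+ 2) =
  chi / 2 * q + chi / 2 * (b * q) + c * (chi * M ^+ 2) / 2 by field.
have -> : (q' - i') * chi = 2 * (chi / 2 * q') - 2 * (chi / 2 * i') by field.
rewrite !mulrBl.
move: (x * (2 * chi * (t * M))) (x * (chi * D) * v) (c * (chi * _)) (chi / 2 * (b * q)).
move: (chi / 2 * i) (chi / 2 * i') (chi / 2 * q) (chi / 2 * q') (beta * q) (beta * q')
  (k * p) (k * p') (l * M).
by move=> y1 y2 y3 y4 y5 y6 y7 y8 y9 z1 z2 z3 z4; rewrite mul1r; lra.
Unshelve. all: by end_near. Qed.

Lemma plateau_limit :
  ('N[mu]_(m%:E)[EFin \o (rho s \- rstar)%R])%E @[s --> 0^'+] --> 0%E.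
Proof.
apply: cvge0P => e e0; have em0 : 0 < e `^ m by exact: powR_gt0.
have h0 : 0 < e `^ m / 2 by rewrite divr_gt0.
have [C C0 HC] := well_stability m2 a0 M0 Bvol h0.
have C1 : 0 < C + 1 by rewrite ltr_wpDl.
have e1 : 0 < e `^ m / 2 / (C + 1) by rewrite divr_gt0.
near=> s; have sI : 0 < s < 1 / 2 by near: s; exact: near_half.
have s0 : 0 < s by case/andP: sI.
have sn := double_lt_dim n0 sI; have rmin := rho_min sI.
have rD : density m M (rho s) by have [[]] := rmin.
have [mr r0 rM rm _] := (densityP M (rho s) m0).1 rD.
rewrite gee0_abs ?Lnorm_ge0//; apply: Lnorm_le; [exact: m0|exact: ltW|].
have mA : measurable [set x | T / 2 < rho s x] by exact: measurable_lt_set.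
have nested : (mu (B `\` [set x | T / 2 < rho s x]%R) *
    mu ([set x | T / 2 < rho s x]%R `\` B) = 0)%E.
  (* The inner set [Q] is [B] without the level set, where [rho s] is at most [T / 2]; the outer set
     [P] is the level set without [B]. *)
  apply: (polarized_separation (f := rho s) n0).
  - by apply: measurableD => //; exact: measurable_eball.
  - by apply: measurableD => //; exact: measurable_eball.
  - by move=> v v0; exact: (minimizer_polarize n0 m0 chi0 M0 sn rmin v0).
  - move=> x y [_ xA] [yA _]; apply: le_lt_trans yA.
    by rewrite leNgt; apply/negP.
  - move=> x y [xB _] [_ yB]; apply: (le_lt_trans xB).
    by rewrite ltNge; apply/negP.
apply: (le_trans (HC (rho s) mr r0 rM rm nested)).
have wi : well_int m a M (rho s) <= e `^ m / 2 / (C + 1).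
  by near: s; exact: well_int_near.
have w0 := well_int_ge0 m2 a0 mr r0 rM rm.
rewrite lee_fin; move: wi; rewrite ler_pdivlMr//.
move: (well_int m a M (rho s)) w0 (e `^ m) => w w0 u; rewrite mulrDr mulr1 (mulrC w).
by move=> h; rewrite [leRHS]splitr lerD2l; apply: le_trans h; rewrite lerDl.
Unshelve. all: by end_near. Qed.

End concentration.

Theorem theorem1p2 (R : realType) (d : nat) (m chi beta M : R)
    (rho_ : R -> 'rV[R]_d -> R) :
  (1 <= d)%N -> 2 < m -> 0 < chi -> 0 <= beta -> 0 < M ->
  (forall s : R, 0 < s < 1 / 2 ->
     ae_unique (minimizer (free_energy m chi beta s) (density m M)) (rho_ s)) ->
  (beta < chi / 2 ->
     exists2 rho : 'rV[R]_d -> R, density m M rho &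
       ('N[lebesgue_rV R d]_(m%:E)[EFin \o (rho_ s \- rho)%R])%E
         @[s --> 0^'+] --> 0%E /\
       ae_unique (minimizer (free_energy0 m chi beta) (density m M) `&`
                  radially_decreasing) rho) /\
  (chi / 2 <= beta ->
     free_energy m chi beta s (rho_ s) @[s --> 0^'+] --> 0%E /\
     ('N[lebesgue_rV R d]_+oo[EFin \o rho_ s])%E @[s --> 0^'+] --> 0%E).

Proof.
move=> d1 m2 chi0 beta0 M0 rho_min; split=> [beta_chi|beta_chi]; last first.
  split.
    exact: (vanishing_energy d1 m2 chi0 beta0 M0 rho_min beta_chi).
  exact: (vanishing_sup d1 m2 chi0 beta0 M0 rho_min beta_chi).
have a0 : 0 < chi / 2 - beta by rewrite subr_gt0.
have T0 := plateau_gt0 m a0.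
have [r r_gt0 Bvol] := exists_eball_volume d1 (divr_gt0 M0 T0).
exists (plateau_density m chi beta r); last split.
- exact: (density_plateau m2 beta_chi r_gt0 Bvol).
- exact: (plateau_limit d1 m2 chi0 M0 beta_chi r_gt0 Bvol rho_min).
- exact: (radial_minimizer_unique m2 M0 beta_chi r_gt0 Bvol).
Qed.
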